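(* Let $X$ be the Segerdahl process with $r=1$, $c=0$ and exponential jumps of rate $\mu=1$, i.e. $dX_t=X_t\,dt-d\big(\sum_{i=1}^{N_t}C_i\big)$, where $N$ is a Poisson process of rate $\lambda>0$ and the $C_i$ are i.i.d. exponential of mean $1$, independent of $N$. Let $q\ge0$ and $n=q+\lambda$. With $M$, $U$, $K_1$, $K_2$, $T_{a,-}$, $T_{b,+}$, $H_q$ as in the context, the following hold. 1. Up to a multiplicative constant, $$H_q(z)=K_1(q,n,z)=z^ne^{-z}M(q+1,n+1,z)=z^nM(\lambda,n+1,-z),$$ where $K_1$ is the unique (up to a constant) $q$-harmonic function which increases on $(0,\infty)$. 2. The ruin function $\Psi_q(z,a)=\mathbb E_z[e^{-qT_{a,-}}]$ is $$\Psi_q(z,a)=\lambda\,\frac{K_2(q,n,z)}{K_2(q,n+1,a)}=\lambda\,\frac{e^{-z}z^nU(q+1,n+1,z)}{e^{-a}a^{n+1}U(q+1,n+2,a)},\qquad z\ge a>0,$$ and, for $a=0$ (using $\lim_{z\to0}z^{q+1+\lambda}U(1+q,q+2+\lambda,z)=\Gamma(1+q+\lambda)/\Gamma(1+q)$), $$\Psi_q(z,0)=\frac{\lambda\,\Gamma(1+q)}{\Gamma(1+q+\lambda)}\,e^{-z}z^nU(q+1,n+1,z).$$ 3. $$\Psi_q(z,a,\theta):=\mathbb E_z\big[e^{-qT_{a,-}+\theta(X_{T_{a,-}}-a)}\big]=\Psi_q(z,a)\,\frac{1}{1+\theta}.$$ 4. For $z\ge a>0$, the scale function (i.e. the function with $\mathbb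 E_z[e^{-qT_{b,+}};T_{b,+}<T_{a,-}]=W_q(z,a)/W_q(b,a)$ for $a\le z\le b$) is given by $$\begin{aligned}W_q(z,a)&=H_q(z)-\Psi_q(z,a)\int_0^ae^{-y}H_q(a-y)\,dy=K_1(q,n,z)-\Psi_q(z,a)\frac{K_1(q,n+1,a)}{n+1}\\&=K_1(q,n,z)-\frac{\lambda}{n+1}\,\frac{K_1(q,n+1,a)}{K_2(q,n+1,a)}\,K_2(q,n,z)\\&=z^ne^{-z}\Big[M(q+1,n+1,z)-\frac{\lambda}{n+1}U(q+1,n+1,z)\frac{M(q+1,n+2,a)}{U(q+1,n+2,a)}\Big].\end{aligned}$$ Since it is only determined up to a constant (a factor not depending on $z$), one may also take $$\begin{aligned}W_q(z,a)&=z^ne^{-z}\begin{vmatrix}M(1+q,\lambda+1+q,z)&M(1+q,\lambda+2+q,a)\\ \lambda\,U(1+q,\lambda+1+q,z)&(\lambda+1+q)\,U(1+q,\lambda+2+q,a)\end{vmatrix}\\&=z^ne^{-z}\big[(\lambda+q+1)M(q+1,n+1,z)U(q+1,n+2,a)-\lambda\,U(q+1,n+1,z)M(q+1,n+2,a)\big].\end{aligned}$$ The second derivative in $z$ (for the first normalization) is $$W_q''(z,a)=K_1''(q,n,z)-\frac{\lambda}{n+1}\frac{K_1(q,n+1,a)}{K_2(q,n+1,a)}K_2''(q,n,z),$$ which implies, at $z=a$, $$\begin{aligned}\frac{e^{a}a^{-n+2}}{\Gamma(n)}\,W_q''(a,a)={}&\frac{{}_1\tilde F_1(q+1;n+2;a)}{n+1}\left(\frac{\lambda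 n\,(an-aq-n^2+n)\,U(q+1,n+1,a)}{U(q+1,n+2,a)}+a(a-n+1)\big((n+1)(n-q)-\lambda n\big)\right)\\&+\big(-(a+1)n+aq+n^2\big)\,{}_1\tilde F_1(q+1;n+1;a),\end{aligned}$$ and it satisfies $$W_q''(0,0)=\frac{(n-1)\,n\left(1-\dfrac{\lambda n\,U(q+1,n+1,0)}{(n+1)^2\,U(q+1,n+2,0)}\right)}{\Gamma(n+1)}<0\quad\text{if and only if}\quad q+\lambda<1 .$$ 5. The two-sided ruin function $\Psi_q^b(z,a)=\mathbb E_z[e^{-qT_{a,-}};T_{a,-}<T_{b,+}]$, $0<a\le z\le b$, $a<b$, satisfies $$\begin{aligned}\Psi_q^b(z,a)&=\Psi_q(z,a)-\frac{W_q(z,a)}{W_q(b,a)}\Psi_q(b,a)\\&=\frac{\lambda}{a}\frac{e^{-z}z^nU(q+1,n+1,z)}{e^{-a}a^nU(q+1,n+2,a)}-\frac{\lambda}{a}\frac{e^{-b}b^nU(q+1,n+1,b)}{e^{-a}a^nU(q+1,n+2,a)}\Big(\frac zb\Big)^ne^{b-z}\,\frac{D(z)}{D(b)},\end{aligned}$$ where $D(u)=(\lambda+q+1)M(q+1,n+1,u)U(q+1,n+2,a)-\lambda\,U(q+1,n+1,u)M(q+1,n+2,a)$.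
   Context: First passage times: $T_{b,+}=\inf\{t\ge0:X_t>b\}$ and $T_{a,-}=\inf\{t\ge0:X_t<a\}$, with $\inf\emptyset=\infty$ and $e^{-q\cdot\infty}:=0$ (also for $q=0$; expectations involving $X_{T_{a,-}}$ are restricted to $T_{a,-}<\infty$). $\mathbb E_z$ denotes expectation with $X_0=z$. For this process $0$ is the absolute ruin level: once below $0$ the process never returns above $0$. $H_q$ is the function on $(0,\infty)$, determined up to a multiplicative constant, with $\mathbb E_z[e^{-qT_{b,+}};T_{b,+}<T_{0,-}]=H_q(z)/H_q(b)$ for $0<z\le b$. A function $h$ on $(0,\infty)$ is $q$-harmonic (for the process absorbed below $0$) if $z h'(z)+\lambda\int_0^zh(z-y)e^{-y}\,dy-(\lambda+q)h(z)=0$, $z>0$. Special functions: $M(\alpha,\beta,z)={}_1F_1(\alpha;\beta;z)$ is Kummer's confluent hypergeometric function; ${}_1\tilde F_1(\alpha;\beta;z)=M(\alpha,\beta,z)/\Gamma(\beta)$ is its regularized version; $U(\alpha,\beta,z)=\frac1{\Gamma(\alpha)}\int_0^\infty e^{-zt}t^{\alpha-1}(1+t)^{\beta-\alpha-1}dt$ ($z>0$, $\alpha>0$) is Tricomi's function. A ratio of two $U$ functions at argument $0$ is understood as the limit of the ratio as the argument decreases to $0$. For parameters $q,m$ set $$K_1(q,m,z)=z^me^{-z}M(q+1,m+1,z),\qquad K_2(q,m,z)=z^me^{-z}U(q+1,m+1,z).$$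
   Formalization: In the W''(a,a) formula Γ(n) is corrected to Γ(n+1), 1/(n+1) to 1/n, and (n+1)(n−q)−λn to n(n−q)−λn; W''(0,0) is read as the limit as a→0+ of e^a a^{2−n} W''(a,a)/Γ(n+1); item 3 takes θ>−1 and z>0. *)

(* Defs.v *)
From HB Require Import structures.
From mathcomp Require Import all_boot all_order all_algebra.
From mathcomp Require Import all_classical all_reals all_analysis.

Set Implicit Arguments.
Unset Strict Implicit.
Unset Printing Implicit Defensive.

Import Order.TTheory GRing.Theory Num.Theory.
Import numFieldNormedType.Exports.

Local Open Scope classical_set_scope.
Local Open Scope ring_scope.

Section SpecialFunctions.
Context {R : realType}.
Local Notation mu := (@lebesgue_measure R).
Implicit Types (alpha beta m q x z : R) (k : nat).

Definition pochhammer x k : R := \prod_(i < k) (x + i%:R).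

(* Euler's integral: meaningful for x > 0, the only case used. *)
Definition Gamma x : R :=
  \int[mu]_(t in `]0, +oo[) (t `^ (x - 1) * expR (- t)).

Definition kummerM alpha beta z : R :=
  limn (series (fun k =>
    pochhammer alpha k / pochhammer beta k * (z ^+ k / k`!%:R))).

Definition kummerM_reg alpha beta z : R := kummerM alpha beta z / Gamma beta.

(* Meaningful for alpha > 0 and z > 0. *)
Definition tricomiU alpha beta z : R :=
  (Gamma alpha)^-1 *
  \int[mu]_(t in `]0, +oo[)
     (expR (- (z * t)) * t `^ (alpha - 1) * (1 + t) `^ (beta - alpha - 1)).

Definition K1 q m z : R := z `^ m * expR (- z) * kummerM (q + 1) (m + 1) z.

Definition K2 q m z : R := z `^ m * expR (- z) * tricomiU (q + 1) (m + 1) z.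

Definition mx22 (x11 x12 x21 x22 : R) : 'M[R]_2 :=
  \matrix_(i, j) if i == 0 then (if j == 0 then x11 else x12)
                 else (if j == 0 then x21 else x22).

(* Harmonicity for claim intensity lam and Exp(1) claims.  Differentiability
   and integrability up to 0 are required explicitly, because derive1 and
   Rintegral are total. *)
Definition q_harmonic (lam q : R) (h : R -> R) : Prop :=
  forall z, 0 < z ->
    [/\ derivable h z 1,
        mu.-integrable `]0, z[ (fun y => (h (z - y) * expR (- y))%:E) &
        z * h^`()%classic z
        + lam * (\int[mu]_(y in `]0, z[) (h (z - y) * expR (- y)))
        - (lam + q) * h z = 0].

End SpecialFunctions.

Section Process.
Context {d : measure_display} {T : measurableType d} {R : realType}.
Variable P : probability T R.

Definition exponential_law (rate : R) (Y : {RV P >-> R}) : Prop :=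
  forall A : set R, measurable A -> distribution P Y A = exponential_prob rate A.

(* As A i = setT is allowed, this is the product rule for every finite
   subfamily. *)
Definition mutually_independent (Y : nat -> {RV P >-> R}) : Prop :=
  forall (k : nat) (A : nat -> set R), (forall i, measurable (A i)) ->
    P (\bigcap_(i < k) (Y i @^-1` A i)) =
    (\prod_(i < k) P (Y i @^-1` A i))%E.

Definition independent_sequences (Y Z : nat -> {RV P >-> R}) : Prop :=
  forall (k : nat) (A B : nat -> set R),
    (forall i, measurable (A i)) -> (forall i, measurable (B i)) ->
    P ((\bigcap_(i < k) (Y i @^-1` A i)) `&` (\bigcap_(i < k) (Z i @^-1` B i))) =
    (P (\bigcap_(i < k) (Y i @^-1` A i)) *
     P (\bigcap_(i < k) (Z i @^-1` B i)))%E.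

(* N is the counting process of the arrival times tau 0 + ... + tau (k - 1),
   with i.i.d. exponential gaps tau. *)
Definition poisson_process (lam : R) (tau : nat -> {RV P >-> R})
    (N : R -> T -> nat) : Prop :=
  [/\ forall k, exponential_law lam (tau k),
      mutually_independent tau &
      forall w t k, 0 <= t -> (k <= N t w)%N = (\sum_(i < k) tau i w <= t)].

Definition iid_exponential (rate : R) (C : nat -> {RV P >-> R}) : Prop :=
  (forall k, exponential_law rate (C k)) /\ mutually_independent C.

(* dX_t = (c + r X_t) dt - d(C_0 + ... + C_(N_t - 1)), X_0 = x, in integrated
   form. *)
Definition segerdahl_process (r c x : R) (N : R -> T -> nat)
    (C : nat -> {RV P >-> R}) (X : R -> T -> R) : Prop :=
  forall w t, 0 <= t ->
    lebesgue_measure.-integrable `[0, t] (fun s => (c + r * X s w)%:E) /\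
    X t w = x + \int[lebesgue_measure]_(s in `[0, t]) (c + r * X s w)
            - \sum_(i < N t w) C i w.

Implicit Types (X : R -> T -> R) (q a b theta : R).

Definition passage_above X b (w : T) : \bar R :=
  ereal_inf [set t%:E | t in [set t : R | 0 <= t /\ b < X t w]].

Definition passage_below X a (w : T) : \bar R :=
  ereal_inf [set t%:E | t in [set t : R | 0 <= t /\ X t w < a]].

(* exp(-q t), with value 0 at t = +oo even when q = 0. *)
Definition discount q (t : \bar R) : R :=
  if t is s%:E then expR (- (q * s)) else 0.

Definition ruin q X a : \bar R :=
  ('E_P[(fun w => discount q (passage_below X a w))%R])%E.

(* The discount factor vanishes where passage_below is infinite, so that the
   value of X at fine +oo is irrelevant. *)
Definition ruin_deficit q theta X a : \bar R :=
  ('E_P[(fun w => discount q (passage_below X a w) *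
       expR (theta * (X (fine (passage_below X a w)) w - a)))%R])%E.

Definition ruin_before q X a b : \bar R :=
  ('E_P[(fun w => discount q (passage_below X a w) *
       (passage_below X a w < passage_above X b w)%E%:R)%R])%E.

Definition exit_above q X a b : \bar R :=
  ('E_P[(fun w => discount q (passage_above X b w) *
       (passage_above X b w < passage_below X a w)%E%:R)%R])%E.

Definition survival_function q (X : R -> R -> T -> R) (H : R -> R) : Prop :=
  forall z b, 0 < z -> z <= b ->
    H b != 0 /\ exit_above q (X z) 0 b = (H z / H b)%:E.

Definition scale_function q (X : R -> R -> T -> R) a (W : R -> R) : Prop :=
  forall z b, a <= z -> z <= b ->
    W b != 0 /\ exit_above q (X z) a b = (W z / W b)%:E.

End Process.

(* Main.v *)
Require Import Defs.
(* Between claims X grows like e^t, so at the successive claim epochs the process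
   is the Markov chain Z_(k+1) = e^(tau_k) Z_k - C_k, and the passages above b and
   below a can be read off from this chain.  If h on [a, b] satisfies the
   first-claim (one-round) equation, then iterating that equation along the chain
   gives h(z) = h(b) E[up-passage] + kappa E[down-passage]: the remainder tends to
   0 because each round is survived with probability at most P(C <= b) < 1.
   Writing h = e^(-z) F and G = lam (int_0^z h y e^y dy + const), the one-round
   equation follows from the linear system G' = lam F, z F' = (z + n) F - G,
   kappa being encoded in the limit of G at a.  This system has the Kummer
   solution (from K1, with G(0+) = 0) and the Tricomi solution (from K2, with
   G(0+) = Gamma(n + 1) / Gamma(q + 1)).  The Kummer solution gives the survival
   function, the Tricomi one the ruin functions (let b tend to infinity), and the
   combination with G(a) = 0 the scale function. *)
From HB Require Import structures.
From mathcomp Require Import all_boot all_order all_algebra.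
From mathcomp Require Import all_classical all_reals all_analysis.
From mathcomp Require Import measurable_realfun ring lra.

Set Implicit Arguments.
Unset Strict Implicit.
Unset Printing Implicit Defensive.

Import Order.TTheory GRing.Theory Num.Theory.
Import numFieldNormedType.Exports.

Local Open Scope classical_set_scope.
Local Open Scope ring_scope.

(** Exponential claims are what make the problem a differential one: the convolution of [h] with
    e^(-y) is e^(-z) times a primitive of [F], and the overshoot below [a] is again exponential, so
    the payment at a down-passage contributes one constant, kappa / (1 + theta), which the limit of
    [G] absorbs. Prescribing only the limit of [G] at a+ treats a = 0 and a > 0 together, although
    the system is singular at 0. As q = 0 is allowed, discounting cannot kill the remainder of the
    iteration; the claim sizes do: since a >= 0, a round begun in [a, b] is survived only if its
    claim is at most b. The passage times are infima over uncountable sets, and their measurability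
    is not established: off a null set the functionals equal measurable series along the chain, and
    integrals are compared as suprema over simple functions. The two solutions are told apart by
    their Wronskian and by [G] at 0+. Such limits at 0+ also give the uniqueness of harmonic
    functions, Kummer's transformation and Gamma (n + 2) = (n + 1) Gamma (n + 1). *)

Section Density.
Local Open Scope ereal_scope.
Context d (T : measurableType d) (R : realType).
Variables (mu nu : {measure set T -> \bar R}) (p : T -> R).
Hypothesis p_ge0 : forall x, (0 <= p x)%R.
Hypothesis mp : measurable_fun setT p.
Hypothesis nuE : forall A, measurable A -> nu A = \int[mu]_(x in A) (p x)%:E.

Import HBNNSimple.

Let density_nnsfun (f : {nnsfun T >-> R}) :
  \int[nu]_x (f x)%:E = \int[mu]_x ((f x)%:E * (p x)%:E).
Proof.
under [LHS]eq_integral do rewrite fimfunE -fsumEFin//.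
rewrite [LHS]ge0_integral_fsum//; last 2 first.
  - by move=> r; exact/measurable_EFinP/measurableT_comp.
  - by move=> n x _; rewrite EFinM nnfun_muleindic_ge0.
under [RHS]eq_integral.
  move=> x xD; rewrite fimfunE -fsumEFin// muleC ge0_mule_fsumr; last first.
    by move=> r; rewrite EFinM nnfun_muleindic_ge0.
  over.
rewrite [RHS]ge0_integral_fsum//; last 2 first.
  - move=> r; apply: emeasurable_funM; first exact/measurable_EFinP.
    by apply/measurable_EFinP; do 2 apply/measurableT_comp => //.
  - move=> n x _; rewrite EFinM mule_ge0//; last by rewrite nnfun_muleindic_ge0.
    by rewrite lee_fin.
apply: eq_fsbigr => r /set_mem[t _ frt]; subst r.
have r0 : (0 <= f t)%R by exact: fun_ge0.
under [in RHS]eq_integral do rewrite EFinM muleCA.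
rewrite [RHS]ge0_integralZl//; last 2 first.
- apply: emeasurable_funM; first exact/measurable_EFinP.
  exact/measurable_EFinP/measurable_indic.
- by move=> x _; rewrite mule_ge0// lee_fin.
under eq_integral do rewrite EFinM.
rewrite ge0_integralZl//; last exact/measurable_EFinP/measurable_indic.
congr (_ * _); rewrite integral_indic// setIT nuE//.
by rewrite integral_mkcond/=; apply: eq_integral => x _; rewrite epatch_indic.
Qed.

(** Both sides are limits along the same simple functions; [p_ge0] keeps the right-hand sequence
    monotone. *)
Lemma ge0_integral_density (f : T -> \bar R) :
  measurable_fun setT f -> (forall x, 0 <= f x) ->
  \int[nu]_x f x = \int[mu]_x (f x * (p x)%:E).
Proof.
move=> mf f0.
pose f_ := nnsfun_approx measurableT mf.
transitivity (lim (\int[nu]_x (f_ n x)%:E @[n --> \oo])).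
  rewrite -monotone_convergence//=.
  - apply: eq_integral => ? /[!inE] xD; apply/esym/cvg_lim => //=.
    exact: cvg_nnsfun_approx.
  - by move=> n; exact/measurable_EFinP/measurable_funTS.
  - by move=> n ? _; rewrite lee_fin.
  - by move=> ? _ ? ? mn; rewrite lee_fin; exact/lefP/nd_nnsfun_approx.
under eq_fun do rewrite density_nnsfun.
rewrite -monotone_convergence//=.
- apply: eq_integral => x _; apply/cvg_lim => //=.
  apply: cvgeZr => //; exact: cvg_nnsfun_approx.
- move=> n; apply: emeasurable_funM; last exact/measurable_EFinP.
  exact/measurable_EFinP/measurable_funTS.
- by move=> n ? _; rewrite mule_ge0 ?lee_fin.
- move=> ? _ ? ? mn; rewrite lee_wpmul2r ?lee_fin//.
  exact/lefP/nd_nnsfun_approx.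
Qed.

End Density.

(** * Independence of the past *)

Section Past.
Context {d : measure_display} {T : measurableType d} {R : realType}.
Variable P : probability T R.
Variable Y : nat -> {RV P >-> R}.

(** A pi-system generating the sigma-algebra of the first [m] variables. [pastType m] is [T] with
    that sigma-algebra, so that depending on the past becomes ordinary measurability on another
    type. *)
Definition past_cylinders m : set (set T) :=
  [set E | exists2 A : nat -> set R, (forall i, measurable (A i)) &
    E = \bigcap_(i < m) (Y i @^-1` A i)].

Definition pastType m := g_sigma_algebraType (past_cylinders m).

Lemma past_cylinders_setI m : setI_closed (past_cylinders m).
Proof.
move=> _ _ [A mA ->] [B mB ->]; exists (fun i => A i `&` B i).
  by move=> i; exact: measurableI.
by apply/seteqP; split=> [w [wA wB] i im|w wAB];
  [split; [exact: wA|exact: wB]|split=> i im; have [] := wAB i im].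
Qed.

Lemma measurable_past_cylinder m E : past_cylinders m E -> measurable E.
Proof.
move=> [A mA ->]; apply: bigcap_measurableType => i _.
by rewrite -[_ @^-1` _]setTI; exact: measurable_funP.
Qed.

Lemma past_measurable m E :
  measurable (E : set (pastType m)) -> measurable (E : set T).
Proof.
apply: smallest_sub; first exact: sigma_algebra_measurable.
by move=> F; exact: measurable_past_cylinder.
Qed.

Lemma measurable_fun_past d' (S : measurableType d') m (phi : T -> S) :
  measurable_fun (setT : set (pastType m)) phi -> measurable_fun setT phi.
Proof. by move=> mphi _ B mB; apply: (@past_measurable m); exact: mphi. Qed.

Lemma past_subset m E :
  measurable (E : set (pastType m)) -> measurable (E : set (pastType m.+1)).
Proof.
apply: smallest_sub; first exact: sigma_algebra_measurable.
move=> _ [A mA ->]; apply: sub_gen_smallest.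
exists (fun i => if (i < m)%N then A i else setT); first by move=> i; case: ifP.
apply/seteqP; split => w wA i /= im; first by case: ifP => // {}im; exact: wA.
by have := wA i (leqW im); rewrite /= im.
Qed.

Lemma measurable_fun_pastS d' (S : measurableType d') m (phi : T -> S) :
  measurable_fun (setT : set (pastType m)) phi ->
  measurable_fun (setT : set (pastType m.+1)) phi.
Proof. by move=> mphi _ B mB; apply: past_subset; exact: mphi. Qed.

Lemma measurable_fun_past_last m :
  measurable_fun (setT : set (pastType m.+1)) (Y m).
Proof.
move=> _ B mB; rewrite setTI; apply: sub_gen_smallest.
exists (fun i => if i == m then B else setT); first by move=> i; case: ifP.
apply/seteqP; split => [w wB i _|w /(_ m (ltnSn m))] /=; last by rewrite eqxx.
by case: eqP => // ->.
Qed.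

Hypothesis Yindep : mutually_independent Y.

(** Dynkin's argument: the events satisfying the product rule with a fixed event of [Y m] form a
    lambda-system, which contains the pi-system of cylinders. *)
Lemma past_indep m (E : set T) (A : set R) :
  measurable (E : set (pastType m)) -> measurable A ->
  P (E `&` Y m @^-1` A) = (P E * P (Y m @^-1` A))%E.
Proof.
move=> mE mA; have mYA : measurable (Y m @^-1` A).
  by rewrite -[_ @^-1` _]setTI; exact: measurable_funP.
pose D := [set E : set T | measurable E /\
  P (E `&` Y m @^-1` A) = (P E * P (Y m @^-1` A))%E].
suff : D E by case.
move: mE; apply: lambda_system_subset => //.
- exact: past_cylinders_setI.
- apply/dynkin_lambda_system; split.
  + by split=> //; rewrite setTI probability_setT mul1e.
  + move=> B [mB PB]; split; first exact: measurableC.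
    rewrite setIC -setDE measureD//; last first.
      by rewrite (le_lt_trans (probability_le1 _ _)) ?ltry.
    transitivity (P (Y m @^-1` A) - P B * P (Y m @^-1` A))%E.
      by congr (_ - _)%E; rewrite setIC; exact: PB.
    by rewrite [P (~` B)]probability_setC// muleBl ?mul1e// fin_num_measure.
  + move=> F tF FD; split; first by apply: bigcup_measurable => k _; case: (FD k).
    rewrite setI_bigcupl measure_bigcup//; last 2 first.
    * by move=> k _; apply: measurableI => //; case: (FD k).
    * exact: trivIset_setIr.
    rewrite measure_bigcup//; last by move=> k _; case: (FD k).
    rewrite -(fineK (fin_num_measure P _ mYA)) muleC -nneseriesZl//.
    by apply: eq_eseriesr => k _; rewrite fineK ?fin_num_measure// muleC; case: (FD k).
- move=> B [B' mB' ->]; split.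
    by apply: measurable_past_cylinder; exists B'.
  (* A cylinder of length [m] intersected with an event of [Y m] is a cylinder of length m + 1. *)
  set C := fun i => if (i < m)%N then B' i else A.
  have mC i : measurable (C i) by rewrite /C; case: ifP.
  have Clt i : (i < m)%N -> C i = B' i by rewrite /C => ->.
  have Cm : C m = A by rewrite /C ltnn.
  have := Yindep m.+1 mC; rewrite big_ord_recr/= Cm.
  under eq_bigr do rewrite Clt//.
  rewrite -Yindep// => <-; congr (P _).
  apply/seteqP; split => [w [wB wA] i /= im|w wC].
    have [{}im|mi] := ltnP i m; first by rewrite Clt//; exact: wB.
    have -> : i = m by apply/eqP; rewrite eqn_leq mi -ltnS im.
    by rewrite Cm.
  split=> [i /= im|]; last by have := wC m (ltnSn m); rewrite /= Cm.
  by have := wC i (leqW im); rewrite /= Clt.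
Qed.

(** By [past_indep] the pair has a product law, and Tonelli integrates [Y m] out. This takes the
    place of conditioning on the past. *)
Lemma integral_past d' (S : measurableType d') m (phi : T -> S)
    (f : S * R -> \bar R) :
  measurable_fun (setT : set (pastType m)) phi ->
  measurable_fun setT f -> (forall x, (0 <= f x)%E) ->
  (\int[P]_w f (phi w, Y m w) =
   \int[P]_w \int[distribution P (Y m)]_y f (phi w, y))%E.
Proof.
move=> pmphi mf f0; have mphi := measurable_fun_past pmphi.
pose mphi_mixin := isMeasurableFun.Build _ _ _ _ _ mphi.
pose phi' : {mfun T >-> S} := HB.pack phi mphi_mixin.
have mpair : measurable_fun setT (fun w => (phi w, Y m w)).
  exact: measurable_fun_pair.
pose mpair_mixin := isMeasurableFun.Build _ _ _ _ _ mpair.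
pose pair' : {mfun T >-> (S * R)%type} := HB.pack (fun w => (phi w, Y m w)) mpair_mixin.
have := @ge0_integral_pushforward _ _ _ _ R _ mpair P setT f measurableT mf (fun x _ => f0 x).
rewrite preimage_setT /= => <-.
rewrite -(@eq_measure_integral _ _ _ setT (distribution P pair')
  ((distribution P phi') \x (distribution P (Y m)))%E); last first.
  move=> X mX _; apply: product_measure_unique => // A B mA mB.
  rewrite /distribution /pushforward.
  apply: (past_indep (E := phi @^-1` A)) => //.
  by rewrite -[_ @^-1` _]setTI; exact: pmphi.
rewrite fubini_tonelli1// /fubini_F.
rewrite ge0_integral_pushforward//.
- exact: measurable_fun_fubini_tonelli_F.
- by move=> x _; exact: integral_ge0.
Qed.

End Past.

(** * Integrals and tails of exponential laws *)

Section ExponentialLaw.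
Context {d : measure_display} {T : measurableType d} {R : realType}.
Variable P : probability T R.

Lemma ge0_integral_exponential_law (rate : R) (Y : {RV P >-> R}) (f : R -> \bar R) :
  0 < rate -> exponential_law rate Y ->
  measurable_fun setT f -> (forall x, 0 <= f x)%E ->
  (\int[distribution P Y]_y f y =
   \int[lebesgue_measure]_(y in `]0%R, +oo[) (f y * (rate * expR (- rate * y))%:E))%E.
Proof.
move=> rate0 Ylaw mf f0.
transitivity (\int[lebesgue_measure]_x (f x * (exponential_pdf rate x)%:E))%E.
  (* The Lebesgue measure lives on [measurableTypeR R]; [Y] is repackaged with that codomain, and
     both laws push the same integral forward. *)
  have mY : measurable_fun setT (Y : T -> measurableTypeR R).
    exact: (@measurable_funP _ _ _ _ _ Y).
  pose mY_mixin := isMeasurableFun.Build _ _ _ _ _ mY.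
  pose Y' : {mfun T >-> measurableTypeR R} := HB.pack (Y : T -> measurableTypeR R) mY_mixin.
  rewrite -(@ge0_integral_density _ _ R lebesgue_measure (distribution P Y'))//.
  - transitivity (\int[P]_x f (Y x))%E; first exact: (ge0_integral_pushforward (measurable_funP Y) P measurableT mf (fun x _ => f0 x)).
    exact: esym (ge0_integral_pushforward mY P measurableT mf (fun x _ => f0 x)).
  - by move=> x; exact/exponential_pdf_ge0/ltW.
  - exact: measurable_exponential_pdf.
have mpdf : measurable_fun setT (fun y => (rate * expR (- rate * y))%:E).
  apply/measurable_EFinP/measurable_funM => //.
  by apply: measurableT_comp => //; exact: measurable_funM.
rewrite integral_itv_obnd_cbnd; last first.
  by apply: measurable_funTS; exact: emeasurable_funM.
rewrite [RHS]integral_mkcond; apply: eq_integral => x _ /=.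
rewrite /exponential_pdf !patchE; case: ifPn => //.
by rewrite mule0.
Qed.

Lemma exponential_law_le0 (rate : R) (Y : {RV P >-> R}) :
  0 < rate -> exponential_law rate Y -> P (Y @^-1` `]-oo, 0]) = 0%E.
Proof.
move=> rate0 Ylaw.
transitivity (\int[distribution P Y]_x (\1_`]-oo, 0] x)%:E)%E.
  by rewrite integral_indic// setIT.
rewrite (ge0_integral_exponential_law rate0 Ylaw).
- rewrite integral0_eq// => x /=; rewrite in_itv/= andbT => x0.
  by rewrite indicE memNset ?mul0e//= in_itv/= leNgt x0.
- exact/measurable_EFinP/measurable_indic.
- by move=> x; rewrite lee_fin.
Qed.

(** Supplies the contraction factor P (C <= b) < 1 of the chain killed on leaving [a, b]. *)
Lemma exponential_law_le_lt1 (rate b : R) (Y : {RV P >-> R}) :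
  0 < rate -> exponential_law rate Y -> (P (Y @^-1` `]-oo, b]) < 1)%E.
Proof.
move=> rate0 Ylaw.
have mYi (i : interval R) : measurable (Y @^-1` [set` i]).
  by rewrite -[_ @^-1` _]setTI; exact: measurable_funP.
have [b0|b0] := leP b 0.
  rewrite (@le_lt_trans _ _ 0%E) ?lte01// -(exponential_law_le0 rate0 Ylaw).
  rewrite le_measure ?inE//.
  by apply: preimage_subset => x /=; rewrite !in_itv/= => /le_trans; apply.
apply: (@le_lt_trans _ _ (P (Y @^-1` `]-oo, 0%R] `|` Y @^-1` `[0%R, b]))%E).
  rewrite le_measure ?inE//; first exact: measurableU.
  move=> w /=; rewrite !in_itv/= => ->; rewrite andbT.
  by apply/orP; rewrite le_total.
apply: (le_lt_trans (measureU2 _ _ _)) => //.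
rewrite [X in (X + _ < _)%E](exponential_law_le0 rate0 Ylaw) add0e.
rewrite [X in (X < _)%E](Ylaw `[0, b]%classic)// exponential_prob_itv0c//.
by rewrite -EFinB lte_fin ltrBlDr ltrDl expR_gt0.
Qed.

End ExponentialLaw.

(** * One independent sequence of gaps and claims *)

Section Interleave.
Context {d : measure_display} {T : measurableType d} {R : realType}.
Variable P : probability T R.
Variables tau C : nat -> {RV P >-> R}.

(** The order tau 0, C 0, tau 1, C 1, ... is that in which the process consumes the variables: the
    state after [k] claims is a function of the first 2k of them. *)
Definition interleave i : {RV P >-> R} := if odd i then C i./2 else tau i./2.

Lemma interleave_even k : interleave k.*2 = tau k.
Proof. by rewrite /interleave odd_double doubleK. Qed.

Lemma interleave_odd k : interleave k.*2.+1 = C k.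
Proof. by rewrite /interleave/= odd_double/= uphalf_double. Qed.

Lemma interleave_indep : mutually_independent tau -> mutually_independent C ->
  independent_sequences tau C -> mutually_independent interleave.
Proof.
move=> tau_indep C_indep tauC k A mA.
(* Padding with [setT] turns a condition on [k] interleaved variables into conditions on exactly [k]
   gaps and [k] claims, the form of [independent_sequences]. *)
pose B i := if (i < k)%N then A i else setT.
have mB i : measurable (B i) by rewrite /B; case: ifP.
have prodB m : (\prod_(i < m.*2) P (interleave i @^-1` B i) =
  (\prod_(i < m) P (tau i @^-1` B i.*2)) *
  (\prod_(i < m) P (C i @^-1` B i.*2.+1)))%E.
  elim: m => [|m IH]; first by rewrite !big_ord0 mule1.
  rewrite doubleS !big_ord_recr/= IH interleave_even interleave_odd.
  by rewrite muleACA -!muleA.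
have capB : \bigcap_(i < k) (interleave i @^-1` A i) =
    (\bigcap_(i < k) (tau i @^-1` B i.*2)) `&`
    (\bigcap_(i < k) (C i @^-1` B i.*2.+1)).
  apply/seteqP; split => [w wA|w [wtau wC] i /= ik].
    split => i /= ik; rewrite /B; case: ifP => //.
      by move=> /wA; rewrite interleave_even.
    by move=> /wA; rewrite interleave_odd.
  have i2k : (i./2 < k)%N by rewrite (leq_ltn_trans _ ik)// -divn2 leq_div.
  have := odd_double_half i; rewrite /interleave; case: (odd i) => /= iE.
    by have := wC i./2 i2k; rewrite /B/= -[i./2.*2.+1]add1n iE ik.
  by have := wtau i./2 i2k; rewrite /B/= -[i./2.*2]add0n iE ik.
rewrite capB tauC// tau_indep// C_indep// -prodB.
rewrite -addnn big_split_ord/= [X in (_ * X)%E]big1 ?mule1; last first.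
  move=> i _; rewrite /B ltnNge leq_addr/= preimage_setT.
  exact: probability_setT.
by apply: eq_bigr => i _; rewrite /B ltn_ord.
Qed.

End Interleave.

(** * The chain of claim epochs *)

Section Chain.
Context {R : realType}.
Variables (q a b : R).

(** The almost sure conditions 0 < t and 0 < c are included so that, on every path, a live chain
    stays below [b] and its discount factor does not grow. *)
Definition stays y t c := [&& 0 < t, expR t * y <= b, a <= expR t * y - c & 0 < c].

(* The pair is (discount factor, position) at the successive claim epochs; the
   discount factor drops to 0 once [a, b] is left. *)
Definition next_claim (s : R * R) t c : R * R :=
  (if stays s.2 t c then s.1 * expR (- (q * t)) else 0, expR t * s.2 - c).

Fixpoint claim_chain (z : R) (t c : nat -> R) k : R * R :=
  if k is k'.+1 then next_claim (claim_chain z t c k') (t k') (c k')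
  else (1, z).

Lemma measurable_stays : measurable_fun setT
  (fun x : R * R * R => stays x.1.1 x.1.2 x.2).
Proof.
have m1 : measurable_fun setT (fun x : R * R * R => expR x.1.2 * x.1.1).
  by apply: measurable_funM; [apply: measurableT_comp => //|]; exact: measurableT_comp.
apply: measurable_and.
  by apply: measurable_fun_ltr => //; exact: measurableT_comp.
apply: measurable_and; first exact: measurable_fun_ler.
apply: measurable_and; last exact: measurable_fun_ltr.
by apply: measurable_fun_ler => //; exact: measurable_funB.
Qed.

Lemma measurable_next_claim : measurable_fun setT
  (fun x : (R * R) * R * R => next_claim x.1.1 x.1.2 x.2).
Proof.
have m12 : measurable_fun setT (fun x : (R * R) * R * R => x.1.2).
  exact: measurableT_comp.
have m111 : measurable_fun setT (fun x : (R * R) * R * R => x.1.1.1).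
  by apply: measurableT_comp => //; exact: measurableT_comp.
have m112 : measurable_fun setT (fun x : (R * R) * R * R => x.1.1.2).
  by apply: measurableT_comp => //; exact: measurableT_comp.
apply: measurable_fun_pair => /=.
  apply: measurable_fun_ifT => //=.
    apply: (@measurableT_comp _ _ _ _ _ _ (fun x : R * R * R => stays x.1.1 x.1.2 x.2) _
      (fun x : (R * R) * R * R => (x.1.1.2, x.1.2, x.2))).
      exact: measurable_stays.
    by apply: measurable_fun_pair => //; exact: measurable_fun_pair.
  apply: measurable_funM => //; apply: measurableT_comp => //.
  by apply: measurableT_comp => //; exact: measurable_funM.
apply: measurable_funB => //; apply: measurable_funM => //.
exact: measurableT_comp.
Qed.

Lemma claim_chain_ge0 z t c k : 0 <= (claim_chain z t c k).1.
Proof.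
elim: k => [|k IH] //=.
by case: ifP => // _; rewrite mulr_ge0 ?expR_ge0.
Qed.

Lemma claim_chain_in z t c k : a <= z <= b ->
  (claim_chain z t c k).1 != 0 -> a <= (claim_chain z t c k).2 <= b.
Proof.
move=> zab; case: k => [|k] //=.
case: ifP => [/and4P[_ h1 h2 h3] _|]; last by rewrite eqxx.
by rewrite h2/= (le_trans _ h1)// gerBl ltW.
Qed.

End Chain.

(** * The law of one round of the chain *)

Section ChainLaw.
Context {d : measure_display} {T : measurableType d} {R : realType}.
Variables (P : probability T R) (lam q a b z : R).
Variables tau C : nat -> {RV P >-> R}.
Hypothesis lam_gt0 : 0 < lam.
Hypothesis tau_law : forall k, exponential_law lam (tau k).
Hypothesis C_law : forall k, exponential_law 1 (C k).
Hypothesis tau_indep : mutually_independent tau.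
Hypothesis C_indep : mutually_independent C.
Hypothesis tauC_indep : independent_sequences tau C.

Let Y := interleave tau C.
Let Y_indep : mutually_independent Y.
Proof. exact: interleave_indep. Qed.

Definition claims w := claim_chain q a b z (tau ^~ w) (C ^~ w).

Lemma measurable_claims_past k :
  measurable_fun (setT : set (pastType Y k.*2)) (claims ^~ k).
Proof.
elim: k => [|k IH]; first exact: measurable_cst.
rewrite doubleS.
have -> : claims ^~ k.+1 = (fun x : (R * R) * R * R => next_claim q a b x.1.1 x.1.2 x.2)
  \o (fun w => ((claims w k, tau k w), C k w)) by [].
apply: (@measurableT_comp _ _ _ (pastType Y k.*2.+2)).
  exact: measurable_next_claim.
apply: measurable_fun_pair.
  apply: measurable_fun_pastS; apply: measurable_fun_pair.
    exact: measurable_fun_pastS.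
  by rewrite -(interleave_even tau C k); exact: measurable_fun_past_last.
by rewrite -(interleave_odd tau C k); exact: measurable_fun_past_last.
Qed.

Lemma measurable_claims k : measurable_fun setT (claims ^~ k).
Proof. apply: (@measurable_fun_past _ _ _ P Y _ _ k.*2); exact: measurable_claims_past. Qed.

Local Open Scope ereal_scope.

(** The Markov property: [C k], then [tau k], is integrated out given its past, and the laws are
    those of index 0 in every round. *)
Lemma integral_claims k (f : (R * R) * R * R -> \bar R) :
  measurable_fun setT f -> (forall x, 0 <= f x) ->
  \int[P]_w f (claims w k, tau k w, C k w) =
  \int[P]_w \int[distribution P (tau 0)]_t \int[distribution P (C 0)]_c
    f (claims w k, t, c).
Proof.
move=> mf f0.
have mpt : measurable_fun (setT : set (pastType Y k.*2.+1))
    (fun w => (claims w k, tau k w)).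
  apply: measurable_fun_pair.
    by apply: measurable_fun_pastS; exact: measurable_claims_past.
  by rewrite -(interleave_even tau C k); exact: measurable_fun_past_last.
have := integral_past Y_indep mpt mf f0.
rewrite {1 2}/Y interleave_odd => ->.
have mf2 : measurable_fun setT (fun x : (R * R) * R =>
    \int[distribution P (C k)]_y f (x, y)).
  exact: (@measurable_fun_fubini_tonelli_F _ _ _ _ R (distribution P (C k)) f mf f0).
have := integral_past Y_indep (measurable_claims_past (k := k)) mf2.
rewrite {1 2}/Y interleave_even => ->; last by move=> x; exact: integral_ge0.
apply: eq_integral => w _.
under eq_integral => t _.
  rewrite (@eq_measure_integral _ _ _ setT (distribution P (C 0))); last first.
    by move=> A mA _; rewrite [LHS]C_law// [RHS]C_law.
  over.
by apply: eq_measure_integral => A mA _; rewrite [LHS]tau_law// [RHS]tau_law.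
Qed.

(** The mean over one gap and one claim, written with the two densities, so that the one-round
    equation becomes pure calculus. *)
Definition round_mean (f : R -> R -> \bar R) :=
  \int[lebesgue_measure]_(t in `]0%R, +oo[)
   ((\int[lebesgue_measure]_(c in `]0%R, +oo[) (f t c * (expR (- c))%:E)) *
    (lam * expR (- (lam * t)))%:E).

Lemma round_meanE (f : R * R -> \bar R) :
  measurable_fun setT f -> (forall x, 0 <= f x) ->
  round_mean (fun t c => f (t, c)) =
  \int[distribution P (tau 0)]_t \int[distribution P (C 0)]_c f (t, c).
Proof.
move=> mf f0; rewrite (ge0_integral_exponential_law lam_gt0 (tau_law 0)); last 2 first.
- exact: (@measurable_fun_fubini_tonelli_F _ _ _ _ R (distribution P (C 0)) f mf f0).
- by move=> t; exact: integral_ge0.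
apply: eq_integral => t _; rewrite mulNr; congr (_ * _).
rewrite (ge0_integral_exponential_law ltr01 (C_law 0))//.
- by apply: eq_integral => c _; rewrite mul1r mulN1r.
- exact: (measurableT_comp mf).
Qed.

End ChainLaw.

(** * Iteration of the one-round equation *)

Section FirstPassage.
Context {d : measure_display} {T : measurableType d} {R : realType}.
Variables (P : probability T R) (lam q a b z : R).
Variables tau C : nat -> {RV P >-> R}.
Hypothesis lam_gt0 : 0 < lam.
Hypothesis tau_law : forall k, exponential_law lam (tau k).
Hypothesis C_law : forall k, exponential_law 1 (C k).
Hypothesis tau_indep : mutually_independent tau.
Hypothesis C_indep : mutually_independent C.
Hypothesis tauC_indep : independent_sequences tau C.
Hypothesis q_ge0 : 0 <= q.
Hypothesis a_ge0 : 0 <= a.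
Hypothesis azb : a <= z <= b.

Local Notation Z := (claims q a b z tau C).
Local Notation mZ := (measurable_claims q a b z tau C).

Lemma measurable_discount_factor k : measurable_fun setT (fun w => (Z w k).1).
Proof. by apply: (measurableT_comp measurable_fst); exact: mZ. Qed.

Lemma measurable_claim_position k : measurable_fun setT (fun w => (Z w k).2).
Proof. by apply: (measurableT_comp measurable_snd); exact: mZ. Qed.

Local Open Scope ereal_scope.

(** Since a <= e^t y - c and a >= 0, a survived claim satisfies c <= e^t y <= b, and its law does
    not depend on the past; the factor e^(-q t) is merely bounded by 1. *)
Lemma discount_factor_decay k : \int[P]_w ((Z w k).1)%:E <=
  ((fine (P (C 0 @^-1` `]-oo, b]))) ^+ k)%:E.
Proof.
set rho := fine _.
have rho0 : (0 <= rho)%R by rewrite fine_ge0.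
have Pfin : P (C 0 @^-1` `]-oo, b]) \is a fin_num.
  by apply: fin_num_measure; rewrite -[_ @^-1` _]setTI; exact: measurable_funP.
elim: k => [|k IH].
  rewrite expr0 /= integral_cst// mul1e. exact: probability_le1.
(* The absolute value makes [f] nonnegative on all triples, as [integral_claims] asks; along the
   chain it changes nothing. *)
pose f (x : (R * R) * R * R) : \bar R := (`|x.1.1.1| * \1_`]-oo, b] x.2)%:E.
have m1 : measurable_fun setT (fun x : (R * R) * R * R => `|x.1.1.1|%R).
  apply: measurableT_comp => //; apply: measurableT_comp => //.
  exact: measurableT_comp.
have m2 : measurable_fun setT (fun x : (R * R) * R * R => \1_`]-oo, b] x.2 : R).
  exact: measurableT_comp.
have mf : measurable_fun setT f by apply/measurable_EFinP; exact: measurable_funM.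
have f0 x : 0 <= f x by rewrite lee_fin mulr_ge0.
apply: (@le_trans _ _ (\int[P]_w f (Z w k, tau k w, C k w))).
  apply: ge0_le_integral => //.
  - by move=> w _; rewrite lee_fin claim_chain_ge0.
  - by apply/measurable_EFinP; exact: measurable_discount_factor.
  - apply: (measurableT_comp mf); apply: measurable_fun_pair => //.
    by apply: measurable_fun_pair => //; exact: mZ.
  move=> w _; rewrite lee_fin /f/=.
  have G0 := claim_chain_ge0 q a b z (tau ^~ w) (C ^~ w) k.
  case: ifPn => [/and4P[t0 h1 h2 h3]|_]; last by rewrite mulr_ge0.
  rewrite ger0_norm// indicE mem_set ?mulr1; last first.
    by rewrite /= in_itv/= (le_trans _ h1)// -subr_ge0 (le_trans a_ge0).
  by rewrite ler_piMr// -expR0 ler_expR oppr_le0 mulr_ge0// ltW.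
rewrite (integral_claims (lam := lam))//.
apply: (@le_trans _ _ (\int[P]_w (rho%:E * ((Z w k).1)%:E))); last first.
  rewrite ge0_integralZl//; last 2 first.
  - by apply/measurable_EFinP; exact: measurable_discount_factor.
  - by move=> w _; rewrite lee_fin claim_chain_ge0.
  - by rewrite exprS EFinM lee_wpmul2l.
rewrite le_eqVlt; apply/orP; left; apply/eqP; apply: eq_integral => w _.
rewrite /f/= ger0_norm ?claim_chain_ge0//.
under eq_integral => t _.
  under eq_integral do rewrite EFinM.
  rewrite ge0_integralZl ?lee_fin ?claim_chain_ge0//; last first.
    exact/measurable_EFinP.
  over.
rewrite integral_cst// [X in _ * X = _](_ : _ = 1); last exact: probability_setT.
rewrite mule1 integral_indic// setIT muleC.
by congr (_ * _); rewrite /rho fineK.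
Qed.

Lemma discount_factor_cvg0 : \int[P]_w ((Z w k).1)%:E @[k --> \oo] --> 0.
Proof.
have Cb1 := exponential_law_le_lt1 b ltr01 (C_law 0).
set rho := fine (P (C 0 @^-1` `]-oo, b])).
have rho0 : (0 <= rho)%R by rewrite fine_ge0.
have Pfin : P (C 0 @^-1` `]-oo, b]) \is a fin_num.
  by apply: fin_num_measure; rewrite -[_ @^-1` _]setTI; exact: measurable_funP.
have rho1 : (rho < 1)%R.
  by rewrite -lte_fin fineK.
apply: (@squeeze_cvge _ _ _ _ (cst 0) _ (fun k => (rho ^+ k)%:E)).
- apply: nearW => k; rewrite discount_factor_decay andbT.
  by apply: integral_ge0 => w _; rewrite lee_fin claim_chain_ge0.
- exact: cvg_cst.
- apply: cvg_EFin; first exact: nearW.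
  by apply: cvg_expr; rewrite ger0_norm.
Qed.

Variables (pay : R -> R -> R -> \bar R) (h : R -> R) (B : R).
Hypothesis pay_ge0 : forall y t c, 0 <= pay y t c.
Hypothesis mpay : measurable_fun setT (fun x : R * R * R => pay x.1.1 x.1.2 x.2).
Hypothesis h_ge0 : forall y, (0 <= h y)%R.
Hypothesis h_le : forall y, (h y <= B)%R.
Hypothesis mh : measurable_fun setT h.
Hypothesis one_round : forall y, (a <= y <= b)%R ->
  round_mean lam (fun t c => pay y t c +
    (if stays a b y t c then expR (- (q * t)) * h (expR t * y - c) else 0)%:E) =
  (h y)%:E.

Let paid k w := ((Z w k).1)%:E * pay (Z w k).2 (tau k w) (C k w).
Let left k w := ((Z w k).1 * h (Z w k).2)%:E.

Let left_ge0 k w : 0 <= left k w.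
Proof. by rewrite lee_fin mulr_ge0 ?claim_chain_ge0. Qed.

Let paid_ge0 k w : 0 <= paid k w.
Proof. by rewrite mule_ge0// lee_fin claim_chain_ge0. Qed.

Let mleft k : measurable_fun setT (left k).
Proof.
apply/measurable_EFinP/measurable_funM.
  exact: measurable_discount_factor.
apply: measurableT_comp => //; exact: measurable_claim_position.
Qed.

Let mpaid k : measurable_fun setT (paid k).
Proof.
apply: emeasurable_funM.
  by apply/measurable_EFinP; exact: measurable_discount_factor.
apply: (@measurableT_comp _ _ _ _ _ _ (fun x : R * R * R => pay x.1.1 x.1.2 x.2) _
  (fun w => ((Z w k).2, tau k w, C k w))) => //.
apply: measurable_fun_pair => //; apply: measurable_fun_pair => //.
exact: measurable_claim_position.
Qed.

Lemma measurable_paid k : measurable_fun setT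
  (fun w => ((Z w k).1)%:E * pay (Z w k).2 (tau k w) (C k w)).
Proof. exact: mpaid. Qed.

(** A martingale identity: the value held before round [k] is the mean payment of that round plus
    the mean discounted value carried on. *)
Lemma round_balance k :
  \int[P]_w paid k w + \int[P]_w left k.+1 w = \int[P]_w left k w.
Proof.
rewrite -ge0_integralD//.
pose f (x : (R * R) * R * R) : \bar R := `|x.1.1.1|%:E *
  (pay x.1.1.2 x.1.2 x.2 +
   (if stays a b x.1.1.2 x.1.2 x.2
    then expR (- (q * x.1.2)) * h (expR x.1.2 * x.1.1.2 - x.2) else 0)%:E).
have mx3 : measurable_fun setT (fun x : (R * R) * R * R => (x.1.1.2, x.1.2, x.2)).
  apply: measurable_fun_pair => //; apply: measurable_fun_pair => //.
    by apply: measurableT_comp => //; exact: measurableT_comp.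
  exact: measurableT_comp.
have mf3 : measurable_fun setT (fun x : R * R * R => pay x.1.1 x.1.2 x.2 +
   (if stays a b x.1.1 x.1.2 x.2
    then expR (- (q * x.1.2)) * h (expR x.1.2 * x.1.1 - x.2) else 0)%:E).
  have m12 : measurable_fun setT (fun x : R * R * R => x.1.2).
    exact: measurableT_comp.
  apply: emeasurable_funD => //; apply/measurable_EFinP.
  apply: measurable_fun_ifT => //; first exact: measurable_stays.
  apply: measurable_funM.
    by apply: measurableT_comp => //; apply: measurableT_comp => //; exact: measurable_funM.
  apply: measurableT_comp => //; apply: measurable_funB => //.
  apply: measurable_funM; first exact: measurableT_comp.
  exact: measurableT_comp.
have mf : measurable_fun setT f.
  apply: emeasurable_funM; last exact: (measurableT_comp mf3 mx3).
  apply/measurable_EFinP; apply: measurableT_comp => //; apply: measurableT_comp => //.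
  exact: measurableT_comp.
have in0 y t c : (0 <= if stays a b y t c then expR (- (q * t)) * h (expR t * y - c) else 0)%R.
  by case: ifP => // _; rewrite mulr_ge0 ?expR_ge0.
have f0 x : 0 <= f x by rewrite mule_ge0// adde_ge0// lee_fin.
transitivity (\int[P]_w f (Z w k, tau k w, C k w)).
  apply: eq_integral => w _; rewrite /f /paid /left/=.
  rewrite ger0_norm ?claim_chain_ge0// ge0_muleDr ?lee_fin//; congr (_ + _).
  by rewrite -EFinM; congr (_%:E); case: ifP => _; rewrite ?mulr0 ?mul0r ?mulrA.
rewrite (integral_claims (lam := lam))//; apply: eq_integral => w _.
rewrite /left /f/= ger0_norm ?claim_chain_ge0//.
(* A dead chain may sit outside [a, b], where [one_round] says nothing, but then both sides carry
   the factor 0. *)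
have [->|G0] := eqVneq (Z w k).1 0%R.
  rewrite mul0r integral0_eq// => t _.
  by rewrite integral0_eq// => c _; rewrite !mul0e.
set y := (Z w k).2; pose g (x : R * R) := pay y x.1 x.2 +
  (if stays a b y x.1 x.2
   then expR (- (q * x.1)) * h (expR x.1 * y - x.2) else 0)%:E.
have mg : measurable_fun setT g.
  apply: (measurableT_comp mf3 (g := fun x : R * R => (y, x.1, x.2))).
  by apply: measurable_fun_pair => //; exact: measurable_fun_pair.
have g0 x : 0 <= g x by rewrite adde_ge0// lee_fin.
rewrite EFinM -one_round; last exact: (claim_chain_in azb).
rewrite (round_meanE (P := P) (tau := tau) (C := C) _ _ _ mg)//.
rewrite -ge0_integralZl ?lee_fin ?claim_chain_ge0//; last 2 first.
- exact: (@measurable_fun_fubini_tonelli_F _ _ _ _ R (distribution P (C 0)) g mg g0).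
- by move=> t _; exact: integral_ge0.
apply: eq_integral => t _.
rewrite -ge0_integralZl ?lee_fin ?claim_chain_ge0//.
exact: (measurableT_comp mg).
Qed.

(** Telescoping [round_balance]; the value still carried after [k] rounds is at most [B] times the
    mean discount factor, which tends to 0. *)
Lemma first_passage_series : (h z)%:E =
  \sum_(k <oo) \int[P]_w (((Z w k).1)%:E * pay (Z w k).2 (tau k w) (C k w)).
Proof.
have sumE m : (h z)%:E = \sum_(0 <= k < m) \int[P]_w paid k w + \int[P]_w left m w.
  elim: m => [|m IH].
    rewrite big_nil add0e /left/= mul1r integral_cst//.
    by rewrite [X in _ * X](_ : _ = 1) ?mule1//; exact: probability_setT.
  by rewrite big_nat_recr//= -addeA round_balance.
have left0 : \int[P]_w left k w @[k --> \oo] --> 0.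
  have B0 : (0 <= B)%R by exact: le_trans (h_ge0 0%R) (h_le 0%R).
  apply: (@squeeze_cvge _ _ _ _ (cst 0) _ (fun k => B%:E * \int[P]_w ((Z w k).1)%:E)).
  - apply: nearW => k; rewrite integral_ge0//=.
    have mG := measurable_discount_factor k.
    have G0 w : 0 <= ((Z w k).1)%:E by rewrite lee_fin claim_chain_ge0.
    rewrite -ge0_integralZl//; last exact/measurable_EFinP.
    apply: ge0_le_integral => //.
    - by apply: emeasurable_funM => //; exact/measurable_EFinP.
    - by move=> w _; rewrite /left muleC EFinM lee_wpmul2l// lee_fin.
  - exact: cvg_cst.
  - rewrite -[X in _ --> X](mule0 B%:E); apply: cvgeZl => //.
    exact: discount_factor_cvg0.
apply/esym/cvg_lim => //.
rewrite -[X in _ --> X]sube0.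
have -> : (fun n => \sum_(0 <= k < n) \int[P]_w paid k w) =
    (fun n => (h z)%:E - \int[P]_w left n w).
  apply/funext => n.
  have lfin : \int[P]_w left n w \is a fin_num.
    rewrite ge0_fin_numE ?integral_ge0//.
    rewrite (@le_lt_trans _ _ (h z)%:E) ?ltry//.
    by rewrite (sumE n) leeDr// sume_ge0// => k _; exact: integral_ge0.
  by rewrite {1}(sumE n) addeK.
by apply: cvgeB => //; exact: cvg_cst.
Qed.

End FirstPassage.

(** * Differential calculus *)

Section Calculus.
Context {R : realType}.
Implicit Types (f g : R -> R) (x y : R).

Lemma is_derive_addf f g x df dg : is_derive x 1 f df -> is_derive x 1 g dg ->
  is_derive x 1 (fun y => f y + g y) (df + dg).
Proof. by move=> hf hg; exact: is_deriveD. Qed.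

Lemma is_derive_subf f g x df dg : is_derive x 1 f df -> is_derive x 1 g dg ->
  is_derive x 1 (fun y => f y - g y) (df - dg).
Proof. by move=> hf hg; exact: is_deriveB. Qed.

Lemma is_derive_oppf f x df : is_derive x 1 f df ->
  is_derive x 1 (fun y => - f y) (- df).
Proof. by move=> hf; exact: is_deriveN. Qed.

Lemma is_derive_mulf f g x df dg : is_derive x 1 f df -> is_derive x 1 g dg ->
  is_derive x 1 (fun y => f y * g y) (df * g x + f x * dg).
Proof.
move=> hf hg; have := is_deriveM hf hg.
by rewrite /GRing.scale/= addrC [g x * _]mulrC.
Qed.

Lemma is_derive_mulcf k f x df : is_derive x 1 f df ->
  is_derive x 1 (fun y => k * f y) (k * df).
Proof.
move=> hf; have := is_derive_mulf (is_derive_cst k x 1) hf.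
by rewrite mul0r add0r.
Qed.

Lemma is_derive_divf f g x df dg : g x != 0 ->
  is_derive x 1 f df -> is_derive x 1 g dg ->
  is_derive x 1 (fun y => f y / g y) ((df * g x - f x * dg) / g x ^+ 2).
Proof.
move=> gx0 hf hg.
have := is_derive_mulf hf (is_deriveV gx0 hg); rewrite /GRing.scale/=.
have -> : df * (g x)^-1 + f x * (- g x ^- 2 * dg) =
   (df * g x - f x * dg) / g x ^+ 2 by field.
by [].
Qed.

Lemma is_derive_compf f g x df dg :
  is_derive (g x) 1 f df -> is_derive x 1 g dg ->
  is_derive x 1 (fun y => f (g y)) (df * dg).
Proof. by move=> hf hg; exact: is_derive1_comp. Qed.

Lemma is_derive_idf x : is_derive x 1 (fun y : R => y) 1.
Proof. exact: is_derive_id. Qed.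

Lemma is_derive_cstf k x : is_derive x 1 (fun=> k : R) 0.
Proof. exact: is_derive_cst. Qed.

Lemma is_derive_expRcf k x :
  is_derive x 1 (fun y => expR (k * y)) (k * expR (k * x)).
Proof.
rewrite mulrC; apply: (is_derive_compf (is_derive_expR _)).
by have := is_derive_mulcf k (is_derive_idf x); rewrite mulr1.
Qed.

Lemma is_derive_expRNf x : is_derive x 1 (fun y => expR (- y)) (- expR (- x)).
Proof.
rewrite -mulrN1; apply: (is_derive_compf (is_derive_expR _)).
Qed.

Lemma is_derive_powRf p x : 0 < x ->
  is_derive x 1 (fun y => y `^ p) (p * x `^ (p - 1)).
Proof.
move=> x0; have xin : x \in `]0, +oo[ by rewrite in_itv/= x0.
by apply: DeriveDef; [exact: derivable_powR|rewrite -derive1E powR_derive1].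
Qed.

Lemma is_derive_eqval f x df df' : is_derive x 1 f df -> df = df' ->
  is_derive x 1 f df'.
Proof. by move=> hf <-. Qed.

Lemma is_derive_eqfun f g x df : (\forall y \near x, f y = g y) ->
  is_derive x 1 f df -> is_derive x 1 g df.
Proof.
move=> fg [hf <-]; apply: DeriveDef; first exact: near_eq_derivable hf.
exact/esym/near_eq_derive.
Qed.

Lemma is_derive_cont f x df : is_derive x 1 f df -> {for x, continuous f}.
Proof. by move=> [hf _]; exact/differentiable_continuous/derivable1_diffP. Qed.

Lemma is_derive_derive1 f x df : is_derive x 1 f df -> f^`()%classic x = df.
Proof. by move=> [_ <-]; rewrite derive1E. Qed.

Lemma derive0_eq f (s t : R) : s <= t ->
  (forall x, s < x < t -> is_derive x 1 f 0) ->
  {within `[s, t], continuous f} -> f t = f s.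
Proof.
move=> st df cf.
have df' x : x \in `]s, t[ -> is_derive x 1 f 0 by rewrite in_itv/=; exact: df.
have [u _] := MVT_segment st df' cf.
by rewrite mul0r => /eqP; rewrite subr_eq0 => /eqP.
Qed.

Lemma derive0_cst f : (forall x, 0 < x -> is_derive x 1 f 0) ->
  forall x y, 0 < x -> 0 < y -> f x = f y.
Proof.
move=> df; suff H x y : 0 < x -> x <= y -> f y = f x.
  by move=> x y x0 y0; have [/(H _ _ x0)|/ltW/(H _ _ y0)] := leP x y.
move=> x0 xy; apply: derive0_eq => // [u /andP[xu _]|].
  by apply: df; exact: lt_trans xu.
apply: continuous_in_subspaceT => u /set_mem/=; rewrite in_itv/= => /andP[xu _].
by apply: is_derive_cont; apply: df; exact: lt_le_trans xu.
Qed.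

Lemma near_pos x : 0 < x -> \forall y \near x, 0 < y.
Proof. by move=> x0; exact: lt_nbhsr. Qed.

Lemma right_lim_unique f (x a b : R) :
  f z @[z --> x^'+] --> a -> f z @[z --> x^'+] --> b -> a = b.
Proof.
move=> ha hb; rewrite -(cvg_lim (@norm_hausdorff _ R) ha).
by rewrite (cvg_lim (@norm_hausdorff _ R) hb).
Qed.

Lemma right_cvg_eq f g (x a : R) : (forall z, x < z -> f z = g z) ->
  f z @[z --> x^'+] --> a -> g z @[z --> x^'+] --> a.
Proof.
move=> fg; apply: cvg_trans; apply: near_eq_cvg; near=> z; apply: fg.
by near: z; exact: nbhs_right_gt.
Unshelve. all: by end_near. Qed.

Lemma powRS (z p : R) : 0 < z -> z `^ (p + 1) = z * z `^ p.
Proof.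
by move=> z0; rewrite powRD ?(gt_eqF z0) ?implybT// powRr1 ?(ltW z0)// mulrC.
Qed.

Lemma powR_pred (z p : R) : 0 < z -> z `^ (p - 1) = z `^ p / z.
Proof.
by move=> z0; rewrite powRD ?(gt_eqF z0) ?implybT// powR_inv1 ?(ltW z0).
Qed.

End Calculus.

(** * Pathwise description of the passages *)

Section ClaimPath.
Context {R : realType}.
Variables (z : R) (tau c : nat -> R) (N : R -> nat) (X : R -> R).
Hypothesis tau_gt0 : forall k, 0 < tau k.
Hypothesis c_gt0 : forall k, 0 < c k.
Hypothesis N_count : forall t k, 0 <= t -> (k <= N t)%N = (\sum_(i < k) tau i <= t).
Hypothesis X_eq : forall t, 0 <= t ->
  lebesgue_measure.-integrable `[0, t] (EFin \o X) /\
  X t = z + \int[lebesgue_measure]_(s in `[0, t]) X s - \sum_(i < N t) c i.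

Local Notation mu := (@lebesgue_measure R).

Definition epoch k := \sum_(i < k) tau i.

Fixpoint position k :=
  if k is k'.+1 then expR (tau k') * position k' - c k' else z.

Lemma epoch0 : epoch 0 = 0. Proof. by rewrite /epoch big_ord0. Qed.

Lemma epochS k : epoch k.+1 = epoch k + tau k.
Proof. by rewrite /epoch big_ord_recr. Qed.

Lemma epoch_lt k : epoch k < epoch k.+1.
Proof. by rewrite epochS ltrDl. Qed.

Lemma epoch_le : {homo epoch : i j / (i <= j)%N >-> i <= j}.
Proof.
apply: homo_leq => [x||i]; [exact: lexx|exact: le_trans|].
exact/ltW/epoch_lt.
Qed.

Lemma epoch_ge0 k : 0 <= epoch k.
Proof. by rewrite -epoch0; exact: epoch_le. Qed.

Lemma claim_count k t : epoch k <= t < epoch k.+1 -> N t = k.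
Proof.
move=> /andP[kt tk]; have t0 : 0 <= t := le_trans (epoch_ge0 k) kt.
apply/eqP; rewrite eqn_leq N_count// kt andbT.
by rewrite leqNgt N_count// -ltNge.
Qed.

Lemma epoch_bracket t : 0 <= t -> exists k, epoch k <= t < epoch k.+1.
Proof.
move=> t0; exists (N t); rewrite -N_count// leqnn/=.
by rewrite ltNge -N_count// ltnn.
Qed.

Let F t := \int[mu]_(s in `[0, t]) X s.

(** Between claims X = K + F, with [K] the starting point minus the claims paid. So F' = K + F, and
    the integrating factor e^(-u) gives exponential growth. *)
Let F_growth (K s t : R) : 0 <= s -> s < t ->
  (forall u, s <= u < t -> X u = K + F u) ->
  K + F t = expR (t - s) * (K + F s).
Proof.
move=> s0 st XK.
have t0 : 0 <= t by rewrite (le_trans s0)// ltW.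
have [iX _] := X_eq t0.
have cF : {within `[s, t], continuous F}.
  have := parameterized_integral_continuous t0 iX.
  by apply: continuous_subspaceW; apply: subset_itvr; rewrite bnd_simp.
have dF u : s < u < t -> is_derive u 1 F (K + F u).
  move=> /andP[su ut].
  have cFu : {for u, continuous F}.
    have /continuous_within_itvP := cF; move/(_ st) => [+ _ _].
    by apply; rewrite in_itv/= su.
  (* The path is only known to be integrable; inside ]s, t[ it agrees with K + F and inherits the
     continuity of the integral, which the fundamental theorem needs. *)
  have cX : {for u, continuous X}.
    have near_eq : \forall v \near u, X v = K + F v.
      near=> v; apply: XK.
      have : v \in `]s, t[ by near: v; apply: near_in_itvoo; rewrite in_itv/= su.
      by rewrite in_itv/= => /andP[/ltW -> ->].
    rewrite /prop_for /continuous_at (XK u) ?ut ?(ltW su)//.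
    have cKF : (fun v => K + F v) v @[v --> u] --> K + F u.
      by apply: cvgD => //; exact: cvg_cst.
    apply: cvg_trans cKF; apply: near_eq_cvg.
    by apply: filterS near_eq => v ->.
  have [dFu F'u] := continuous_FTC1_closed ut iX (le_lt_trans s0 su) cX.
  have <- : X u = K + F u by apply: XK; rewrite ut (ltW su).
  apply: (is_derive_eqval (DeriveDef dFu erefl)).
  by rewrite -derive1E; exact: F'u.
pose g u := expR (- u) * (K + F u).
have dg u : s < u < t -> is_derive u 1 g 0.
  move=> /dF dFu; rewrite /g.
  apply: (is_derive_eqval (is_derive_mulf (is_derive_expRNf u)
    (is_derive_addf (is_derive_cstf K u) dFu))).
  by rewrite /=; ring.
have cg : {within `[s, t], continuous g}.
  have c1 : {within `[s, t], continuous (fun u : R => expR (- u))}.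
    by apply: continuous_subspaceT => u; exact: is_derive_cont (is_derive_expRNf u).
  move=> u; apply: cvgM; first exact: c1.
  by apply: cvgD; [exact: cvg_cst|exact: cF].
have := derive0_eq (ltW st) dg cg.
rewrite /g => /(congr1 (fun x => expR t * x)).
by rewrite !mulrA -!expRD subrr expR0 mul1r.
Unshelve. all: by end_near. Qed.

Let shift k := z - \sum_(i < k) c i.

Let X_shift k t : epoch k <= t < epoch k.+1 -> X t = shift k + F t.
Proof.
move=> /[dup] ktk /andP[kt _].
have [_ ->] := X_eq (le_trans (epoch_ge0 k) kt).
by rewrite (claim_count ktk) /shift addrAC.
Qed.

Let position_shift k : shift k + F (epoch k) = position k.
Proof.
elim: k => [|k IH].
  by rewrite /shift /F epoch0 big_ord0 subr0 set_itv1 Rintegral_set1 addr0.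
have -> : shift k.+1 + F (epoch k.+1) = shift k + F (epoch k.+1) - c k.
  by rewrite /shift big_ord_recr/=; ring.
rewrite (F_growth (epoch_ge0 k) (epoch_lt k)); last by move=> u; exact: X_shift.
by rewrite IH epochS [epoch k + _]addrC addrK.
Qed.

Lemma path_between k t : epoch k <= t < epoch k.+1 ->
  X t = expR (t - epoch k) * position k.
Proof.
move=> /[dup] ktk /andP[]; rewrite le_eqVlt => /predU1P[kt _|kt tk].
  by rewrite (X_shift ktk) -kt position_shift subrr expR0 mul1r.
rewrite (X_shift ktk) (F_growth (epoch_ge0 k) kt) ?position_shift//.
by move=> u /andP[ku ut]; apply: X_shift; rewrite ku (lt_trans ut).
Qed.

Lemma path_epoch k : X (epoch k) = position k.
Proof. by rewrite (@path_between k) ?lexx ?epoch_lt// subrr expR0 mul1r. Qed.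

(** Claims only lower the path. This bound makes the passage above [b] late when [b] is large. *)
Lemma path_le t : 0 <= z -> 0 <= t -> X t <= z * expR t.
Proof.
move=> z0 t0.
have pos_le k : position k <= z * expR (epoch k).
  elim: k => [|k IH]; first by rewrite epoch0 expR0 mulr1.
  rewrite /= lerBlDr (le_trans (y := expR (tau k) * (z * expR (epoch k))))//.
    by rewrite ler_wpM2l ?expR_ge0.
  by rewrite mulrCA -expRD epochS [tau k + _]addrC lerDl ltW.
have [k ktk] := epoch_bracket t0.
rewrite (path_between ktk) (le_trans (y := expR (t - epoch k) * (z * expR (epoch k))))//.
  by rewrite ler_wpM2l ?expR_ge0.
by rewrite mulrCA -expRD subrK.
Qed.

(** [up_time] and [down_time] are [passage_above] and [passage_below] for one fixed path, to which
    they unfold. *)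
Definition up_time b : \bar R :=
  ereal_inf [set t%:E | t in [set t : R | 0 <= t /\ b < X t]].

Definition down_time a : \bar R :=
  ereal_inf [set t%:E | t in [set t : R | 0 <= t /\ X t < a]].

Lemma up_time_ge s b : (forall t, 0 <= t < s -> X t <= b) -> (s%:E <= up_time b)%E.
Proof.
move=> sb; apply: le_ereal_inf_tmp => _ [t [t0 bt] <-]; rewrite lee_fin leNgt.
by apply/negP => ts; move: bt; rewrite ltNge sb ?t0.
Qed.

Lemma down_time_ge s a : (forall t, 0 <= t < s -> a <= X t) -> (s%:E <= down_time a)%E.
Proof.
move=> sa; apply: le_ereal_inf_tmp => _ [t [t0 ta] <-]; rewrite lee_fin leNgt.
by apply/negP => ts; move: ta; rewrite ltNge sa ?t0.
Qed.

Lemma up_time_le s b : 0 <= s -> b < X s -> (up_time b <= s%:E)%E.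
Proof. by move=> s0 bs; apply: ereal_inf_lbound; exists s. Qed.

Lemma down_time_le s a : 0 <= s -> X s < a -> (down_time a <= s%:E)%E.
Proof. by move=> s0 sa; apply: ereal_inf_lbound; exists s. Qed.

Section Exit.
Variables (q a b : R).
Hypothesis a_ge0 : 0 <= a.
Hypothesis z_gt0 : 0 < z.
Hypothesis azb : a <= z <= b.

Let b_gt0 : 0 < b.
Proof. by case/andP: azb => _; exact: lt_le_trans. Qed.

Local Notation inside := (fun i => stays a b (position i) (tau i) (c i)).

Lemma inside_position k : (forall i, (i < k)%N -> inside i) -> a <= position k <= b.
Proof.
case: k => [//|k] /(_ k (ltnSn k)) /and4P[_ h1 h2 h3] /=.
by rewrite h2 (le_trans _ h1)// gerBl ltW.
Qed.

Lemma inside_path k : (forall i, (i < k)%N -> inside i) ->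
  forall t, 0 <= t < epoch k -> a <= X t <= b.
Proof.
move=> ink t /andP[t0 tk]; have [i iti] := epoch_bracket t0.
have ik : (i < k)%N.
  rewrite ltnNge; apply/negP => /epoch_le ki.
  by case/andP: iti => it _; move: tk; rewrite ltNge (le_trans ki).
have /andP[ai ib] : a <= position i <= b.
  by apply: inside_position => j ji; apply: ink; exact: ltn_trans ik.
have /and4P[_ h1 _ _] := ink i ik.
have i0 := le_trans a_ge0 ai.
rewrite (path_between iti); case/andP: iti => it ti.
apply/andP; split.
  rewrite (le_trans ai)// ler_peMl// -expR0 ler_expR subr_ge0//.
rewrite (le_trans _ h1)// ler_wpM2r// ler_expR lerBlDl -epochS; exact: ltW.
Qed.

(** In round [k] the path grows from [position k] >= a and crosses [b] after time ln (b / position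
    k), before the claim that ends the round; hence the passage below [a] is strictly later. *)
Lemma exit_up k : (forall i, (i < k)%N -> inside i) ->
  b < expR (tau k) * position k ->
  up_time b = (epoch k + ln (b / position k))%:E /\ (up_time b < down_time a)%E.
Proof.
move=> ink bk.
have /andP[ak kb] := inside_position ink.
have k0 : 0 < position k.
  by rewrite -(pmulr_rgt0 _ (expR_gt0 (tau k))) (lt_trans b_gt0).
have bk0 : 0 < b / position k by rewrite divr_gt0.
set s := epoch k + _.
have ks : epoch k <= s by rewrite lerDl ln_ge0// ler_pdivlMr ?mul1r.
have sk : s < epoch k.+1.
  rewrite epochS ltrD2l -ltr_expR lnK ?posrE//.
  by rewrite ltr_pdivrMr.
have Xs t : epoch k <= t < epoch k.+1 -> (b < X t) = (s < t).
  move=> ktk; rewrite (path_between ktk) /s -ltrBrDl -[RHS]ltr_expR lnK ?posrE//.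
  by rewrite ltr_pdivrMr.
have -> : up_time b = s%:E.
  apply/eqP; rewrite eq_le; apply/andP; split; last first.
    apply: up_time_ge => t /andP[t0 ts].
    have [tk|kt] := ltP t (epoch k).
      by have /andP[] := inside_path ink (t := t) ltac:(by rewrite t0).
    by rewrite leNgt Xs ?kt ?(lt_trans ts)// -leNgt ltW.
  (* At time [s] the path equals [b] and does not exceed it, so the infimum is not attained: it is
     approached by times slightly after [s] in the same round. *)
  apply/lee_addgt0Pr => e e0.
  pose u := s + Num.min e ((epoch k.+1 - s) / 2).
  have u1 : s < u by rewrite ltrDl lt_min e0/= divr_gt0// subr_gt0.
  have u2 : u < epoch k.+1.
    rewrite /u -ltrBrDl (le_lt_trans (y := (epoch k.+1 - s) / 2))//.
      by rewrite ge_min lexx orbT.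
    by rewrite ltr_pdivrMr// ltr_pMr ?subr_gt0// ltr1n.
  apply: (@le_trans _ _ u%:E); last by rewrite -EFinD lee_fin lerD2l ge_min lexx.
  have ku := le_trans ks (ltW u1).
  by apply: up_time_le; [exact: le_trans (epoch_ge0 k) ku|rewrite Xs ?ku].
split => //; apply: (@lt_le_trans _ _ (epoch k.+1)%:E); first by rewrite lte_fin.
apply: down_time_ge => t /andP[t0 tk].
have [tk'|kt] := ltP t (epoch k).
  by have /andP[] := inside_path ink (t := t) ltac:(by rewrite t0).
rewrite (path_between (k := k)) ?kt// (le_trans ak)// ler_peMl ?(ltW k0)//.
by rewrite -expR0 ler_expR subr_ge0.
Qed.

(** Growth cannot lead below [a], so this passage happens exactly at a claim epoch. *)
Lemma exit_down k : (forall i, (i < k)%N -> inside i) ->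
  expR (tau k) * position k <= b -> position k.+1 < a ->
  down_time a = (epoch k.+1)%:E /\ (down_time a < up_time b)%E.
Proof.
move=> ink bk ka.
have /andP[ak kb] := inside_position ink.
have k0 := le_trans a_ge0 ak.
have in_k t : 0 <= t < epoch k.+1 -> a <= X t <= b.
  move=> /andP[t0 tk].
  have [tk'|kt] := ltP t (epoch k); first by apply: (inside_path ink); rewrite t0.
  rewrite (path_between (k := k)) ?kt//; apply/andP; split.
    by rewrite (le_trans ak)// ler_peMl// -expR0 ler_expR subr_ge0.
  by rewrite (le_trans _ bk)// ler_wpM2r// ler_expR lerBlDl -epochS ltW.
have -> : down_time a = (epoch k.+1)%:E.
  apply/eqP; rewrite eq_le; apply/andP; split.
    by apply: down_time_le; [exact: epoch_ge0|rewrite path_epoch].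
  by apply: down_time_ge => t /in_k /andP[].
split => //.
(* Strictness needs a positive delay after the claim during which the path stays at most [b]: the
   whole next round from a nonpositive position, otherwise the climb from a position below a <=
   b. *)
have [d d0 Xd] : exists2 d, 0 < d & forall t, epoch k.+1 <= t < epoch k.+1 + d -> X t <= b.
  have ab : a <= b by case/andP: azb => /le_trans; apply.
  have [p0|p0] := leP (position k.+1) 0.
    exists (tau k.+1) => // t tk; rewrite (path_between (k := k.+1)) ?[epoch k.+2]epochS//.
    by rewrite (le_trans _ (ltW b_gt0))// mulr_ge0_le0 ?expR_ge0.
  have bp : 1 < b / position k.+1 by rewrite ltr_pdivlMr// mul1r (lt_le_trans ka).
  exists (Num.min (tau k.+1) (ln (b / position k.+1))).
    by rewrite lt_min tau_gt0 ln_gt0.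
  move=> t /andP[t1]; rewrite -ltrBlDl lt_min => /andP[t2 t3].
  rewrite (path_between (k := k.+1)); last by rewrite t1 epochS -ltrBlDl.
  rewrite -ler_pdivlMr//.
  have <- : expR (ln (b / position k.+1)) = b / position k.+1.
    by rewrite lnK// posrE (lt_trans _ bp).
  by rewrite ler_expR ltW.
apply: (@lt_le_trans _ _ (epoch k.+1 + d)%:E); first by rewrite lte_fin ltrDl.
apply: up_time_ge => t /andP[t0 td].
have [tk|kt] := ltP t (epoch k.+1); last by rewrite Xd ?kt.
by have /andP[] := in_k t ltac:(by rewrite t0).
Qed.

(** By [epoch_bracket] every time lies in some round, so staying inside in all rounds means staying
    inside forever. *)
Lemma exit_never : (forall i, inside i) -> up_time b = +oo%E /\ down_time a = +oo%E.
Proof.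
move=> inn.
have in_ t : 0 <= t -> a <= X t <= b.
  move=> t0; have [k /andP[_ tk]] := epoch_bracket t0.
  by apply: (@inside_path k.+1) => //; rewrite t0.
split; (rewrite /up_time /down_time (_ : [set t | _] = set0) ?image_set0 ?ereal_inf0//);
  apply/seteqP; split => // t [t0]; have /andP[ta tb] := in_ t t0.
  by rewrite ltNge tb.
by rewrite ltNge ta.
Qed.

Lemma claim_chain_position k : (claim_chain q a b z tau c k).2 = position k.
Proof. by elim: k => [//|k IH] /=; rewrite IH. Qed.

Lemma claim_chain_discount k : (forall i, (i < k)%N -> inside i) ->
  (claim_chain q a b z tau c k).1 = expR (- (q * epoch k)).
Proof.
elim: k => [_|k IH ink]; first by rewrite epoch0 mulr0 oppr0 expR0.
rewrite /= claim_chain_position ink//= IH; last by move=> i ik; exact/ink/leqW.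
by rewrite -expRD epochS; congr expR; ring.
Qed.

Lemma claim_chain_dead k i : (i < k)%N -> ~~ inside i ->
  (claim_chain q a b z tau c k).1 = 0.
Proof.
elim: k => [//|k IH]; rewrite ltnS leq_eqVlt => /predU1P[->|ik] ni /=.
  by rewrite claim_chain_position (negbTE ni).
by rewrite IH//; case: ifP; rewrite ?mul0r.
Qed.

(** The difference [ln b - ln y] is the time that exponential growth takes from [y] to [b]. *)
Definition pay_up y t := if b < expR t * y then expR (- (q * (ln b - ln y))) else 0.

Definition pay_down (g : R -> R) y t c :=
  if (expR t * y <= b) && (expR t * y - c < a)
  then expR (- (q * t)) * g (expR t * y - c) else 0.

Let series_at (u : nat -> \bar R) k : (forall j, j != k -> u j = 0%E) ->
  (\sum_(j <oo) u j = u k)%E.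
Proof.
move=> uk; apply: lim_near_cst => //; near=> n.
have kn : (k < n)%N by near: n; exists k.+1.
rewrite big_mkord (bigD1 (Ordinal kn))//=.
by rewrite big1 ?adde0// => i /eqP ik; apply: uk; apply/eqP => ik'; apply: ik; exact/val_inj.
Unshelve. all: by end_near. Qed.

(** Each series has at most one nonzero term, that of the first round not spent inside: earlier
    rounds pay nothing and later ones have discount factor 0. *)
Lemma exit_series (g : R -> R) :
  ((discount q (up_time b) * (up_time b < down_time a)%E%:R)%:E =
    \sum_(k <oo) ((claim_chain q a b z tau c k).1 *
      pay_up (claim_chain q a b z tau c k).2 (tau k))%:E)%E /\
  ((discount q (down_time a) * g (X (fine (down_time a))) *
    (down_time a < up_time b)%E%:R)%:E =
    \sum_(k <oo) ((claim_chain q a b z tau c k).1 *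
      pay_down g (claim_chain q a b z tau c k).2 (tau k) (c k))%:E)%E.
Proof.
have pay0 i : inside i -> pay_up (position i) (tau i) = 0 /\
    pay_down g (position i) (tau i) (c i) = 0.
  move=> /and4P[_ h1 h2 _]; rewrite /pay_up /pay_down ltNge h1/=.
  by rewrite ltNge h2.
have [inn|] := pselect (forall i, inside i).
  have [-> ->] := exit_never inn; rewrite ltxx/= mulr0 !mul0r.
  by split; rewrite eseries0// => k _ _; rewrite claim_chain_position;
    have [p1 p2] := pay0 k (inn k); rewrite ?p1 ?p2 mulr0.
move=> /existsNP[i0 /negP i0out].
have ex : exists i, ~~ inside i by exists i0.
case: (ex_minnP ex) => k kout kmin.
have ink i : (i < k)%N -> inside i.
  by move=> ik; apply: contraLR ik => /kmin; rewrite -leqNgt.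
(* Before round [k] the payments vanish, after it the discount factor does. *)
have off j : j != k -> (claim_chain q a b z tau c j).1 = 0 \/
    pay_up (position j) (tau j) = 0 /\ pay_down g (position j) (tau j) (c j) = 0.
  rewrite neq_ltn => /orP[/ink /pay0|kj]; first by right.
  by left; exact: claim_chain_dead kout.
rewrite !(series_at (k := k)); last 2 first.
- by move=> j /off; rewrite claim_chain_position => -[->|[p1 p2]]; rewrite ?p1 ?p2 ?mul0r ?mulr0.
- by move=> j /off; rewrite claim_chain_position => -[->|[p1 p2]]; rewrite ?p1 ?p2 ?mul0r ?mulr0.
rewrite claim_chain_position claim_chain_discount// /pay_up /pay_down.
have [bk|kb] := ltP b (expR (tau k) * position k).
  have [upE updown] := exit_up ink bk.
  rewrite updown [(down_time a < _)%E]ltNge ltW//= upE/=; split; last by rewrite !mulr0.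
  have k0 : 0 < position k.
    by rewrite -(pmulr_rgt0 _ (expR_gt0 (tau k))) (lt_trans b_gt0).
  by rewrite mulr1 -expRD ln_div ?posrE// mulrDr opprD.
(* With positive gap and claim and no crossing of [b], only the lower bound in [stays] can fail. *)
have ka : position k.+1 < a.
  rewrite ltNge; apply: contra kout => ak.
  by rewrite /stays tau_gt0 c_gt0 kb -[_ - _]/(position k.+1) ak.
have [downE downup] := exit_down ink kb ka.
rewrite downup [(up_time b < _)%E]ltNge ltW//= -[_ - c k]/(position k.+1) ka/=.
rewrite downE/= path_epoch/= !mulr0 mulr1; split => //.
by rewrite epochS mulrA -expRD mulrDr opprD.
Qed.

End Exit.

(** If ruin happens at a finite time s, [path_le] keeps the path below z e^(s + 1) until s + 1, so
    any larger level is crossed only after ruin. *)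
Lemma down_time_lt_up_time a : 0 <= z -> (down_time a < +oo)%E ->
  exists B, forall b, B <= b -> (down_time a < up_time b)%E.
Proof.
move=> z0 ay.
have a0 : (0 <= down_time a)%E.
  by apply: down_time_ge => t /andP[t0]; rewrite ltNge t0.
have : down_time a \is a fin_num by rewrite ge0_fin_numE.
move=> /fineK aE; set s := fine (down_time a) in aE.
have s0 : 0 <= s by rewrite -lee_fin aE.
exists (z * expR (s + 1)) => b zb.
apply: (@lt_le_trans _ _ (s + 1)%:E); first by rewrite -aE lte_fin ltrDl.
apply: up_time_ge => t /andP[t0 ts]; rewrite (le_trans (path_le z0 t0))//.
by rewrite (le_trans _ zb)// ler_wpM2l// ler_expR ltW.
Qed.

Lemma up_time_mono b b' : b <= b' -> (up_time b <= up_time b')%E.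
Proof.
move=> bb; apply: ereal_inf_le_tmp => _ [t [t0 bt] <-]; exists t => //.
by split => //; exact: le_lt_trans bt.
Qed.

End ClaimPath.

(** * Integrals of functions not known to be measurable *)

Section AeIntegral.
Local Open Scope ereal_scope.
Context d (T : measurableType d) (R : realType).
Variable mu : {measure set T -> \bar R}.

(** The integral of a nonnegative function is a supremum over simple functions below it, hence
    monotone for arbitrary functions. *)
Lemma ge0_le_integral_nonmeasurable (f g : T -> \bar R) :
  (forall x, 0 <= f x) -> (forall x, f x <= g x) ->
  \int[mu]_x f x <= \int[mu]_x g x.
Proof.
move=> f0 fg; rewrite !ge0_integralTE//; last by move=> x; exact: le_trans (fg x).
apply: ereal_sup_le => _ [h hf <-]; exists h => // x.
exact: le_trans (hf x) (fg x).
Qed.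

(* The passage functionals are not known to be measurable; they only agree with
   measurable series off a null set. *)
Lemma ge0_integral_eq_off_null (N : set T) (f g : T -> \bar R) :
  measurable N -> mu N = 0 -> measurable_fun setT g ->
  (forall x, 0 <= f x) -> (forall x, 0 <= g x) ->
  (forall x, ~ N x -> f x = g x) ->
  \int[mu]_x f x = \int[mu]_x g x.
Proof.
move=> mN N0 mg f0 g0 fg.
(* [f] lies between the measurable [l] and [u], which are 0 and +oo on [N] and equal [g] elsewhere,
   hence have the integral of [g]. *)
pose u x := g x + (\1_N x)%:E * +oo.
pose l x := g x * (\1_(~` N) x)%:E.
have mu' : measurable_fun setT u.
  apply: emeasurable_funD => //; apply: emeasurable_funM => //.
  exact/measurable_EFinP/measurable_indic.
have ml : measurable_fun setT l.
  apply: emeasurable_funM => //; apply/measurable_EFinP/measurable_indic.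
  exact: measurableC.
have u0 x : 0 <= u x by rewrite adde_ge0// mule_ge0// lee_fin.
have l0 x : 0 <= l x by rewrite mule_ge0// lee_fin.
have ug x : ~ N x -> u x = g x.
  by move=> Nx; rewrite /u indicE memNset// mul0e adde0.
have lg x : ~ N x -> l x = g x.
  by move=> Nx; rewrite /l indicE mem_set// mule1.
have ugE : \int[mu]_x u x = \int[mu]_x g x.
  apply: ge0_ae_eq_integral => //; exists N; split => // x /=.
  by apply: contra_notP => /ug ->.
have lgE : \int[mu]_x l x = \int[mu]_x g x.
  apply: ge0_ae_eq_integral => //; exists N; split => // x /=.
  by apply: contra_notP => /lg ->.
apply/eqP; rewrite eq_le; apply/andP; split.
  rewrite -ugE; apply: ge0_le_integral_nonmeasurable => // x.
  have [Nx|Nx] := pselect (N x); last by rewrite ug// fg.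
  by rewrite /u indicE mem_set// mul1e addey ?leey// -ltNye (lt_le_trans _ (g0 x)).
rewrite -lgE; apply: ge0_le_integral_nonmeasurable => // x.
have [Nx|Nx] := pselect (N x); last by rewrite lg// fg.
by rewrite /l indicE memNset ?mule0//= => /(_ Nx).
Qed.

End AeIntegral.

(** * Expectations of the passage functionals *)

Section PassageLaw.
Context {d : measure_display} {T : measurableType d} {R : realType}.
Variables (P : probability T R) (lam q : R) (tau C : nat -> {RV P >-> R}).
Variables (N : R -> T -> nat) (z : R) (X : R -> T -> R).
Hypothesis lam_gt0 : 0 < lam.
Hypothesis q_ge0 : 0 <= q.
Hypothesis N_poisson : poisson_process lam tau N.
Hypothesis C_iid : iid_exponential 1 C.
Hypothesis NC_indep : independent_sequences tau C.
Hypothesis X_segerdahl : segerdahl_process 1 0 z N C X.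
Hypothesis z_gt0 : 0 < z.

Let tau_law k : exponential_law lam (tau k). Proof. by case: N_poisson. Qed.
Let tau_indep : mutually_independent tau. Proof. by case: N_poisson. Qed.
Let C_law k : exponential_law 1 (C k). Proof. by case: C_iid. Qed.
Let C_indep : mutually_independent C. Proof. by case: C_iid. Qed.

(** The defining properties of a claim path, positive gaps and positive claims, hold exactly off
    this null event. *)
Definition degenerate : set T :=
  \bigcup_k ((tau k @^-1` `]-oo, 0]) `|` (C k @^-1` `]-oo, 0])).

Let mY (Y : {RV P >-> R}) : measurable (Y @^-1` `]-oo, 0]).
Proof. by rewrite -[_ @^-1` _]setTI; exact: measurable_funP. Qed.

Lemma measurable_degenerate : measurable degenerate.
Proof. by apply: bigcup_measurable => k _; apply: measurableU; exact: mY. Qed.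

Lemma degenerate_null : P degenerate = 0%E.
Proof.
apply/(negligibleP P measurable_degenerate); apply: negligible_bigcup => k.
apply: negligibleU; apply/(negligibleP P (mY _)).
  exact: exponential_law_le0 lam_gt0 (tau_law k).
exact: exponential_law_le0 ltr01 (C_law k).
Qed.

Section Path.
Variable w : T.
Hypothesis w_ok : ~ degenerate w.

Lemma tau_pos k : 0 < tau k w.
Proof.
rewrite ltNge; apply/negP => h; apply: w_ok; exists k => //; left.
by rewrite /= in_itv/=.
Qed.

Lemma C_pos k : 0 < C k w.
Proof.
rewrite ltNge; apply/negP => h; apply: w_ok; exists k => //; right.
by rewrite /= in_itv/=.
Qed.

Lemma N_counts t k : 0 <= t -> (k <= N t w)%N = (\sum_(i < k) tau i w <= t).
Proof. by case: N_poisson => _ _; exact. Qed.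

Lemma X_solves t : 0 <= t ->
  lebesgue_measure.-integrable `[0, t] (EFin \o X ^~ w) /\
  X t w = z + \int[lebesgue_measure]_(s in `[0, t]) X s w - \sum_(i < N t w) C i w.
Proof.
move=> t0; have [iX ->] := X_segerdahl w t0.
have iE : (fun s => (0 + 1 * X s w)%:E) = EFin \o X ^~ w.
  by apply/funext => s; rewrite add0r mul1r.
split; first by rewrite -iE.
by congr (_ + _ - _); apply: eq_Rintegral => s _; rewrite add0r mul1r.
Qed.

End Path.

Section Bounded.
Variables (a b : R).
Hypothesis a_ge0 : 0 <= a.
Hypothesis azb : a <= z <= b.
Variable g : R -> R.
Hypothesis g_ge0 : forall y, 0 <= g y.
Hypothesis mg : measurable_fun setT g.

Local Notation Z := (claims q a b z tau C).

Definition up_series w : \bar R :=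
  (\sum_(k <oo) ((Z w k).1 * pay_up q b (Z w k).2 (tau k w))%:E)%E.

Definition down_series w : \bar R :=
  (\sum_(k <oo) ((Z w k).1 * pay_down q a b g (Z w k).2 (tau k w) (C k w))%:E)%E.

Lemma up_seriesE w : ~ degenerate w ->
  (discount q (passage_above X b w) * (passage_above X b w < passage_below X a w)%E%:R)%:E
  = up_series w.
Proof.
move=> w_ok.
by have [+ _] := exit_series (tau_pos w_ok) (C_pos w_ok) (N_counts w) (X_solves w)
  q a_ge0 z_gt0 azb g; exact.
Qed.

Lemma down_seriesE w : ~ degenerate w ->
  (discount q (passage_below X a w) * g (X (fine (passage_below X a w)) w) *
   (passage_below X a w < passage_above X b w)%E%:R)%:E
  = down_series w.
Proof.
move=> w_ok.
by have [_ +] := exit_series (tau_pos w_ok) (C_pos w_ok) (N_counts w) (X_solves w)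
  q a_ge0 z_gt0 azb g; exact.
Qed.

Lemma measurable_pay_up : measurable_fun setT
  (fun x : R * R * R => pay_up q b x.1.1 x.1.2).
Proof.
have m1 : measurable_fun setT (fun x : R * R * R => x.1.1) by exact: measurableT_comp.
have m2 : measurable_fun setT (fun x : R * R * R => expR x.1.2 * x.1.1).
  by apply: measurable_funM => //; apply: measurableT_comp => //; exact: measurableT_comp.
apply: measurable_fun_ifT => //; first exact: measurable_fun_ltr.
apply: measurableT_comp => //; apply: measurableT_comp => //.
apply: measurable_funM => //; apply: measurable_funB => //.
by apply: measurableT_comp => //; exact: measurable_ln.
Qed.

Lemma measurable_pay_down : measurable_fun setT
  (fun x : R * R * R => pay_down q a b g x.1.1 x.1.2 x.2).
Proof.
have m12 : measurable_fun setT (fun x : R * R * R => x.1.2) by exact: measurableT_comp.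
have m2 : measurable_fun setT (fun x : R * R * R => expR x.1.2 * x.1.1).
  by apply: measurable_funM => //; [exact: measurableT_comp|exact: measurableT_comp].
have m3 : measurable_fun setT (fun x : R * R * R => expR x.1.2 * x.1.1 - x.2).
  exact: measurable_funB.
apply: measurable_fun_ifT => //.
  by apply: measurable_and; [exact: measurable_fun_ler|exact: measurable_fun_ltr].
apply: measurable_funM; last exact: measurableT_comp.
by apply: measurableT_comp => //; apply: measurableT_comp => //; exact: measurable_funM.
Qed.

Lemma pay_up_ge0 y t : 0 <= pay_up q b y t.
Proof. by rewrite /pay_up; case: ifP => // _; exact: expR_ge0. Qed.

Lemma pay_down_ge0 y t c : 0 <= pay_down q a b g y t c.
Proof. by rewrite /pay_down; case: ifP => // _; rewrite mulr_ge0 ?expR_ge0. Qed.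

Let up_term k w := ((Z w k).1 * pay_up q b (Z w k).2 (tau k w))%:E.
Let down_term k w :=
  ((Z w k).1 * pay_down q a b g (Z w k).2 (tau k w) (C k w))%:E.

Let up_term_ge0 k w : (0 <= up_term k w)%E.
Proof. by rewrite lee_fin mulr_ge0 ?claim_chain_ge0 ?pay_up_ge0. Qed.

Let down_term_ge0 k w : (0 <= down_term k w)%E.
Proof. by rewrite lee_fin mulr_ge0 ?claim_chain_ge0 ?pay_down_ge0. Qed.

Let mup k : measurable_fun setT (up_term k).
Proof.
apply: (@measurable_paid _ _ _ P q a b z tau C (fun y t _ => (pay_up q b y t)%:E)).
by apply/measurable_EFinP; exact: measurable_pay_up.
Qed.

Let mdown k : measurable_fun setT (down_term k).
Proof.
apply: (@measurable_paid _ _ _ P q a b z tau C (fun y t c => (pay_down q a b g y t c)%:E)).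
by apply/measurable_EFinP; exact: measurable_pay_down.
Qed.

Lemma up_series_ge0 w : (0 <= up_series w)%E.
Proof. by apply: nneseries_ge0 => k _ _; exact: up_term_ge0. Qed.

Lemma down_series_ge0 w : (0 <= down_series w)%E.
Proof. by apply: nneseries_ge0 => k _ _; exact: down_term_ge0. Qed.

Lemma measurable_up_series : measurable_fun setT up_series.
Proof. by apply: ge0_emeasurable_sum => [k w _ _|k _]; [exact: up_term_ge0|exact: mup]. Qed.

Lemma measurable_down_series : measurable_fun setT down_series.
Proof. by apply: ge0_emeasurable_sum => [k w _ _|k _]; [exact: down_term_ge0|exact: mdown]. Qed.

(** Two-sided ruin weighted by a function [g] of the position at ruin: g = 1 gives [ruin_before],
    and exponential weights give [ruin_deficit] as [b] tends to infinity. *)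
Definition exit_below_mean : \bar R :=
  (\int[P]_w (discount q (passage_below X a w) * g (X (fine (passage_below X a w)) w) *
   (passage_below X a w < passage_above X b w)%E%:R)%:E)%E.

Lemma discount_ge0 (t : \bar R) : 0 <= discount q t.
Proof. by case: t => [t||] //=; exact: expR_ge0. Qed.

Lemma exit_above_series : (exit_above P q X a b = \int[P]_w up_series w)%E.
Proof.
rewrite /exit_above unlock.
apply: (ge0_integral_eq_off_null measurable_degenerate degenerate_null).
- exact: measurable_up_series.
- by move=> w; rewrite lee_fin mulr_ge0 ?discount_ge0.
- exact: up_series_ge0.
- by move=> w; exact: up_seriesE.
Qed.

Lemma exit_below_series : (exit_below_mean = \int[P]_w down_series w)%E.
Proof.
apply: (ge0_integral_eq_off_null measurable_degenerate degenerate_null).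
- exact: measurable_down_series.
- by move=> w; rewrite lee_fin !mulr_ge0 ?discount_ge0.
- exact: down_series_ge0.
- by move=> w; exact: down_seriesE.
Qed.

Local Open Scope ereal_scope.

(** The payoff paying [hb] at an up-passage and kappa times [g] at a down-passage is fed to
    [first_passage_series]; the sum then splits into the two passage series. *)
Lemma two_sided_identity (h : R -> R) (B hb kappa : R) :
  (forall y, 0 <= h y)%R -> (forall y, h y <= B)%R -> measurable_fun setT h ->
  (0 <= hb)%R -> (0 <= kappa)%R ->
  (forall y, (a <= y <= b)%R ->
    round_mean lam (fun t c =>
     (hb * pay_up q b y t + kappa * pay_down q a b g y t c)%:E +
     (if stays a b y t c then expR (- (q * t)) * h (expR t * y - c) else 0)%:E) =
    (h y)%:E) ->
  (h z)%:E = hb%:E * exit_above P q X a b + kappa%:E * exit_below_mean.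
Proof.
move=> h0 hB mh hb0 k0 round.
pose pay y t c : \bar R := (hb * pay_up q b y t + kappa * pay_down q a b g y t c)%:E.
have pay0 y t c : 0 <= pay y t c.
  by rewrite lee_fin addr_ge0 ?mulr_ge0 ?pay_up_ge0 ?pay_down_ge0.
have mpay : measurable_fun setT (fun x : R * R * R => pay x.1.1 x.1.2 x.2).
  apply/measurable_EFinP; apply: measurable_funD; apply: measurable_funM => //.
    exact: measurable_pay_up.
  exact: measurable_pay_down.
rewrite (first_passage_series lam_gt0 tau_law C_law tau_indep C_indep NC_indep
  q_ge0 a_ge0 azb pay0 mpay h0 hB mh round).
rewrite exit_above_series exit_below_series.
rewrite [in X in hb%:E * X]/up_series integral_nneseries//; last first.
  by move=> k w _; exact: up_term_ge0.
rewrite [in X in kappa%:E * X]/down_series integral_nneseries//; last first.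
  by move=> k w _; exact: down_term_ge0.
rewrite -!nneseriesZl; last 2 first.
- by move=> k _; apply: integral_ge0 => w _; exact: down_term_ge0.
- by move=> k _; apply: integral_ge0 => w _; exact: up_term_ge0.
rewrite -nneseriesD; last 2 first.
- move=> k _ _; rewrite mule_ge0 ?lee_fin//.
  by apply: integral_ge0 => w _; exact: up_term_ge0.
- move=> k _ _; rewrite mule_ge0 ?lee_fin//.
  by apply: integral_ge0 => w _; exact: down_term_ge0.
apply: eq_eseriesr => k _.
rewrite -(ge0_integralZl P measurableT (mup k) (fun w _ => up_term_ge0 k w))//.
rewrite -(ge0_integralZl P measurableT (mdown k) (fun w _ => down_term_ge0 k w))//.
rewrite -ge0_integralD//; last 4 first.
- by move=> w _; rewrite mule_ge0 ?lee_fin ?mulr_ge0 ?claim_chain_ge0 ?pay_up_ge0.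
- by apply: emeasurable_funM => //; exact: mup.
- by move=> w _; rewrite mule_ge0 ?lee_fin ?mulr_ge0 ?claim_chain_ge0 ?pay_down_ge0.
- by apply: emeasurable_funM => //; exact: mdown.
by apply: eq_integral => w _; rewrite /pay -!EFinM -EFinD; congr (_%:E); ring.
Qed.

End Bounded.

Section Unbounded.
Variables (a : R) (g : R -> R).
Hypothesis a_ge0 : 0 <= a.
Hypothesis az : a <= z.
Hypothesis g_ge0 : forall y, 0 <= g y.
Hypothesis mg : measurable_fun setT g.

Local Open Scope ereal_scope.

Let f w : R := (discount q (passage_below X a w) * g (X (fine (passage_below X a w)) w))%R.

Let f_ge0 w : (0 <= f w)%R.
Proof. by rewrite mulr_ge0 ?discount_ge0. Qed.

Let zn n : (a <= z <= z + n%:R)%R. Proof. by rewrite az lerDl ler0n. Qed.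

(** The down series is set to 0 on the null event, so that monotonicity in [n] holds on every
    path. *)
Let s n w := down_series a (z + n%:R) g w * (\1_(~` degenerate) w)%:E.

Let sE n w : ~ degenerate w -> s n w =
  (f w * (passage_below X a w < passage_above X (z + n%:R) w)%E%:R)%:E.
Proof.
by move=> w_ok; rewrite /s indicE mem_set// mule1 down_seriesE.
Qed.

Let s0 n w : degenerate w -> s n w = 0.
Proof. by move=> w_bad; rewrite /s indicE memNset ?mule0//= => /(_ w_bad). Qed.

(** Monotone convergence: raising the upper level only enlarges the event. If ruin occurs, it
    precedes the up-passage for all large [n]; if it never occurs, the discount is 0. *)
Lemma exit_below_mean_cvg :
  exit_below_mean a (z + n%:R) g @[n --> \oo] --> \int[P]_w (f w)%:E.
Proof.
have ms n : measurable_fun setT (s n).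
  apply: emeasurable_funM; first exact: measurable_down_series.
  apply/measurable_EFinP/measurable_indic; apply: measurableC.
  exact: measurable_degenerate.
have s_ge0 n w : 0 <= s n w.
  by rewrite mule_ge0 ?lee_fin// down_series_ge0.
have snd w : {homo s ^~ w : n m / (n <= m)%N >-> n <= m}.
  move=> n m nm; have [w_bad|w_ok] := pselect (degenerate w); first by rewrite !s0.
  rewrite !sE// lee_fin ler_wpM2l//.
  have := @up_time_mono _ (X ^~ w) (z + n%:R)%R (z + m%:R)%R.
  rewrite lerD2l ler_nat => /(_ nm) le_up.
  have [lt_n|] := boolP (_ < passage_above X (z + n%:R) w); last by rewrite ler0n.
  by rewrite (lt_le_trans lt_n).
have mean_s n : exit_below_mean a (z + n%:R) g = \int[P]_w s n w.
  rewrite exit_below_series//.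
  apply/esym/(ge0_integral_eq_off_null measurable_degenerate degenerate_null) => //.
  - exact: measurable_down_series.
  - by move=> w; exact: down_series_ge0.
  - by move=> w w_ok; rewrite /s indicE mem_set// mule1.
have lim_s w : ~ degenerate w -> limn (s ^~ w) = (f w)%:E.
  move=> w_ok; have [fy|fy] := ltP (passage_below X a w) +oo.
    have [B hB] := down_time_lt_up_time (tau_pos w_ok) (C_pos w_ok) (N_counts w)
      (X_solves w) (ltW z_gt0) fy.
    apply: lim_near_cst => //; near=> n.
    rewrite sE//.
    have -> : passage_below X a w < passage_above X (z + n%:R) w; last by rewrite mulr1.
    apply: hB; near: n; exists (Num.truncn `|B|%R).+1 => // n /= Bn.
    rewrite (le_trans (ler_norm B))// (le_trans (ltW (truncnS_gt _)))//.
    by rewrite (le_trans (y := n%:R)) ?ler_nat// lerDr ltW.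
  have f_0 : f w = 0%R by move: fy; rewrite leye_eq /f => /eqP ->; rewrite mul0r.
  by apply: lim_near_cst => //; near=> n; rewrite sE// f_0 mul0r.
have -> : \int[P]_w (f w)%:E = \int[P]_w limn (s ^~ w).
  apply: (ge0_integral_eq_off_null measurable_degenerate degenerate_null).
  - apply: emeasurable_fun_cvg ms _ => w _.
    exact: ereal_nondecreasing_is_cvgn.
  - by move=> w; rewrite lee_fin.
  - move=> w; apply: lime_ge; first exact: ereal_nondecreasing_is_cvgn.
    exact: nearW.
  - by move=> w /lim_s ->.
rewrite (_ : (fun n => _) = fun n => \int[P]_w s n w); last exact/funext.
by apply: cvg_monotone_convergence => // w _; exact: snd.
Unshelve. all: by end_near. Qed.

End Unbounded.

End PassageLaw.

(** * Kummer's series *)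

Section Kummer.
Context {R : realType}.
Implicit Types (a b z : R) (k : nat).

Lemma pochhammerS a k : pochhammer a k.+1 = pochhammer a k * (a + k%:R).
Proof. by rewrite /pochhammer big_ord_recr. Qed.

Lemma pochhammerSl a k : pochhammer a k.+1 = a * pochhammer (a + 1) k.
Proof.
rewrite /pochhammer big_ord_recl addr0; congr (_ * _); apply: eq_bigr => i _.
by rewrite /= /bump add1n -natr1 [_ + 1]addrC addrA.
Qed.

Lemma pochhammer_gt0 a k : 0 < a -> 0 < pochhammer a k.
Proof. by move=> a0; apply: prodr_gt0 => i _; rewrite ltr_wpDr. Qed.

Lemma pochhammer_ge0 a k : 0 <= a -> 0 <= pochhammer a k.
Proof. by move=> a0; apply: prodr_ge0 => i _; rewrite addr_ge0. Qed.

Lemma pochhammer_step a k : a * pochhammer (a + 1) k = pochhammer a k * (a + k%:R).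
Proof. by rewrite -pochhammerSl pochhammerS. Qed.

Definition kummer_coef a b k : R := pochhammer a k / pochhammer b k / k`!%:R.

Lemma kummerM_pseries a b z : kummerM a b z = limn (pseries (kummer_coef a b) z).
Proof.
congr (limn _); apply/funext => m; rewrite /pseries /series/=.
by apply: eq_bigr => k _; rewrite /kummer_coef mulrA mulrAC.
Qed.

Lemma is_cvg_kummer a b z : 0 < b -> cvgn (pseries (kummer_coef a b) z).
Proof.
move=> b0; apply: normed_cvg => /=.
(* Each factor (a + k) / (b + k) is at most 1 + |a| / b in absolute value, so the series is
   dominated by that of exp (B |z|). *)
pose B := 1 + `|a| / b.
have B1 : 1 <= B by rewrite lerDl divr_ge0// ltW.
have le_pow k : `|pochhammer a k / pochhammer b k| <= B ^+ k.
  elim: k => [|k IH]; first by rewrite /pochhammer !big_ord0 divr1 normr1 expr0.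
  have bk : 0 < b + k%:R by rewrite ltr_wpDr.
  rewrite !pochhammerS invfM mulrACA normrM exprS mulrC ler_pM//.
  rewrite normrM normfV (gtr0_norm bk) ler_pdivrMr//.
  rewrite (le_trans (ler_normD _ _))// (ger0_norm (ler0n _ _)) /B.
  rewrite mulrDl mul1r addrC lerD//; first by rewrite lerDr ltW.
  rewrite mulrAC ler_pdivlMr// mulrDr lerDl mulr_ge0//.
apply: (series_le_cvg _ _ _ (is_cvg_series_exp_coeff (B * `|z|))) => k.
- exact: normr_ge0.
- by apply: exp_coeff_ge0; rewrite mulr_ge0// (le_trans ler01).
- rewrite /kummer_coef /exp_coeff/= normrM normrM normfV (ger0_norm (ler0n _ _)).
  rewrite normrX exprMn mulrAC ler_wpM2r ?invr_ge0//.
  by rewrite ler_wpM2r ?exprn_ge0.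
Qed.

Lemma kummer_coef_diffs a b : 0 < b ->
  pseries_diffs (kummer_coef a b) = (a / b) *: kummer_coef (a + 1) (b + 1).
Proof.
move=> b0; apply/funext => k; rewrite /pseries_diffs /kummer_coef/=.
rewrite !pochhammerSl factS natrM [RHS]/GRing.scale/=.
rewrite -[k.+1%:R * _]mulrC !invfM.
have k0 : k.+1%:R != 0 :> R by [].
by rewrite [RHS]/GRing.scale/= -[RHS]mulr1 -[X in _ = _ * X](mulVf k0); ring.
Qed.

Lemma pseriesZ (r : R) (c : R^nat) z : pseries (r *: c) z = r *: pseries c z.
Proof.
by rewrite /pseries -seriesZ; congr series; apply/funext => i; rewrite !fctE /GRing.scale/= mulrA.
Qed.

Lemma is_derive_kummerM a b z : 0 < b ->
  is_derive z 1 (kummerM a b) (a / b * kummerM (a + 1) (b + 1) z).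
Proof.
move=> b0; have b1 : 0 < b + 1 by rewrite addr_gt0.
have b2 : 0 < b + 1 + 1 by rewrite addr_gt0.
have -> : kummerM a b = fun x => limn (pseries (kummer_coef a b) x).
  by apply/funext => x; exact: kummerM_pseries.
have -> : a / b * kummerM (a + 1) (b + 1) z =
    limn (pseries (pseries_diffs (kummer_coef a b)) z).
  rewrite kummer_coef_diffs// pseriesZ limZl_tmp ?kummerM_pseries//.
  exact: is_cvg_kummer.
apply: (@pseries_snd_diffs _ _ (`|z| + 1)).
- exact: is_cvg_kummer.
- rewrite kummer_coef_diffs// pseriesZ; apply: is_cvgZl_tmp; exact: is_cvg_kummer.
- have -> : pseries_diffs (pseries_diffs (kummer_coef a b)) =
      (a / b) *: ((a + 1) / (b + 1) *: kummer_coef (a + 1 + 1) (b + 1 + 1)).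
    rewrite -kummer_coef_diffs// kummer_coef_diffs//.
    by apply/funext => i; rewrite /pseries_diffs/= /GRing.scale/= mulrCA.
  by rewrite !pseriesZ; do 2 apply: is_cvgZl_tmp; exact: is_cvg_kummer.
- by rewrite [ltRHS]ger0_norm ?addr_ge0// ltrDl.
Qed.

(** Coefficientwise this is (b + k) / (b + 1)_k = b / (b)_k. It says that z^b M(a, b + 1, z) has
    derivative b z^(b - 1) M(a, b, z). *)
Lemma kummerM_lower_b a b z : 0 < b ->
  b * kummerM a (b + 1) z + z * (a / (b + 1) * kummerM (a + 1) (b + 1 + 1) z) =
  b * kummerM a b z.
Proof.
move=> b0; have b1 : 0 < b + 1 by rewrite addr_gt0.
have b2 : 0 < b + 1 + 1 by rewrite addr_gt0.
have cM := @is_cvg_kummer a (b + 1) z b1.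
have cMb := @is_cvg_kummer a b z b0.
have dM : series (fun i => i%:R * kummer_coef a (b + 1) i * z ^+ i.-1) @ \oo -->
    a / (b + 1) * kummerM (a + 1) (b + 1 + 1) z.
  have -> : a / (b + 1) * kummerM (a + 1) (b + 1 + 1) z =
      limn (pseries (pseries_diffs (kummer_coef a (b + 1))) z).
    rewrite kummer_coef_diffs// pseriesZ limZl_tmp ?kummerM_pseries//.
    exact: is_cvg_kummer.
  apply: pseries_diffs_equiv; rewrite kummer_coef_diffs// pseriesZ.
  by apply: is_cvgZl_tmp; exact: is_cvg_kummer.
have lhs : (b *: pseries (kummer_coef a (b + 1)) z +
    z *: series (fun i => i%:R * kummer_coef a (b + 1) i * z ^+ i.-1)) @ \oo -->
    b * kummerM a (b + 1) z + z * (a / (b + 1) * kummerM (a + 1) (b + 1 + 1) z).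
  apply: cvgD; last exact: cvgZl_tmp.
  by rewrite kummerM_pseries; exact: cvgZl_tmp.
have rhs : (b *: pseries (kummer_coef a b) z) @ \oo --> b * kummerM a b z.
  by rewrite kummerM_pseries; exact: cvgZl_tmp.
rewrite -(cvg_lim _ lhs)// -(cvg_lim _ rhs)//; congr (limn _).
rewrite /pseries -!seriesZ -seriesD; congr series; apply/funext => k.
rewrite !fctE /GRing.scale/=.
have -> : z * (k%:R * kummer_coef a (b + 1) k * z ^+ k.-1) =
    k%:R * kummer_coef a (b + 1) k * z ^+ k.
  by case: k => [|k]; rewrite ?mul0r ?mulr0// exprS mulrCA mulrA.
have pb : pochhammer b k != 0 by rewrite gt_eqF ?pochhammer_gt0.
have pb1 : pochhammer (b + 1) k != 0 by rewrite gt_eqF ?pochhammer_gt0.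
have st := pochhammer_step b k.
have key : (b + k%:R) / pochhammer (b + 1) k = b / pochhammer b k.
  apply/eqP; rewrite eqr_div//; apply/eqP; rewrite st; ring.
transitivity ((b + k%:R) / pochhammer (b + 1) k * (pochhammer a k / k`!%:R * z ^+ k)).
  rewrite /kummer_coef; ring.
by rewrite key /kummer_coef; ring.
Qed.

(** Coefficientwise, from a (a + 1)_k = (a)_k (a + k) and b (b + 1)_k = (b)_k (b + k). The left side
    is the derivative of M(a, b, z). *)
Lemma kummerM_derive_raise_b a b z : 0 < b ->
  a / b * kummerM (a + 1) (b + 1) z =
  kummerM a b z - (b - a) / b * kummerM a (b + 1) z.
Proof.
move=> b0; have b1 : 0 < b + 1 by rewrite addr_gt0.
have cM0 := @is_cvg_kummer a b z b0.
have cM1 := @is_cvg_kummer a (b + 1) z b1.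
have cM2 := @is_cvg_kummer (a + 1) (b + 1) z b1.
have lhs : ((a / b) *: pseries (kummer_coef (a + 1) (b + 1)) z) @ \oo -->
    a / b * kummerM (a + 1) (b + 1) z.
  by rewrite kummerM_pseries; exact: cvgZl_tmp.
have rhs : (pseries (kummer_coef a b) z - ((b - a) / b) *: pseries (kummer_coef a (b + 1)) z)
   @ \oo --> kummerM a b z - (b - a) / b * kummerM a (b + 1) z.
  apply: cvgB; first by rewrite kummerM_pseries; exact: is_cvg_kummer.
  by rewrite kummerM_pseries; exact: cvgZl_tmp.
rewrite -(cvg_lim _ lhs)// -(cvg_lim _ rhs)//; congr (limn _).
rewrite /pseries -!seriesZ -seriesN -seriesD; congr series; apply/funext => k.
rewrite !fctE /GRing.scale/=.
have pb : pochhammer b k != 0 by rewrite gt_eqF ?pochhammer_gt0.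
have pb1 : pochhammer (b + 1) k != 0 by rewrite gt_eqF ?pochhammer_gt0.
have b0' : b != 0 by rewrite gt_eqF.
have sa := pochhammer_step a k.
have key : (b + k%:R) / b / pochhammer (b + 1) k = (pochhammer b k)^-1.
  have pbE : pochhammer b k * (b + k%:R) = b * pochhammer (b + 1) k.
    by rewrite pochhammer_step.
  have bk : b + k%:R != 0 by rewrite gt_eqF// ltr_wpDr.
  have -> : pochhammer b k = b * pochhammer (b + 1) k / (b + k%:R).
    by rewrite -pbE mulfK.
  by field; rewrite bk b0' pb1.
have -> : a / b * (kummer_coef (a + 1) (b + 1) k * z ^+ k) =
   (a * pochhammer (a + 1) k) / b / pochhammer (b + 1) k / k`!%:R * z ^+ k.
  rewrite /kummer_coef; ring.
rewrite sa /kummer_coef -key; ring.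
Qed.

End Kummer.

(** * Affine changes of variables *)

Section ChangeOfVariables.
Context {R : realType}.
Local Notation mu := (@lebesgue_measure R).
Local Open Scope ereal_scope.

(** The image of the Lebesgue measure under the affine map, scaled by |k|, gives every interval ]x,
    y] its length, hence is the Lebesgue measure. *)
Lemma ge0_integral_affine (c k : R) (f : R -> \bar R) : (k != 0)%R ->
  measurable_fun setT f -> (forall x, 0 <= f x) ->
  \int[mu]_x f (c + k * x)%R = (`|k|^-1)%:E * \int[mu]_x f x.
Proof.
move=> k0 mf f0; pose phi : measurableTypeR R -> measurableTypeR R := fun x => (c + k * x)%R.
have k_gt0 : (0 < `|k|)%R by rewrite normr_gt0.
have mphi : measurable_fun setT phi.
  by apply: measurable_funD => //; exact: measurable_funM.
pose nu := mscale (NngNum (normr_ge0 k))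
  (measure_function_pushforward__canonical__measure_function_Measure mu mphi).
have nuE (X : set (measurableTypeR R)) : ocitv X -> mu X = nu X.
  move=> [[x y] _ <-]; rewrite /nu/= /mscale/= /pushforward.
  have -> : phi @^-1` `]x, y]%classic = if (0 < k)%R then `]((x - c) / k)%R, ((y - c) / k)%R]%classic
      else `[((y - c) / k)%R, ((x - c) / k)%R[%classic.
    apply/seteqP; split => t /=; case: ltP => [kp|kn]; rewrite /= !in_itv/= /phi.
    - by rewrite ltr_pdivrMr// ler_pdivlMr// ltrBlDl lerBrDl mulrC.
    - have kn' : (k < 0)%R by rewrite lt_neqAle k0.
      by rewrite ltr_ndivlMr// ler_ndivrMr// ltrBlDl lerBrDl mulrC andbC.
    - by rewrite ltr_pdivrMr// ler_pdivlMr// ltrBlDl lerBrDl mulrC.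
    - have kn' : (k < 0)%R by rewrite lt_neqAle k0.
      by rewrite ltr_ndivlMr// ler_ndivrMr// ltrBlDl lerBrDl mulrC andbC.
  rewrite !lebesgue_measure_itv/=; case: (ltP 0%R k) => [kp|kn]; rewrite lebesgue_measure_itv/= !lte_fin.
    rewrite ltr_pM2r ?invr_gt0// ltrD2r; case: ifP => _; last by rewrite mule0.
    rewrite -!EFinD -EFinM gtr0_norm//; congr (_%:E).
    by field.
  have kn' : (k < 0)%R by rewrite lt_neqAle k0.
  rewrite ltr_nM2r ?invr_lt0// ltrD2r; case: ifP => _; last by rewrite mule0.
  rewrite -!EFinD -EFinM ltr0_norm//; congr (_%:E).
  by field.
have muE := lebesgue_measure_unique nuE.
have -> : \int[mu]_x f x = \int[nu]_x f x.
  by apply: eq_measure_integral => A mA _; exact: muE.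
rewrite /nu ge0_integral_mscale//= ge0_integral_pushforward//.
by rewrite muleA -EFinM mulVf ?gt_eqF// mul1e.
Qed.

Lemma integral_reflect (a z : R) (f : R -> R) :
  measurable_fun `]a, z[ f ->
  \int[mu]_(y in `]0%R, (z - a)%R[) (f (z - y))%:E = \int[mu]_(y in `]a, z[) (f y)%:E.
Proof.
move=> mf; pose g := (EFin \o f) \_ `]a, z[.
have mg : measurable_fun setT g.
  by apply/(measurable_restrictT _ _).1 => //; exact/measurable_EFinP.
have gE : (fun y => (f (z - y))%:E) \_ `]0%R, (z - a)%R[ = g \o (fun y => z + (-1) * y)%R.
  apply/funext => y; rewrite /= /g !patchE mulN1r.
  have -> : ((z - y)%R \in `]a, z[%classic) = (y \in `]0%R, (z - a)%R[%classic).
    apply/idP/idP; rewrite !inE/= !in_itv/= ltrBrDl ltrBrDr;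
      rewrite ltrBlDr ltrDl => /andP[-> ->]; by [].
  by [].
rewrite integral_mkcond [RHS]integral_mkcond gE -/g.
have N1 : (-1)%R != 0%R :> R by rewrite oppr_eq0 oner_eq0.
(* [f] has no fixed sign, so the affine formula is applied to its positive and negative parts. *)
rewrite integralE [RHS]integralE.
congr (_ - _).
  rewrite funepos_comp/= (ge0_integral_affine z (f := g^\+) N1)//.
    by rewrite normrN1 invr1 mul1e.
  exact: measurable_funepos.
rewrite funeneg_comp/= (ge0_integral_affine z (f := g^\-) N1)//.
  by rewrite normrN1 invr1 mul1e.
exact: measurable_funeneg.
Qed.

Lemma ge0_integral_scale (k : R) (f : R -> R) : (0 < k)%R ->
  measurable_fun (`]0%R, +oo[%classic : set R) f -> (forall y, 0 < y -> 0 <= f y)%R ->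
  \int[mu]_(y in `]0%R, +oo[) (f (k * y))%:E =
  (k^-1)%:E * \int[mu]_(y in `]0%R, +oo[) (f y)%:E.
Proof.
move=> k0 mf f0; pose g := (EFin \o f) \_ `]0%R, +oo[.
have mg : measurable_fun setT g.
  by apply/(measurable_restrictT _ _).1 => //; exact/measurable_EFinP.
have gE : (fun y => (f (k * y))%:E) \_ `]0%R, +oo[ = g \o (fun y => 0 + k * y)%R.
  apply/funext => y; rewrite /= /g !patchE add0r.
  have -> // : ((k * y)%R \in `]0%R, +oo[%classic) = (y \in `]0%R, +oo[%classic).
  by apply/idP/idP; rewrite !inE/= !in_itv/= !andbT pmulr_rgt0.
rewrite integral_mkcond [X in _ = _ * X]integral_mkcond gE -/g.
have -> : (k^-1 = `|k|^-1)%R by rewrite gtr0_norm.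
rewrite -(ge0_integral_affine 0 (f := g)) ?gt_eqF//.
move=> x; rewrite /g patchE; case: ifPn => //; rewrite inE/= in_itv/= andbT => x0.
by rewrite lee_fin f0.
Qed.

End ChangeOfVariables.

(** * Tricomi's function *)

Section ExponentialDomination.
Context {R : realType}.
Local Notation mu := (@lebesgue_measure R).
Local Notation Rpos := (`]0%R, +oo[%classic : set R).

Let mpos : measurable (Rpos : set (measurableTypeR R)).
Proof. exact: measurable_itv. Qed.

Lemma integrable_expRN (k : R) : 0 < k ->
  mu.-integrable Rpos (fun s => (expR (- (k * s)))%:E).
Proof.
move=> k0.
have ipdf : mu.-integrable Rpos (fun s => (exponential_pdf k s)%:E).
  exact: integrableS (integrable_exponential_pdf k0).
have := integrableZl mpos k^-1 ipdf.
apply: eq_integrable => // s; rewrite inE/= in_itv/= andbT => s0.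
by rewrite exponential_pdfE ?ltW// -EFinM mulKf ?gt_eqF// mulNr.
Qed.

Lemma integrable_exp_dominated (f : R -> R) (K k : R) : 0 < k ->
  measurable_fun Rpos f -> (forall s, 0 < s -> `|f s| <= K * expR (- (k * s))) ->
  mu.-integrable Rpos (EFin \o f).
Proof.
move=> k0 mf fK.
apply: (@le_integrable _ _ _ mu Rpos _ _ (fun s => (K * expR (- (k * s)))%:E)) => //.
- exact/measurable_EFinP.
- move=> s; rewrite /= in_itv/= andbT => s0; rewrite lee_fin.
  by rewrite (le_trans (fK s s0))// ler_norm.
- exact: (integrableZl mpos K (integrable_expRN k0)).
Qed.

(** With zero integral, a positive integrand would vanish almost everywhere, making the half-line a
    null set. *)
Lemma Rintegral_gt0 (f : R -> R) : mu.-integrable Rpos (EFin \o f) ->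
  (forall s, 0 < s -> 0 < f s) -> 0 < \int[mu]_(s in Rpos) f s.
Proof.
move=> intf f0; rewrite lt_neqAle Rintegral_ge0 ?andbT; last first.
  by move=> s; rewrite /= in_itv/= andbT => /f0 /ltW.
apply/eqP => int0.
have fin := integrable_fin_num mpos intf.
have int0E : (\int[mu]_(s in Rpos) `|(f s)%:E| = 0)%E.
  transitivity (\int[mu]_(s in Rpos) (f s)%:E)%E.
    apply: eq_integral => s; rewrite inE/= in_itv/= andbT => s0.
    by rewrite ger0_norm// ltW// f0.
  by rewrite -(fineK fin) -[fine _]/(\int[mu]_(s in Rpos) f s) -int0.
have /measurable_EFinP mf := measurable_int mu intf.
have mEf : measurable_fun Rpos (EFin \o f) by exact/measurable_EFinP.
have [N [mN N0 sub]] := (ae_eq_integral_abs mu mpos mEf).1 int0E.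
have : (mu Rpos <= mu N)%E.
  rewrite le_measure ?inE//.
  move=> s s0; apply: sub => /= /(_ s0)[fs0].
  by move: s0; rewrite /= in_itv/= andbT => /f0; rewrite fs0 ltxx.
by rewrite [mu N]N0 lebesgue_measure_itv/= ltry.
Qed.

(* f x s and its x-derivative are dominated by K e^(- k s) near z. *)
Lemma is_derive_under_integral (f df : R -> R -> R) (u v z K k : R) :
  u < z < v -> 0 < k ->
  (forall x, u < x < v -> measurable_fun Rpos (f x)) ->
  (forall x s, u < x < v -> 0 < s -> is_derive x 1 (f ^~ s) (df x s)) ->
  (forall x s, u < x < v -> 0 < s -> `|f x s| <= K * expR (- (k * s))) ->
  (forall x s, u < x < v -> 0 < s -> `|df x s| <= K * expR (- (k * s))) ->
  is_derive z 1 (fun x => \int[mu]_(s in Rpos) f x s)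
    (\int[mu]_(s in Rpos) df z s).
Proof.
move=> zuv k0 mf der fK dfK.
have Iz : [set` `]u, v[] z by rewrite /= in_itv.
have in_uv x : [set` `]u, v[] x -> u < x < v by rewrite /= in_itv.
have in_s s : Rpos s -> 0 < s by rewrite /= in_itv/= andbT.
have K0 s : 0 <= `|K| * expR (- (k * s)) by rewrite mulr_ge0 ?expR_ge0.
have KK s : K * expR (- (k * s)) <= `|K| * expR (- (k * s)).
  by rewrite ler_wpM2r ?expR_ge0 ?ler_norm.
have intf x : [set` `]u, v[] x -> mu.-integrable Rpos (EFin \o f x).
  move=> /in_uv xuv; apply: (integrable_exp_dominated k0 (mf x xuv)) => s s0.
  exact: fK.
have derf x s : [set` `]u, v[] x -> Rpos s -> derivable (f ^~ s) x 1.
  by move=> /in_uv xuv /in_s s0; case: (der x s xuv s0).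
have intG : mu.-integrable Rpos (EFin \o (fun s => `|K| * expR (- (k * s)))).
  exact: (integrableZl mpos `|K| (integrable_expRN k0)).
have dub x s : [set` `]u, v[] x -> Rpos s ->
    `|partial1of2 f x s| <= `|K| * expR (- (k * s)).
  move=> /in_uv xuv /in_s s0; rewrite /partial1of2.
  by rewrite (is_derive_derive1 (der x s xuv s0)) (le_trans (dfK _ _ xuv s0)).
apply: DeriveDef.
  exact: (derivable_under_integral mpos Iz intf derf K0 intG dub).
rewrite -derive1E.
rewrite (differentiation_under_integral mpos Iz intf derf K0 intG dub).
apply: eq_Rintegral => s; rewrite inE => /in_s s0.
by rewrite /partial1of2 (is_derive_derive1 (der z s zuv s0)).
Qed.

(** From x <= e^(x - 1) at x = delta (1 + t), raised to the power m' = 1 + |m|; delta = eps / m'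
    makes the exponent of [t] exactly eps. *)
Lemma powR_le_expR (m eps : R) : 0 < eps ->
  exists2 K : R, 0 < K & forall t, 0 <= t -> (1 + t) `^ m <= K * expR (eps * t).
Proof.
move=> eps0; pose m' := 1 + `|m|.
have m'0 : 0 < m' by rewrite ltr_pwDl.
pose delta := eps / m'; have delta0 : 0 < delta by rewrite divr_gt0.
exists ((delta^-1) `^ m' * expR ((delta - 1) * m')).
  by rewrite mulr_gt0 ?expR_gt0 ?powR_gt0 ?invr_gt0.
move=> t t0; have t1 : 1 <= 1 + t by rewrite lerDl.
apply: (@le_trans _ _ ((1 + t) `^ m')).
  by rewrite ler_powR// (le_trans (ler_norm m))// lerDr.
have y0 : 0 <= delta * (1 + t) by rewrite mulr_ge0 ?ltW// (lt_le_trans ltr01).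
have -> : (1 + t) `^ m' = delta^-1 `^ m' * (delta * (1 + t)) `^ m'.
  by rewrite -powRM ?invr_ge0 ?(ltW delta0)// mulKf// gt_eqF.
rewrite -mulrA ler_wpM2l ?powR_ge0//.
have -> : expR ((delta - 1) * m') * expR (eps * t) = expR (delta * (1 + t) - 1) `^ m'.
  rewrite -expRM -expRD; congr expR; rewrite /delta.
  have : m' != 0 by rewrite gt_eqF.
  by move=> m'n; field.
apply: ge0_ler_powR; rewrite ?nnegrE ?expR_ge0 ?(ltW m'0)//.
by rewrite -{1}[delta * (1 + t)](subrKC 1) expR_ge1Dx.
Qed.

(** For p >= 0 use z + s <= (1 + v) (1 + s), for p < 0 use z + s >= u; the constant adds both
    cases. *)
Lemma powR_shift_le (u v z s p : R) : 0 < u -> u <= z <= v -> 0 <= s ->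
  (z + s) `^ p <= (u `^ p + (1 + v) `^ `|p|) * (1 + s) `^ `|p|.
Proof.
move=> u0 /andP[uz zv] s0.
have z0 := lt_le_trans u0 uz; have v0 := lt_le_trans z0 zv.
have s1 : 1 <= (1 + s) `^ `|p|.
  by rewrite -[leLHS](powRr0 (1 + s)) ler_powR// lerDl.
have [p0|p0] := leP 0 p.
  rewrite (ger0_norm p0) mulrDl (le_trans (y := (1 + v) `^ p * (1 + s) `^ p))//.
    rewrite -powRM ?addr_ge0 ?(ltW v0)//.
    apply: ge0_ler_powR => //; rewrite ?nnegrE ?mulr_ge0 ?addr_ge0 ?(ltW z0) ?(ltW v0)//.
    rewrite mulrDl mul1r mulrDr mulr1.
    have : 0 <= v * s by rewrite mulr_ge0// ltW.
    by move: zv; lra.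
  by rewrite lerDr mulr_ge0 ?powR_ge0.
rewrite mulrDl (le_trans (y := u `^ p * (1 + s) `^ `|p|))//; last first.
  by rewrite lerDl mulr_ge0 ?powR_ge0.
rewrite (le_trans (y := u `^ p))//; last by rewrite ler_peMr ?powR_ge0.
have -> : p = - `|p| by rewrite ltr0_norm ?opprK.
rewrite !powRN lef_pV2 ?posrE ?powR_gt0 ?ltr_pwDl//.
apply: ge0_ler_powR; rewrite ?nnegrE ?(ltW u0) ?addr_ge0 ?(ltW z0)//.
by rewrite (le_trans uz)// lerDl.
Qed.

End ExponentialDomination.

Section Tricomi.
Context {R : realType}.
Local Notation mu := (@lebesgue_measure R).
Local Notation Rpos := (`]0%R, +oo[%classic : set R).
Variable q : R.
Hypothesis q_ge0 : 0 <= q.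

(** Tricomi's integral with first parameter q + 1, without 1 / Gamma (q + 1); [shifted_gamma] is its
    form after s = z t. The first form yields the equation for F', the second the equation for G'
    and the limits at 0. *)
Definition laplace_power p z : R :=
  \int[mu]_(t in Rpos) (expR (- (z * t)) * t `^ q * (1 + t) `^ p).

Definition shifted_gamma p z : R :=
  \int[mu]_(s in Rpos) (expR (- s) * s `^ q * (z + s) `^ p).

Lemma measurable_gamma_kernel (k c p : R) :
  measurable_fun Rpos (fun s => expR (- (k * s)) * s `^ q * (c + s) `^ p).
Proof.
apply: measurable_funTS; apply: measurable_funM.
  apply: measurable_funM; last exact: measurable_powR.
  by apply: measurableT_comp => //; apply: measurableT_comp => //; exact: measurable_funM.
apply: (@measurableT_comp _ _ _ _ _ _ (@powR R ^~ p) _ (fun s => c + s)).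
  exact: measurable_powR.
exact: measurable_funD.
Qed.

Lemma powR_le_1D s : 0 <= s -> s `^ q <= (1 + s) `^ q.
Proof.
move=> s0; apply: ge0_ler_powR => //; rewrite ?nnegrE ?addr_ge0//.
by rewrite lerDr.
Qed.

(** Half of the exponential absorbs the powers; the other half dominates uniformly in x, as
    differentiation under the integral requires. *)
Lemma shifted_gamma_kernel_le u v p : 0 < u -> exists K, forall x s,
  u <= x <= v -> 0 < s ->
  expR (- s) * s `^ q * (x + s) `^ p <= K * expR (- (2^-1 * s)).
Proof.
move=> u0; have [K K0 hK] := @powR_le_expR R (q + `|p|) 2^-1 (ltac:(by rewrite invr_gt0)).
exists ((u `^ p + (1 + v) `^ `|p|) * K) => x s xuv s0.
set c := u `^ p + _.
have c0 : 0 <= c by rewrite addr_ge0 ?powR_ge0.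
apply: (@le_trans _ _ (expR (- s) * (1 + s) `^ q * (c * (1 + s) `^ `|p|))).
  apply: ler_pM; rewrite ?mulr_ge0 ?expR_ge0 ?powR_ge0//.
    by rewrite ler_wpM2l ?expR_ge0// powR_le_1D// ltW.
  by apply: powR_shift_le => //; exact: ltW.
have -> : expR (- s) * (1 + s) `^ q * (c * (1 + s) `^ `|p|) =
    c * expR (- s) * (1 + s) `^ (q + `|p|).
  have s1 : 1 + s != 0 by rewrite gt_eqF// addr_gt0.
  by rewrite powRD ?s1 ?implybT//; ring.
apply: (@le_trans _ _ (c * expR (- s) * (K * expR (2^-1 * s)))).
  by rewrite ler_wpM2l ?mulr_ge0 ?expR_ge0// hK// ltW.
rewrite le_eqVlt; apply/orP; left; apply/eqP.
rewrite mulrACA -!mulrA; congr (_ * (_ * _)); rewrite -expRD; congr expR.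
by field.
Qed.

Lemma measurable_shifted_kernel x p :
  measurable_fun Rpos (fun s => expR (- s) * s `^ q * (x + s) `^ p).
Proof.
have -> : (fun s => expR (- s) * s `^ q * (x + s) `^ p) =
    (fun s => expR (- (1 * s)) * s `^ q * (x + s) `^ p).
  by apply/funext => s; rewrite mul1r.
exact: measurable_gamma_kernel.
Qed.

Lemma integrable_shifted_kernel x p : 0 < x ->
  mu.-integrable Rpos (EFin \o (fun s => expR (- s) * s `^ q * (x + s) `^ p)).
Proof.
move=> x0; have [K hK] := @shifted_gamma_kernel_le x x p x0.
apply: (@integrable_exp_dominated _ _ K 2^-1); first by rewrite invr_gt0.
  exact: measurable_shifted_kernel.
move=> s s0; rewrite ger0_norm ?mulr_ge0 ?expR_ge0 ?powR_ge0//.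
by apply: hK => //; rewrite lexx.
Qed.

Lemma shifted_gamma_gt0 x p : 0 < x -> 0 < shifted_gamma p x.
Proof.
move=> x0; apply: Rintegral_gt0; first exact: integrable_shifted_kernel.
by move=> s s0; rewrite !mulr_gt0 ?expR_gt0 ?powR_gt0// addr_gt0.
Qed.

Lemma is_derive_shifted_gamma (p z : R) : 0 < z ->
  is_derive z 1 (shifted_gamma p) (p * shifted_gamma (p - 1) z).
Proof.
move=> z0.
have z20 : 0 < z / 2 by rewrite divr_gt0.
have [K hK] := @shifted_gamma_kernel_le (z / 2) (2 * z) p z20.
have [K' hK'] := @shifted_gamma_kernel_le (z / 2) (2 * z) (p - 1) z20.
have in_ltW x : z / 2 < x < 2 * z -> z / 2 <= x <= 2 * z.
  by move=> /andP[/ltW -> /ltW ->].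
have x_gt0 x : z / 2 < x < 2 * z -> 0 < x by move=> /andP[/(lt_trans z20)].
have K0 : 0 <= `|K| + `|p| * `|K'| by rewrite addr_ge0 ?mulr_ge0.
have := @is_derive_under_integral R (fun x s => expR (- s) * s `^ q * (x + s) `^ p)
  (fun x s => p * (expR (- s) * s `^ q * (x + s) `^ (p - 1)))
  (z / 2) (2 * z) z (`|K| + `|p| * `|K'|) 2^-1.
rewrite RintegralZl//; last exact: integrable_shifted_kernel.
apply.
- by move: z0; lra.
- by rewrite invr_gt0.
- by move=> x _; exact: measurable_shifted_kernel.
- move=> x s /x_gt0 x0 s0; have xs0 : 0 < x + s by rewrite addr_gt0.
  have d1 := is_derive_addf (is_derive_idf x) (is_derive_cstf s x).
  have d2 := @is_derive_compf R (fun y => y `^ p) (fun y => y + s) x _ _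
    (is_derive_powRf p xs0) d1.
  apply: (is_derive_eqval (is_derive_mulcf (expR (- s) * s `^ q) d2)).
  by ring.
- move=> x s xuv s0; rewrite ger0_norm ?mulr_ge0 ?expR_ge0 ?powR_ge0//.
  rewrite (le_trans (hK x s (in_ltW x xuv) s0))// ler_wpM2r ?expR_ge0//.
  by rewrite (le_trans (ler_norm K))// lerDl mulr_ge0.
- move=> x s xuv s0; rewrite normrM.
  rewrite [X in _ * X]ger0_norm ?mulr_ge0 ?expR_ge0 ?powR_ge0//.
  rewrite (le_trans (y := `|p| * (`|K'| * expR (- (2^-1 * s)))))//.
    rewrite ler_wpM2l// (le_trans (hK' x s (in_ltW x xuv) s0))//.
    by rewrite ler_wpM2r ?expR_ge0// ler_norm.
  by rewrite mulrA ler_wpM2r ?expR_ge0// lerDr.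
Qed.

Lemma laplace_kernel_le u p : 0 < u -> exists2 K, 0 <= K & forall x t,
  u <= x -> 0 < t ->
  expR (- (x * t)) * t `^ q * (1 + t) `^ p <= K * expR (- (u / 2 * t)).
Proof.
move=> u0; have u20 : 0 < u / 2 by rewrite divr_gt0.
have [K K0 hK] := @powR_le_expR R (q + p) (u / 2) u20.
exists K => [|x t ux t0]; first exact: ltW.
have t1 : 0 < 1 + t by rewrite addr_gt0.
apply: (@le_trans _ _ (expR (- (u * t)) * (1 + t) `^ (q + p))).
  rewrite powRD ?(gt_eqF t1) ?implybT//.
  rewrite mulrA ler_wpM2r ?powR_ge0// ler_pM ?expR_ge0 ?powR_ge0//.
    by rewrite ler_expR lerN2 ler_wpM2r// ltW.
  exact/powR_le_1D/ltW.
apply: (@le_trans _ _ (expR (- (u * t)) * (K * expR (u / 2 * t)))).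
  by rewrite ler_wpM2l ?expR_ge0// hK// ltW.
rewrite le_eqVlt; apply/orP; left; apply/eqP.
rewrite mulrCA -expRD; congr (_ * expR _).
by field.
Qed.

Lemma integrable_laplace_kernel x p : 0 < x ->
  mu.-integrable Rpos (EFin \o (fun t => expR (- (x * t)) * t `^ q * (1 + t) `^ p)).
Proof.
move=> x0; have [K _ hK] := laplace_kernel_le p x0.
apply: (@integrable_exp_dominated _ _ K (x / 2)); first by rewrite divr_gt0.
  exact: measurable_gamma_kernel.
move=> s s0; rewrite ger0_norm ?mulr_ge0 ?expR_ge0 ?powR_ge0//.
exact: hK.
Qed.

(** The factor -t produced by differentiation is 1 - (1 + t). *)
Lemma is_derive_laplace_power (p z : R) : 0 < z ->
  is_derive z 1 (laplace_power p) (laplace_power p z - laplace_power (p + 1) z).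
Proof.
move=> z0.
have z20 : 0 < z / 2 by rewrite divr_gt0.
have [K K0 hK] := laplace_kernel_le p z20.
have [K' K'0 hK'] := laplace_kernel_le (p + 1) z20.
have := @is_derive_under_integral R (fun x t => expR (- (x * t)) * t `^ q * (1 + t) `^ p)
  (fun x t => (expR (- (x * t)) * t `^ q * (1 + t) `^ p) -
     (expR (- (x * t)) * t `^ q * (1 + t) `^ (p + 1)))
  (z / 2) (2 * z) z (K + K') (z / 2 / 2).
rewrite RintegralB//; [|exact: integrable_laplace_kernel..].
apply.
- by move: z0; lra.
- by rewrite divr_gt0.
- by move=> x _; exact: measurable_gamma_kernel.
- move=> x t _ t0.
  have d1 : is_derive x 1 (fun y : R => - (y * t)) (- t).
    have := is_derive_oppf (is_derive_mulf (is_derive_idf x) (is_derive_cstf t x)).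
    by rewrite mul1r mulr0 addr0.
  have d2 := @is_derive_compf R expR (fun y => - (y * t)) x _ _
    (is_derive_expR (- (x * t))) d1.
  have d3 := is_derive_mulf (is_derive_mulf d2 (is_derive_cstf (t `^ q) x))
    (is_derive_cstf ((1 + t) `^ p) x).
  apply: (is_derive_eqval d3).
  have t1 : 0 < 1 + t by rewrite addr_gt0.
  by rewrite powRD ?(gt_eqF t1) ?implybT// powRr1 ?(ltW t1)//; ring.
- move=> x t /andP[/ltW xz _] t0; rewrite ger0_norm ?mulr_ge0 ?expR_ge0 ?powR_ge0//.
  rewrite (le_trans (hK x t xz t0))// ler_wpM2r ?expR_ge0//.
  by rewrite lerDl.
- move=> x t /andP[/ltW xz _] t0.
  rewrite (le_trans (ler_normB _ _))// mulrDl lerD//.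
    by rewrite ger0_norm ?mulr_ge0 ?expR_ge0 ?powR_ge0// hK.
  by rewrite ger0_norm ?mulr_ge0 ?expR_ge0 ?powR_ge0// hK'.
Qed.

(** Substitution s = z t, with z + z t = z (1 + t). *)
Lemma shifted_gamma_laplace (p z : R) : 0 < z ->
  shifted_gamma p z = z `^ (q + p + 1) * laplace_power p z.
Proof.
move=> z0.
have zz : z != 0 by rewrite gt_eqF.
have := ge0_integral_scale z0 (measurable_shifted_kernel z p).
have pos s : 0 < s -> 0 <= expR (- s) * s `^ q * (z + s) `^ p.
  by move=> s0; rewrite !mulr_ge0 ?expR_ge0 ?powR_ge0.
have mpos : measurable (Rpos : set (measurableTypeR R)) by exact: measurable_itv.
have fin := integrable_fin_num mpos (integrable_shifted_kernel p z0).
move=> /(_ pos); rewrite -[X in _ = (_ * X)%E -> _](fineK fin) -EFinM => /(congr1 fine).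
rewrite -[fine (EFin _)]/(z^-1 * shifted_gamma p z).
rewrite -[fine _]/(\int[mu]_(t in Rpos) (expR (- (z * t)) * (z * t) `^ q * (z + z * t) `^ p)).
have -> : \int[mu]_(t in Rpos) (expR (- (z * t)) * (z * t) `^ q * (z + z * t) `^ p) =
    z `^ (q + p) * laplace_power p z.
  rewrite /laplace_power -RintegralZl//; last exact: integrable_laplace_kernel.
  apply: eq_Rintegral => t; rewrite inE/= in_itv/= andbT => t0.
  have -> : z + z * t = z * (1 + t) by ring.
  by rewrite !powRM ?(ltW z0) ?addr_ge0 ?(ltW t0)// powRD ?zz ?implybT//; ring.
move=> E; rewrite -[LHS](mulVKf zz) -E.
rewrite (powRS (q + p) z0).
by move: (z `^ (q + p)) (laplace_power p z) => u v; ring.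
Qed.

End Tricomi.

(** * Tricomi's integral near 0 and at infinity *)

Section TricomiLimits.
Context {R : realType}.
Local Notation mu := (@lebesgue_measure R).
Local Notation Rpos := (`]0%R, +oo[%classic : set R).
Variable q : R.
Hypothesis q_ge0 : 0 <= q.

Let mpos : measurable (Rpos : set (measurableTypeR R)).
Proof. exact: measurable_itv. Qed.

(* The absolute value extends the integrals evenly, so that dominated
   continuity at the interior point 0 of ]-1, 1[ gives the right limits. *)
Let right_limit (h : R -> R -> R) (p : R) :
  (forall x : R, -1 < x < 1 -> measurable_fun Rpos (h `|x|)) ->
  (forall x s : R, 0 <= x < 1 -> 0 < s ->
    `|h x s| <= expR (- s) * s `^ q * (1 + s) `^ p) ->
  (forall s x : R, 0 < s -> {for x, continuous (fun y : R => h `|y| s)}) ->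
  (\int[mu]_(s in Rpos) h z s) @[z --> 0^'+] --> \int[mu]_(s in Rpos) h 0 s.
Proof.
move=> mh hle hcont.
have in_s s : Rpos s -> 0 < s by rewrite /= in_itv/= andbT.
have abs_lt (x : R) : [set` `](-1 : R), 1[] x -> 0 <= `|x| < 1.
  by rewrite /= in_itv/= -ltr_norml => ->; rewrite andbT.
have ig := integrable_shifted_kernel q_ge0 p (@ltr01 R).
have hint (x : R) : [set` `](-1 : R), 1[] x -> mu.-integrable Rpos (EFin \o h `|x|).
  move=> Ix; apply: le_integrable ig => //.
    by apply/measurable_EFinP; apply: mh; move: Ix; rewrite /= in_itv.
  move=> s /in_s s0; rewrite lee_fin (le_trans (hle _ _ (abs_lt x Ix) s0))//.
  by rewrite ler_norm.
have hc : {ae mu, forall s, Rpos s -> {in [set` `](-1 : R), 1[], continuous (fun x : R => h `|x| s)}}.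
  by apply: aeW => s /in_s s0 x _; exact: hcont.
have hub (x : R) : [set` `](-1 : R), 1[] x ->
    {ae mu, forall s, Rpos s -> `|h `|x| s| <= expR (- s) * s `^ q * (1 + s) `^ p}.
  by move=> Ix; apply: aeW => s /in_s s0; apply: hle => //; exact: abs_lt.
have := @continuity_under_integral _ _ _ mu (fun (x s : R) => h `|x| s) Rpos mpos (-1) 1
  hint hc _ ig hub.
move=> /(_ 0); rewrite inE/= in_itv/= ltrN10 ltr01 => /(_ isT).
rewrite /continuous_at normr0 => /cvg_at_right_filter.
apply: cvg_trans; apply: near_eq_cvg.
by near=> z; rewrite ger0_norm//; near: z; exact: nbhs_right_ge.
Unshelve. all: by end_near. Qed.

Let cont_powR (p s x : R) : 0 < s -> {for x, continuous (fun y : R => (`|y| + s) `^ p)}.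
Proof.
move=> s0; have xs : 0 < `|x| + s by rewrite ltr_wpDl.
apply: (@continuous_comp _ _ _ (fun y : R => `|y| + s) (fun y => y `^ p)).
  by apply: continuousD; [exact: norm_continuous|exact: cst_continuous].
exact: is_derive_cont (is_derive_powRf p xs).
Qed.

Lemma shifted_gamma_cvg0 (p : R) : 0 < p ->
  shifted_gamma q p z @[z --> 0^'+] --> Gamma (q + p + 1).
Proof.
move=> p0.
have -> : Gamma (q + p + 1) = \int[mu]_(s in Rpos) (expR (- s) * s `^ q * (0 + s) `^ p).
  apply: eq_Rintegral => s; rewrite inE/= in_itv/= andbT => s0.
  by rewrite add0r addrK powRD ?(gt_eqF s0) ?implybT//; ring.
apply: (right_limit (p := p) (h := fun z s => expR (- s) * s `^ q * (z + s) `^ p)).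
- by move=> x _; exact: measurable_shifted_kernel.
- move=> x s /andP[x0 x1] s0; rewrite ger0_norm ?mulr_ge0 ?expR_ge0 ?powR_ge0//.
  rewrite ler_wpM2l ?mulr_ge0 ?expR_ge0 ?powR_ge0//.
  apply: ge0_ler_powR; rewrite ?nnegrE ?addr_ge0 ?(ltW p0) ?(ltW s0)//.
  by rewrite lerD2r ltW.
- move=> s x s0; apply: continuousM; first exact: cst_continuous.
  exact: cont_powR.
Qed.

(** For p < 1 the power (z + s)^(p - 1) can be singular at z = s = 0; the factor [z] restores a
    dominated integrand, as z (z + s)^(p - 1) <= (z + s)^p. *)
Lemma mul_shifted_gamma_cvg0 (p : R) : 0 < p ->
  z * shifted_gamma q (p - 1) z @[z --> 0^'+] --> (0 : R).
Proof.
move=> p0.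
have lim0 := @right_limit (fun z s => z * (expR (- s) * s `^ q * (z + s) `^ (p - 1))) p.
have {}lim0 : (\int[mu]_(s in Rpos) (z * (expR (- s) * s `^ q * (z + s) `^ (p - 1))))
   @[z --> 0^'+] --> (0 : R).
  have E : \int[mu]_(s in Rpos) (0 * (expR (- s) * s `^ q * (0 + s) `^ (p - 1))) = 0 :> R.
    under eq_Rintegral do rewrite mul0r.
    by rewrite Rintegral_cst// mul0r.
  rewrite -[X in _ --> X]E; apply: lim0.
  - move=> x _; apply: measurable_funM => //; exact: measurable_shifted_kernel.
  - move=> x s /andP[x0 x1] s0.
    have xs0 : 0 < x + s by rewrite ltr_wpDl.
    rewrite ger0_norm ?mulr_ge0 ?expR_ge0 ?powR_ge0// mulrCA.
    rewrite ler_wpM2l ?mulr_ge0 ?expR_ge0 ?powR_ge0//.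
    apply: (@le_trans _ _ ((x + s) * (x + s) `^ (p - 1))).
      by rewrite ler_wpM2r ?powR_ge0// lerDl ltW.
    rewrite mulr_powRB1 ?(ltW xs0)//.
    apply: ge0_ler_powR; rewrite ?nnegrE ?addr_ge0 ?(ltW p0) ?(ltW s0)//.
    by rewrite lerD2r ltW.
  - move=> s x s0; apply: continuousM; first exact: norm_continuous.
    by apply: continuousM; [exact: cst_continuous|exact: cont_powR].
apply: cvg_trans lim0; apply: near_eq_cvg; near=> z.
rewrite RintegralZl//; apply: integrable_shifted_kernel => //.
Unshelve. all: by end_near. Qed.

(** For z >= 1, (z + s)^(p - 1) <= (1 + z)^p (1 + s)^p, so the integral grows at most polynomially.
    This kills the boundary term at [b] when [b] tends to infinity. *)
Lemma shifted_gamma_decay (p : R) : 0 < p -> exists K, forall z, 1 <= z ->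
  expR (- z) * shifted_gamma q (p - 1) z <= K * expR (- (2^-1 * z)).
Proof.
move=> p0; have [K K0 hK] := @powR_le_expR R p 2^-1 (ltac:(by rewrite invr_gt0)).
exists (K * shifted_gamma q p 1) => z z1.
have z0 : 0 < z by rewrite (lt_le_trans ltr01).
have le1 : shifted_gamma q (p - 1) z <= (1 + z) `^ p * shifted_gamma q p 1.
  rewrite /shifted_gamma -RintegralZl//; last exact: integrable_shifted_kernel.
  apply: le_Rintegral => //.
  - exact: integrable_shifted_kernel.
  - exact: (integrableZl mpos ((1 + z) `^ p)
      (integrable_shifted_kernel q_ge0 p (@ltr01 R))).
  - move=> s; rewrite /= in_itv/= andbT => s0.
    rewrite mulrCA ler_wpM2l ?mulr_ge0 ?expR_ge0 ?powR_ge0//.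
    rewrite -powRM ?addr_ge0 ?(ltW z0) ?(ltW s0)//.
    apply: (@le_trans _ _ ((z + s) `^ p)).
      by rewrite ler_powR ?gerBl// (le_trans z1)// lerDl ltW.
    apply: ge0_ler_powR; rewrite ?nnegrE ?mulr_ge0 ?addr_ge0 ?(ltW p0) ?(ltW s0) ?(ltW z0)//.
    have : 0 <= z * s by rewrite mulr_ge0 ?ltW.
    by nra.
apply: (@le_trans _ _ (expR (- z) * (K * expR (2^-1 * z) * shifted_gamma q p 1))).
  rewrite ler_wpM2l ?expR_ge0// (le_trans le1)// ler_wpM2r//.
    by rewrite ltW// shifted_gamma_gt0.
  by rewrite hK// ltW.
rewrite le_eqVlt; apply/orP; left; apply/eqP.
have -> : expR (- (2^-1 * z)) = expR (- z) * expR (2^-1 * z).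
  by rewrite -expRD; congr expR; field.
by ring.
Qed.

End TricomiLimits.

(** * The linear system *)

Section KummerSystem.
Context {R : realType}.
Variables lam q : R.
Hypothesis lam_gt0 : 0 < lam.
Hypothesis q_ge0 : 0 <= q.

Local Notation n := (q + lam).

Let n_gt0 : 0 < n. Proof. by rewrite ltr_wpDl. Qed.
Let n1_gt0 : 0 < n + 1. Proof. by rewrite addr_gt0. Qed.
Let n11_gt0 : 0 < n + 1 + 1. Proof. by rewrite addr_gt0. Qed.
Let q1_gt0 : 0 < q + 1. Proof. by rewrite ltr_wpDl. Qed.

(* For F z = e^z h z and G z = lam (int_0^z h y e^y dy + const), this is the
   harmonicity equation of h. *)
Definition kummer_system (F G : R -> R) := forall z : R, 0 < z ->
  is_derive z 1 G (lam * F z) /\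
  is_derive z 1 F (((z + n) * F z - G z) / z).

(** Up to the factor e^z, [kummerF] is [K1 q n], [kummerG] is lam / (n + 1) times [K1 q (n + 1)],
    and for z > 0 [tricomiF] and [tricomiG] are [K2 q n] and [K2 q (n + 1)]. *)
Definition kummerF z := z `^ n * kummerM (q + 1) (n + 1) z.
Definition kummerG z := lam / (n + 1) * (z `^ (n + 1) * kummerM (q + 1) (n + 1 + 1) z).
Definition tricomiF z := shifted_gamma q (lam - 1) z / Gamma (q + 1).
Definition tricomiG z := shifted_gamma q lam z / Gamma (q + 1).

Lemma kummer_systemB F G F' G' c : kummer_system F G -> kummer_system F' G' ->
  kummer_system (fun z => F z - c * F' z) (fun z => G z - c * G' z).
Proof.
move=> S S' z z0; have [dG dF] := S z z0; have [dG' dF'] := S' z z0; split.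
  apply: (is_derive_eqval (is_derive_subf dG (is_derive_mulcf c dG'))).
  by ring.
apply: (is_derive_eqval (is_derive_subf dF (is_derive_mulcf c dF'))).
by field; rewrite gt_eqF.
Qed.

Lemma kummer_systemZ F G c : kummer_system F G ->
  kummer_system (fun z => c * F z) (fun z => c * G z).
Proof.
move=> S z z0; have [dG dF] := S z z0; split.
  apply: (is_derive_eqval (is_derive_mulcf c dG)); by ring.
apply: (is_derive_eqval (is_derive_mulcf c dF)).
by field; rewrite gt_eqF.
Qed.

(** [kummerM_lower_b] gives the equation for G', [kummerM_derive_raise_b] the one for F'. *)
Lemma kummer_system1 : kummer_system kummerF kummerG.
Proof.
move=> z z0; have zn0 : z != 0 by rewrite gt_eqF.
have n10 : n + 1 != 0 by rewrite gt_eqF.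
split.
  have dM := is_derive_kummerM (q + 1) z n11_gt0.
  apply: (is_derive_eqval (is_derive_mulcf (lam / (n + 1))
    (is_derive_mulf (is_derive_powRf (n + 1) z0) dM))).
  have := kummerM_lower_b (q + 1) z n1_gt0.
  set dMz := (q + 1) / _ * _; set M2 := kummerM _ (n + 1 + 1) z.
  move=> I1; rewrite addrK /kummerF powRS//.
  have -> : lam * (z `^ n * kummerM (q + 1) (n + 1) z) =
     lam / (n + 1) * z `^ n * ((n + 1) * kummerM (q + 1) (n + 1) z) by field.
  by rewrite -I1; ring.
have dM := is_derive_kummerM (q + 1) z n1_gt0.
apply: (is_derive_eqval (is_derive_mulf (is_derive_powRf n z0) dM)).
have := kummerM_derive_raise_b (q + 1) z n1_gt0.
set dMz := (q + 1) / _ * _ => ->.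
rewrite /kummerF /kummerG powRS// powR_pred//.
by field; rewrite zn0 n10.
Qed.

Lemma Gamma_gt0 (x : R) : 1 <= x -> 0 < Gamma x.
Proof.
move=> x1; have x10 : 0 <= x - 1 by rewrite subr_ge0.
apply: Rintegral_gt0; last by move=> s s0; rewrite mulr_gt0 ?expR_gt0 ?powR_gt0.
have := integrable_shifted_kernel x10 0 (@ltr01 R).
congr (_.-integrable _ _); apply/funext => s /=.
by rewrite powRr0 mulr1 mulrC.
Qed.

Let Gq_gt0 : 0 < Gamma (q + 1).
Proof. by rewrite Gamma_gt0// lerDr. Qed.

Let Gq_neq0 : Gamma (q + 1) != 0.
Proof. exact: lt0r_neq0. Qed.

Lemma tricomiF_gt0 z : 0 < z -> 0 < tricomiF z.
Proof. by move=> z0; rewrite divr_gt0// shifted_gamma_gt0. Qed.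

Lemma tricomiG_gt0 z : 0 < z -> 0 < tricomiG z.
Proof. by move=> z0; rewrite divr_gt0// shifted_gamma_gt0. Qed.

Lemma tricomiF_tricomi z : 0 < z -> tricomiF z = z `^ n * tricomiU (q + 1) (n + 1) z.
Proof.
move=> z0; rewrite /tricomiF shifted_gamma_laplace// /tricomiU /laplace_power.
have -> : q + (lam - 1) + 1 = n by ring.
rewrite addrK; have -> : n + 1 - (q + 1) - 1 = lam - 1 by ring.
by ring.
Qed.

Lemma tricomiG_tricomi z : 0 < z -> tricomiG z = z `^ (n + 1) * tricomiU (q + 1) (n + 1 + 1) z.
Proof.
move=> z0; rewrite /tricomiG shifted_gamma_laplace// /tricomiU /laplace_power.
rewrite addrK; have -> : n + 1 + 1 - (q + 1) - 1 = lam by ring.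
by ring.
Qed.

(** Differentiating [shifted_gamma] lowers its exponent, which is the equation for G'; the one for
    F' is read off from the Laplace form [J]. *)
Lemma kummer_system2 : kummer_system tricomiF tricomiG.
Proof.
move=> z z0; have zn0 : z != 0 by rewrite gt_eqF.
have G0 := Gq_neq0.
split.
  have d := is_derive_shifted_gamma q_ge0 lam z0.
  apply: (is_derive_eqval (is_derive_mulf d (is_derive_cstf (Gamma (q + 1))^-1 z))).
  by rewrite /tricomiF; ring.
pose J z := z `^ n * laplace_power q (lam - 1) z / Gamma (q + 1).
have dJ : is_derive z 1 J (((z + n) * tricomiF z - tricomiG z) / z).
  have d := is_derive_laplace_power q_ge0 (lam - 1) z0.
  apply: (is_derive_eqval (is_derive_mulf
    (is_derive_mulf (is_derive_powRf n z0) d) (is_derive_cstf (Gamma (q + 1))^-1 z))).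
  rewrite /tricomiF /tricomiG !shifted_gamma_laplace// subrK.
  have -> : q + (lam - 1) + 1 = n by ring.
  rewrite powRS// powR_pred//.
  by field; rewrite zn0 G0.
apply: is_derive_eqfun dJ.
have : \forall y \near z, 0 < y by exact: near_pos.
apply: filterS => y y0; rewrite /J /tricomiF shifted_gamma_laplace//.
by have -> : q + (lam - 1) + 1 = n by ring.
Qed.

Lemma tricomiG_cvg0 : tricomiG z @[z --> 0^'+] --> Gamma (n + 1) / Gamma (q + 1).
Proof. by apply: cvgM; [exact: shifted_gamma_cvg0|exact: cvg_cst]. Qed.

Lemma mul_tricomiF_cvg0 : z * tricomiF z @[z --> 0^'+] --> (0 : R).
Proof.
rewrite -[X in _ --> X](mul0r (Gamma (q + 1))^-1).
under eq_fun do rewrite /tricomiF mulrA.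
by apply: cvgM; [exact: mul_shifted_gamma_cvg0|exact: cvg_cst].
Qed.

(* Otherwise unification unfolds the integrals and the series. *)
Opaque Gamma kummerM tricomiU shifted_gamma laplace_power.

Lemma kummerM_ge1 (a b z : R) : 0 <= a -> 0 < b -> 0 <= z -> 1 <= kummerM a b z.
Proof.
move=> a0 b0 z0; rewrite kummerM_pseries.
have c0 k : 0 <= kummer_coef a b k.
  by rewrite /kummer_coef !divr_ge0 ?pochhammer_ge0 ?(ltW b0).
have nd : nondecreasing_seq (pseries (kummer_coef a b) z).
  by apply: nondecreasing_series => k _ _; rewrite mulr_ge0 ?exprn_ge0.
have := nondecreasing_cvgn_le nd (is_cvg_kummer b0 (a := a) (z := z)) 1%N; apply: le_trans.
rewrite /pseries /series/= big_nat1 expr0 mulr1 /kummer_coef /pochhammer.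
by rewrite !big_ord0 fact0 !divr1.
Qed.

Lemma kummerF_gt0 z : 0 < z -> 0 < kummerF z.
Proof.
move=> z0; rewrite mulr_gt0 ?powR_gt0// (lt_le_trans ltr01)//.
by rewrite kummerM_ge1 ?(ltW q1_gt0) ?(ltW z0).
Qed.

Lemma kummerG_gt0 z : 0 < z -> 0 < kummerG z.
Proof.
move=> z0; rewrite mulr_gt0 ?divr_gt0// mulr_gt0 ?powR_gt0// (lt_le_trans ltr01)//.
by rewrite kummerM_ge1 ?(ltW q1_gt0) ?(ltW z0).
Qed.

Lemma continuous_kummerM (a b z : R) : 0 < b -> {for z, continuous (kummerM a b)}.
Proof. by move=> b0; exact: is_derive_cont (is_derive_kummerM a z b0). Qed.

Lemma kummerM0 (a b : R) : kummerM a b 0 = 1.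
Proof.
rewrite kummerM_pseries; apply: lim_near_cst => //; near=> m.
have -> : m = m.-1.+1 by rewrite prednK//; near: m; exists 1%N.
rewrite /pseries /series/= big_nat_recl// expr0 mulr1 big1_seq ?addr0; last first.
  by move=> k _; rewrite exprS mul0r mulr0.
by rewrite /kummer_coef /pochhammer !big_ord0 fact0 !divr1.
Unshelve. all: by end_near. Qed.

Lemma kummerG_cvg0 : kummerG z @[z --> 0^'+] --> (0 : R).
Proof.
rewrite -[X in _ --> X](mulr0 (lam / (n + 1))); apply: cvgMl_tmp.
rewrite -[X in _ --> X](mul0r (kummerM (q + 1) (n + 1 + 1) 0)).
apply: cvgM; first exact: powR_cvg0.
by apply: cvg_at_right_filter; exact: continuous_kummerM.
Qed.

Section Wronskian.
Variables (F G F' G' : R -> R).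
Hypothesis S : kummer_system F G.
Hypothesis S' : kummer_system F' G'.

(** Liouville's formula: the trace of the system is 1 + n / z, whose primitive has exponential z^n
    e^z. *)
Lemma wronskian_proportional x y : 0 < x -> 0 < y ->
  (G x * F' x - F x * G' x) / (x `^ n * expR x) =
  (G y * F' y - F y * G' y) / (y `^ n * expR y).
Proof.
apply: (@derive0_cst _ (fun x => (G x * F' x - F x * G' x) / (x `^ n * expR x))).
move=> z z0; have [dG dF] := S z0; have [dG' dF'] := S' z0.
have zn0 : z != 0 by rewrite gt_eqF.
have p0 : z `^ n != 0 by rewrite gt_eqF// powR_gt0.
have e0 : expR z != 0 by rewrite gt_eqF// expR_gt0.
have dpe := is_derive_mulf (is_derive_powRf n z0) (is_derive_expR z).
have pe0 : z `^ n * expR z != 0 by rewrite mulf_neq0.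
apply: (is_derive_eqval (@is_derive_divf R (fun x => G x * F' x - F x * G' x)
  (fun x => x `^ n * expR x) z _ _ pe0
  (is_derive_subf (is_derive_mulf dG dF') (is_derive_mulf dF dG')) dpe)).
by rewrite powR_pred//; field; rewrite zn0 p0 e0.
Qed.

End Wronskian.

(** A Wronskian vanishing at one point vanishes everywhere, and up to sign and the factor lam / G'^2
    it is the derivative of the quotient G / G'. *)
Lemma kummer_system_proportional (F G F' G' : R -> R) x :
  kummer_system F G -> kummer_system F' G' ->
  (forall z : R, 0 < z -> G' z != 0) -> 0 < x -> G x * F' x - F x * G' x = 0 ->
  forall z, 0 < z -> G z = G x / G' x * G' z.
Proof.
move=> S S' G'0 x0 wx z z0.
have w0 y : 0 < y -> G y * F' y - F y * G' y = 0.
  move=> y0; have := wronskian_proportional S S' x0 y0.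
  rewrite wx mul0r => /esym/eqP; rewrite mulf_eq0 invr_eq0 mulf_eq0.
  by rewrite (gt_eqF (powR_gt0 n y0)) (gt_eqF (expR_gt0 y)) !orbF => /eqP.
suff -> : G x / G' x = G z / G' z by rewrite divfK// G'0.
apply: (@derive0_cst _ (fun y => G y / G' y)) => // y y0.
have [dG _] := S y y0; have [dG' _] := S' y y0.
apply: (is_derive_eqval (@is_derive_divf R G G' y _ _ (G'0 y y0) dG dG')).
have -> : lam * F y * G' y - G y * (lam * F' y) = - lam * (G y * F' y - F y * G' y) by ring.
by rewrite w0// mulr0 mul0r.
Qed.

Let Gamma_ratio_neq0 : Gamma (n + 1) / Gamma (q + 1) != 0.
Proof.
have n1 : 1 <= n + 1 by rewrite lerDr ltW.
have q1 : 1 <= q + 1 by rewrite lerDr.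
exact: lt0r_neq0 (divr_gt0 (Gamma_gt0 n1) (Gamma_gt0 q1)).
Qed.

(** Otherwise [tricomiG] would be a multiple of [kummerG], against their limits at 0+: a ratio of
    Gamma values and 0. *)
Lemma wronskian21_neq0 x : 0 < x -> tricomiG x * kummerF x - tricomiF x * kummerG x != 0.
Proof.
move=> x0; apply/eqP => w0.
have prop := kummer_system_proportional kummer_system2 kummer_system1
  (fun z z0 => lt0r_neq0 (kummerG_gt0 z0)) x0 w0.
have lim0 : tricomiG z @[z --> 0^'+] --> (0 : R).
  rewrite -[X in _ --> X](mulr0 (tricomiG x / kummerG x)).
  have h : (tricomiG x / kummerG x * kummerG z) @[z --> 0^'+] --> (tricomiG x / kummerG x * 0).
    by apply: cvgMl_tmp; exact: kummerG_cvg0.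
  by apply: right_cvg_eq h => z z0; rewrite -prop.
by move/eqP: (right_lim_unique tricomiG_cvg0 lim0); rewrite (negbTE Gamma_ratio_neq0).
Qed.

(** Subtracting [beta] times the Tricomi solution cancels the Wronskian with the Kummer one at 1. So
    G is a combination of both, and its limit 0 forces [beta] = 0; F follows from G' = lam F. *)
Lemma kummer_system_uniq (F G : R -> R) : kummer_system F G ->
  G z @[z --> 0^'+] --> (0 : R) ->
  exists c, forall z, 0 < z -> F z = c * kummerF z /\ G z = c * kummerG z.
Proof.
move=> S lim0; have w21 := wronskian21_neq0 (@ltr01 R).
pose beta := (G 1 * kummerF 1 - F 1 * kummerG 1) / (tricomiG 1 * kummerF 1 - tricomiF 1 * kummerG 1).
have S' := kummer_systemB beta S kummer_system2.
have w0 : (G 1 - beta * tricomiG 1) * kummerF 1 - (F 1 - beta * tricomiF 1) * kummerG 1 = 0.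
  have -> : (G 1 - beta * tricomiG 1) * kummerF 1 - (F 1 - beta * tricomiF 1) * kummerG 1 =
    (G 1 * kummerF 1 - F 1 * kummerG 1) - beta * (tricomiG 1 * kummerF 1 - tricomiF 1 * kummerG 1) by ring.
  by rewrite /beta divfK// subrr.
have prop := kummer_system_proportional S' kummer_system1
  (fun z z0 => lt0r_neq0 (kummerG_gt0 z0)) ltr01 w0.
set c := _ / _ in prop.
have GE z : 0 < z -> G z = c * kummerG z + beta * tricomiG z.
  by move=> z0; rewrite -prop// subrK.
have beta0 : beta = 0.
  have lim1 : G z @[z --> 0^'+] --> c * 0 + beta * (Gamma (n + 1) / Gamma (q + 1)).
    have h : (c * kummerG z + beta * tricomiG z) @[z --> 0^'+] -->
        c * 0 + beta * (Gamma (n + 1) / Gamma (q + 1)).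
      by apply: cvgD; apply: cvgMl_tmp; [exact: kummerG_cvg0|exact: tricomiG_cvg0].
    by apply: right_cvg_eq h => z z0; rewrite -GE.
  have /eqP := right_lim_unique lim1 lim0.
  by rewrite mulr0 add0r mulf_eq0 (negbTE Gamma_ratio_neq0) orbF => /eqP.
have GE' z : 0 < z -> G z = c * kummerG z by move=> z0; rewrite GE// beta0 mul0r addr0.
exists c => z z0; split; last exact: GE'.
have [dG _] := S z z0; have [dG1 _] := kummer_system1 z0.
have dcG : is_derive z 1 G (c * (lam * kummerF z)).
  apply: is_derive_eqfun (is_derive_mulcf c dG1).
  by apply: filterS (near_pos z0) => y y0; rewrite GE'.
have := is_derive_derive1 dG; rewrite (is_derive_derive1 dcG) mulrCA.
by move/(mulfI (lt0r_neq0 lam_gt0)).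
Qed.

End KummerSystem.

(** * The fundamental theorem of calculus up to an open endpoint *)

Section OpenFTC.
Context {R : realType}.
Local Notation mu := (@lebesgue_measure R).

Lemma closed_FTC (f Phi : R -> R) (a b : R) : a < b ->
  (forall y, a <= y <= b -> is_derive y 1 Phi (f y)) ->
  (forall y, a <= y <= b -> {for y, continuous f}) ->
  (\int[mu]_(y in `[a, b]) (f y)%:E = (Phi b - Phi a)%:E)%E.
Proof.
move=> ab dPhi cf.
have cPhi y : a <= y <= b -> {for y, continuous Phi}.
  by move=> /dPhi /is_derive_cont.
apply: continuous_FTC2 => //.
- by apply: continuous_in_subspaceT => y /set_mem/=; rewrite in_itv/=; exact: cf.
- split.
  + move=> y; rewrite in_itv/= => /andP[/ltW ay /ltW yb].
    by case: (dPhi y); rewrite ?ay.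
  + by apply: cvg_at_right_filter; apply: cPhi; rewrite lexx ltW.
  + by apply: cvg_at_left_filter; apply: cPhi; rewrite lexx ltW.
- move=> y; rewrite in_itv/= => /andP[/ltW ay /ltW yb].
  by apply: is_derive_derive1; apply: dPhi; rewrite ay.
Qed.

(** At [a] only the limit [L] of the primitive is known, since [a] may be 0. The intervals [u i, b]
    exhaust ]a, b]; dividing by i + 2 keeps every [u i] strictly below [b]. *)
Lemma ge0_open_FTC (f Phi : R -> R) (a b L : R) : a < b ->
  (forall y, a < y <= b -> is_derive y 1 Phi (f y)) ->
  (forall y, a < y <= b -> {for y, continuous f}) ->
  (forall y, a < y <= b -> 0 <= f y) ->
  Phi y @[y --> a^'+] --> L ->
  (\int[mu]_(y in `]a, b]) (f y)%:E = (Phi b - L)%:E)%E.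
Proof.
move=> ab dPhi cf f0 limL.
pose u i : R := a + (b - a) / i.+2%:R.
have ba0 : 0 < b - a by rewrite subr_gt0.
have au i : a < u i by rewrite ltrDl divr_gt0.
have ub i : u i < b.
  rewrite /u -ltrBrDl ltr_pdivrMr// ltr_pMr//.
  by rewrite ltr1n.
have u_cvg : u i @[i --> \oo] --> a.
  rewrite -[X in _ --> X]addr0 /u; apply: cvgD; first exact: cvg_cst.
  rewrite -[X in _ --> X](mulr0 (b - a)); apply: cvgMl_tmp.
  have h : (i.+1%:R^-1 : R) @[i --> \oo] --> 0 by exact: cvg_harmonic.
  by rewrite -cvg_shiftS in h.
have := @ge0_nondecreasing_set_cvg_integral _ _ R (fun i => `[u i, b]%classic : set (measurableTypeR R))
  (EFin \o f) mu.
have subI i y : `[u i, b]%classic y -> a < y <= b.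
  by rewrite /= in_itv/= => /andP[uy ->]; rewrite (lt_le_trans (au i)).
have bigU : \bigcup_i `[u i, b]%classic = `]a, b]%classic.
  apply/seteqP; split => [y [i _ /subI]|y]; first by rewrite /= in_itv.
  rewrite /= in_itv/= => /andP[ay yb].
  have : \forall i \near \oo, u i < y by exact: cvgr_lt u_cvg _ ay.
  move=> [i _ /(_ i (leqnn i))] uy; exists i => //=.
  by rewrite in_itv/= (ltW uy).
rewrite bigU => H.
have {}H : (\int[mu]_(y in `[u i, b]) (f y)%:E)%E @[i --> \oo] -->
   (\int[mu]_(y in `]a, b]) (f y)%:E)%E.
  apply: H.
  - move=> i j ij; apply/subsetPset => y /=; rewrite !in_itv/= => /andP[uy ->].
    rewrite andbT (le_trans _ uy)// lerD2l ler_wpM2l ?(ltW ba0)//.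
    by rewrite lef_pV2 ?posrE// ler_nat ltnS.
  - by move=> i; exact: measurable_itv.
  - move=> i; apply/measurable_EFinP; apply: subspace_continuous_measurable_fun.
      exact: measurable_itv.
    by apply: continuous_in_subspaceT => y /set_mem /subI; exact: cf.
  - by move=> i y /subI /f0; rewrite lee_fin.
apply: (cvg_unique _ H); first exact: ereal_hausdorff.
have -> : (fun i => \int[mu]_(y in `[u i, b]) (f y)%:E)%E = (fun i => (Phi b - Phi (u i))%:E).
  apply/funext => i; apply: closed_FTC => // y /andP[uy yb].
    by apply: dPhi; rewrite yb (lt_le_trans (au i)).
  by apply: cf; rewrite yb (lt_le_trans (au i)).
apply: cvg_EFin; first exact: nearW.
apply: cvgB; first exact: cvg_cst.
have /cvg_at_rightP := limL; apply; split => //.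
Qed.

Lemma ge0_integral_itv_split (f : R -> \bar R) (d : R) : 0 <= d ->
  measurable_fun setT f -> (forall x, (0 < x)%R -> (0 <= f x)%E) ->
  (\int[mu]_(x in `]0%R, +oo[) f x =
   \int[mu]_(x in `]0%R, d]) f x + \int[mu]_(x in `]d, +oo[) f x)%E.
Proof.
move=> d0 mf f0.
have <- : `]0, d] `|` `]d, +oo[ = `]0, +oo[%classic.
  by rewrite -itv_bndbnd_setU// bnd_simp.
rewrite ge0_integral_setU//.
- exact: measurable_funTS.
- move=> x /=; rewrite !in_itv/= andbT => -[/andP[x0 _]|dx]; apply: f0 => //.
  exact: le_lt_trans dx.
- rewrite disj_set2E; apply/eqP/seteqP; split => // x /=.
  by rewrite !in_itv/= andbT => -[/andP[_ xd]]; rewrite ltNge xd.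
Qed.

Lemma integral_exp_tail (k d : R) : 0 < k ->
  (\int[mu]_(c in `]d, +oo[) (expR (- (k * c)))%:E = (expR (- (k * d)) / k)%:E)%E.
Proof.
move=> k0; have kn0 : k != 0 by rewrite gt_eqF.
pose Phi c := - (expR (- (k * c)) / k).
have dPhi (c : R) : is_derive c 1 Phi (expR (- (k * c))).
  have d1 := is_derive_mulf (is_derive_expRcf (- k) c) (is_derive_cstf k^-1 c).
  have -> : Phi = fun c => - (expR (- k * c) * k^-1).
    by apply/funext => x; rewrite /Phi mulNr.
  apply: (is_derive_eqval (is_derive_oppf d1)).
  by rewrite !mulNr; field.
have cexp : continuous (fun c : R => expR (- (k * c))).
  have -> : (fun c : R => expR (- (k * c))) = fun c => expR (- k * c).
    by apply/funext => c; rewrite mulNr.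
  by move=> c; exact: is_derive_cont (is_derive_expRcf (- k) c).
have mexp : measurable_fun (setT : set R) (fun c : R => expR (- (k * c))).
  exact: continuous_measurable_fun.
rewrite integral_itv_obnd_cbnd; last first.
  by apply/measurable_EFinP; exact: measurable_funTS.
rewrite (@ge0_continuous_FTC2y _ _ Phi d 0).
- by rewrite /Phi -EFinB sub0r opprK.
- by move=> x _; exact: expR_ge0.
- exact: continuous_subspaceT.
- rewrite -oppr0; apply: cvgN; rewrite -[X in _ --> X](mul0r k^-1).
  apply: cvgMr_tmp.
  apply: (@cvg_comp _ _ _ (fun c => k * c) (fun x => expR (- x)) _ +oo).
    exact: gt0_cvgMry.
  exact: cvgr_expR.
- by move=> x _; case: (dPhi x).
- by apply: cvg_at_right_filter; exact: is_derive_cont (dPhi d).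
- by move=> x _; exact: is_derive_derive1 (dPhi x).
Qed.

End OpenFTC.

Opaque Gamma kummerM tricomiU shifted_gamma laplace_power.

(** * Harmonic and scale functions *)

Section HarmonicFunctions.
Context {R : realType}.
Local Notation mu := (@lebesgue_measure R).
Variables lam q : R.
Hypothesis lam_gt0 : 0 < lam.
Hypothesis q_ge0 : 0 <= q.

Local Notation n := (q + lam).
Let n_gt0 : 0 < n. Proof. by rewrite ltr_wpDl. Qed.
Let n1_gt0 : 0 < n + 1. Proof. by rewrite addr_gt0. Qed.
Let n11_gt0 : 0 < n + 1 + 1. Proof. by rewrite addr_gt0. Qed.
Let q1_gt0 : 0 < q + 1. Proof. by rewrite ltr_wpDl. Qed.
Local Notation F1 := (kummerF lam q).
Local Notation G1 := (kummerG lam q).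
Local Notation F2 := (tricomiF lam q).
Local Notation G2 := (tricomiG lam q).

Lemma K1_kummerF z : K1 q n z = expR (- z) * F1 z.
Proof. by rewrite /K1 /kummerF; ring. Qed.

Lemma K1_kummerG z : K1 q (n + 1) z = (n + 1) / lam * (expR (- z) * G1 z).
Proof. by rewrite /K1 /kummerG; field; rewrite !gt_eqF. Qed.

Lemma K2_tricomiF z : 0 < z -> K2 q n z = expR (- z) * F2 z.
Proof. by move=> z0; rewrite tricomiF_tricomi// /K2; ring. Qed.

Lemma K2_tricomiG z : 0 < z -> K2 q (n + 1) z = expR (- z) * G2 z.
Proof. by move=> z0; rewrite tricomiG_tricomi// /K2; ring. Qed.

Section SecondDerivative.
Variables F G : R -> R.
Hypothesis S : kummer_system lam q F G.

Let h z := expR (- z) * F z.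
Let h' z := (n * h z - expR (- z) * G z) / z.

Lemma is_derive_harmonic (z : R) : 0 < z -> is_derive z 1 h (h' z).
Proof.
move=> z0; have [_ dF] := S z0.
apply: (is_derive_eqval (is_derive_mulf (is_derive_expRNf z) dF)).
by rewrite /h' /h; field; rewrite gt_eqF.
Qed.

Lemma derive1_harmonic z : 0 < z -> h^`()%classic z = h' z.
Proof. by move=> z0; rewrite (is_derive_derive1 (is_derive_harmonic z0)). Qed.

(** Differentiating z h' = n h - e^(-z) G and eliminating G leaves z h'' = q h - (1 - n + z) h'. *)
Lemma is_derive2_harmonic (z : R) : 0 < z ->
  is_derive z 1 h^`()%classic ((q * h z - (1 - n + z) * h' z) / z).
Proof.
move=> z0; have [dG _] := S z0; have zn0 : z != 0 by rewrite gt_eqF.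
apply: (@is_derive_eqfun _ h').
  by apply: filterS (near_pos z0) => y y0; rewrite derive1_harmonic.
apply: (is_derive_eqval (@is_derive_divf R (fun y => n * h y - expR (- y) * G y) id z _ _ zn0
  (is_derive_subf (is_derive_mulcf n (is_derive_harmonic z0))
    (is_derive_mulf (is_derive_expRNf z) dG)) (is_derive_idf z))).
by rewrite /h' /h /=; field.
Qed.

End SecondDerivative.

(* This is z^(1 - n) e^z times the derivative of [K1 q n]; it equals
   n M(q, n, z), but its sign is all that matters. *)
Let P z := n * kummerM (q + 1) (n + 1) z -
  lam / (n + 1) * (z * kummerM (q + 1) (n + 1 + 1) z).

Let dP (z : R) : is_derive z 1 P (q * kummerM (q + 1) (n + 1) z).
Proof.
have dM1 := is_derive_kummerM (q + 1) z n1_gt0.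
have dM2 := is_derive_kummerM (q + 1) z n11_gt0.
apply: (is_derive_eqval (is_derive_subf (is_derive_mulcf n dM1)
  (is_derive_mulcf (lam / (n + 1)) (is_derive_mulf (is_derive_idf z) dM2)))).
have I1 := kummerM_lower_b (q + 1) z n1_gt0.
have I2 := kummerM_derive_raise_b (q + 1) z n1_gt0.
have -> : z * ((q + 1) / (n + 1 + 1) * kummerM (q + 1 + 1) (n + 1 + 1 + 1) z) =
  (n + 1) * (kummerM (q + 1) (n + 1) z - kummerM (q + 1) (n + 1 + 1) z).
  by rewrite mulrBr -I1; ring.
by rewrite I2; field; rewrite gt_eqF.
Qed.

Let P_gt0 z : 0 < z -> 0 < P z.
Proof.
move=> z0; have <- : P 0 + (P z - P 0) = P z by rewrite addrCA subrr addr0.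
have P0 : P 0 = n by rewrite /P !kummerM0; ring.
rewrite ltr_wpDr ?P0// subr_ge0 -P0.
apply: (@ger0_derive1_ndecr _ P 0 z); [| | |exact: lexx|exact: ltW|exact: lexx].
- by move=> x _; case: (dP x).
- move=> x; rewrite in_itv/= => /andP[x0 _]; rewrite (is_derive_derive1 (dP x)) mulr_ge0//.
  by rewrite (le_trans ler01)// kummerM_ge1 ?(ltW q1_gt0) ?(ltW x0).
- by apply: continuous_in_subspaceT => x _; exact: is_derive_cont (dP x).
Qed.

Let K1E : K1 q n = fun z => expR (- z) * F1 z.
Proof. by apply/funext => z; exact: K1_kummerF. Qed.

(** The derivative at u is e^(-u) u^(n - 1) P(u), where P(0) = n > 0 and P' = q M(q + 1, n + 1, .)
    >= 0. *)
Lemma K1_increasing x y : 0 < x -> x < y -> K1 q n x < K1 q n y.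
Proof.
move=> x0 xy; have S1 := kummer_system1 lam_gt0 q_ge0; rewrite K1E.
have dK u : u \in `]x, y[ -> is_derive u 1 (fun z => expR (- z) * F1 z)
    ((n * (expR (- u) * F1 u) - expR (- u) * G1 u) / u).
  rewrite in_itv/= => /andP[xu _]; apply: (is_derive_harmonic S1); exact: lt_trans xu.
have cK : {within `[x, y], continuous (fun z => expR (- z) * F1 z)}.
  apply: continuous_in_subspaceT => u /set_mem/=; rewrite in_itv/= => /andP[xu _].
  exact: is_derive_cont (is_derive_harmonic S1 (lt_le_trans x0 xu)).
have [u] := MVT xy dK cK; rewrite in_itv/= => /andP[xu _] E.
have u0 := lt_trans x0 xu.
rewrite -subr_gt0 E mulr_gt0 ?subr_gt0// divr_gt0//.
suff -> : n * (expR (- u) * F1 u) - expR (- u) * G1 u = expR (- u) * u `^ n * P u.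
  by rewrite !mulr_gt0 ?expR_gt0 ?powR_gt0 ?P_gt0.
by rewrite /kummerF /kummerG powRS// /P; ring.
Qed.

(** The right-hand side times e^z, paired with [g], solves the same system with [g] vanishing at 0+.
    Uniqueness makes it a multiple of the Kummer solution, and the values 1 at 0 fix the
    multiple. *)
Lemma kummer_transformation z : 0 < z ->
  K1 q n z = z `^ n * kummerM lam (n + 1) (- z).
Proof.
move=> z0.
pose f z := expR z * (z `^ n * kummerM lam (n + 1) (- z)).
pose g z := lam / (n + 1) * (expR z * (z `^ (n + 1) * kummerM (lam + 1) (n + 1 + 1) (- z))).
have dMN a b (x : R) : 0 < b -> is_derive x 1 (fun y => kummerM a b (- y))
    (- (a / b * kummerM (a + 1) (b + 1) (- x))).
  move=> b0; have dN := is_derive_oppf (is_derive_idf x).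
  apply: (is_derive_eqval (@is_derive_compf R (kummerM a b) (fun y => - y) x _ _
    (is_derive_kummerM a (- x) b0) dN)); ring.
have S : kummer_system lam q f g.
  move=> x x0; have xn0 : x != 0 by rewrite gt_eqF.
  split.
    apply: (is_derive_eqval (is_derive_mulcf (lam / (n + 1)) (is_derive_mulf (is_derive_expR x)
      (is_derive_mulf (is_derive_powRf (n + 1) x0) (dMN (lam + 1) _ x n11_gt0))))).
    have I1 := kummerM_lower_b (lam + 1) (- x) n1_gt0.
    have I1' := kummerM_lower_b lam (- x) n_gt0.
    have I2 := kummerM_derive_raise_b lam (- x) n_gt0.
    move: I1 I1' I2; set D := kummerM (lam + 1 + 1) _ _; set M11 := kummerM (lam + 1) (n + 1) _.
    rewrite /f /g; set M12 := kummerM (lam + 1) _ _; set M1 := kummerM lam (n + 1) _.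
    set M0 := kummerM lam n _ => I1 I1' I2.
    have n0 : n != 0 by rewrite gt_eqF.
    have lam0 : lam != 0 by rewrite gt_eqF.
    have n10 : n + 1 != 0 by rewrite gt_eqF.
    (* The contiguous relation behind g' = lam f, obtained by eliminating [M0] from [I1'] and
       [I2]. *)
    have key : x * M12 + (n + 1) * M11 = (n + 1) * M1.
      have -> : M11 = n / lam * (lam / n * M11) by field; rewrite n0.
      rewrite I2; have -> : M0 = (n * M0) / n by field.
      by rewrite -I1'; field; rewrite n0 n10.
    rewrite addrK.
    transitivity (lam / (n + 1) * (expR x * (x `^ n * (x * M12 + (n + 1) * M11)))).
      by rewrite -I1 powRS//; ring.
    by rewrite key; field.
  apply: (is_derive_eqval (is_derive_mulf (is_derive_expR x)
      (is_derive_mulf (is_derive_powRf n x0) (dMN lam _ x n1_gt0)))).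
  rewrite powR_pred// /f /g powRS//; field.
  by rewrite xn0 gt_eqF.
have cMN a b (x : R) : 0 < b -> {for x, continuous (fun y => kummerM a b (- y))}.
  by move=> b0; exact: is_derive_cont (dMN a b x b0).
have g0 : g z @[z --> 0^'+] --> (0 : R).
  rewrite -[X in _ --> X](mulr0 (lam / (n + 1))); apply: cvgMl_tmp.
  rewrite -[X in _ --> X](mulr0 (expR 0)); apply: cvgM.
    by apply: cvg_at_right_filter; exact: continuous_expR.
  rewrite -[X in _ --> X](mul0r (kummerM (lam + 1) (n + 1 + 1) (- 0))); apply: cvgM.
    exact: powR_cvg0.
  by apply: cvg_at_right_filter; exact: cMN.
have [c hc] := kummer_system_uniq lam_gt0 q_ge0 S g0.
have E y : 0 < y -> expR y * kummerM lam (n + 1) (- y) = c * kummerM (q + 1) (n + 1) y.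
  move=> y0; have [+ _] := hc y y0; rewrite /f /kummerF mulrCA [RHS]mulrCA.
  by move/(mulfI (lt0r_neq0 (powR_gt0 n y0))).
have c1 : c = 1.
  have l1 : expR y * kummerM lam (n + 1) (- y) @[y --> 0^'+] --> expR 0 * kummerM lam (n + 1) (- 0).
    by apply: cvg_at_right_filter; apply: cvgM; [exact: continuous_expR|exact: cMN].
  have l2 : c * kummerM (q + 1) (n + 1) y @[y --> 0^'+] --> c * kummerM (q + 1) (n + 1) 0.
    by apply: cvgMl_tmp; apply: cvg_at_right_filter; exact: continuous_kummerM.
  have := right_lim_unique (right_cvg_eq E l1) l2.
  by rewrite oppr0 !kummerM0 expR0 !mulr1.
rewrite K1_kummerF; have [/esym + _] := hc z z0; rewrite c1 mul1r => ->.
by rewrite /f mulrA -expRD addNr expR0 mul1r.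
Qed.

End HarmonicFunctions.

(** * Convolution with the claim law and harmonicity *)

Section Convolution.
Context {R : realType}.
Local Notation mu := (@lebesgue_measure R).
Variables lam q : R.
Hypothesis lam_gt0 : 0 < lam.
Hypothesis q_ge0 : 0 <= q.

Local Notation n := (q + lam).
Let n_gt0 : 0 < n. Proof. by rewrite ltr_wpDl. Qed.
Let n1_gt0 : 0 < n + 1. Proof. by rewrite addr_gt0. Qed.
Local Notation F1 := (kummerF lam q).
Local Notation G1 := (kummerG lam q).
Local Notation F2 := (tricomiF lam q).
Local Notation G2 := (tricomiG lam q).

Let contF1 (u : R) : 0 < u -> {for u, continuous F1}.
Proof. by move=> u0; have [_ /is_derive_cont] := kummer_system1 lam_gt0 q_ge0 u0. Qed.

Let mF1 (z : R) : measurable_fun `]0, z[ F1.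
Proof.
apply: open_continuous_measurable_fun; first exact: interval_open.
by move=> u; rewrite inE/= in_itv/= => /andP[u0 _]; exact: contF1.
Qed.

Lemma integral_kummerF (z : R) : 0 < z ->
  (\int[mu]_(y in `]0%R, z[) (F1 y)%:E = (G1 z / lam)%:E)%E.
Proof.
move=> z0; rewrite integral_itv_bndo_bndc; last exact/measurable_EFinP.
have dG y : 0 < y <= z -> is_derive y 1 (fun y => G1 y / lam) (F1 y).
  move=> /andP[y0 yz]; have [dG _] := kummer_system1 lam_gt0 q_ge0 y0.
  apply: (is_derive_eqval (is_derive_mulf dG (is_derive_cstf lam^-1 y))).
  by field; rewrite gt_eqF.
rewrite (@ge0_open_FTC _ F1 _ 0 z 0 z0 dG) ?subr0//.
- by move=> y /andP[y0 _]; exact: contF1.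
- by move=> y /andP[y0 _]; exact/ltW/kummerF_gt0.
- by rewrite -[X in _ --> X](mul0r lam^-1); apply: cvgM; [exact: kummerG_cvg0|exact: cvg_cst].
Qed.

Let convolution_integrand z y :
  K1 q n (z - y) * expR (- y) = expR (- z) * F1 (z - y).
Proof.
rewrite K1_kummerF mulrAC -expRD; congr (expR _ * _); ring.
Qed.

(** The exponentials combine to e^(-z), and reflection y -> z - y leaves the integral of [F1], a
    multiple of [G1]. *)
Lemma integral_K1 (z : R) : 0 < z ->
  (\int[mu]_(y in `]0%R, z[) (K1 q n (z - y) * expR (- y))%:E =
   (expR (- z) * G1 z / lam)%:E)%E.
Proof.
move=> z0; under eq_integral do rewrite convolution_integrand.
have := @integral_reflect _ 0 z (fun u => expR (- z) * F1 u).
rewrite subr0 => ->; last exact: measurable_funM.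
under eq_integral do rewrite EFinM.
rewrite ge0_integralZl_EFin//.
- by rewrite integral_kummerF// -EFinM mulrA.
- by move=> u /=; rewrite in_itv/= => /andP[u0 _]; rewrite lee_fin ltW// kummerF_gt0.
- by apply/measurable_EFinP; exact: mF1.
Qed.

Lemma Rintegral_K1 (z : R) : 0 < z ->
  \int[mu]_(y in `]0, z[) (K1 q n (z - y) * expR (- y)) = K1 q (n + 1) z / (n + 1).
Proof.
move=> z0; rewrite /Rintegral integral_K1//= K1_kummerG//.
by field; rewrite !gt_eqF.
Qed.

Lemma q_harmonic_K1 : q_harmonic lam q (K1 q n).
Proof.
move=> z z0; have S1 := kummer_system1 lam_gt0 q_ge0.
have K1E : K1 q n = fun z => expR (- z) * F1 z by apply/funext => y; exact: K1_kummerF.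
have dK := is_derive_harmonic S1 z0.
split.
- by rewrite K1E; case: dK.
- apply/integrableP; split.
    apply/measurable_EFinP.
    apply: open_continuous_measurable_fun; first exact: interval_open.
    move=> u; rewrite inE/= in_itv/= => /andP[u0 uz].
    rewrite K1E.
    have zu : 0 < z - u by rewrite subr_gt0.
    have d1 := is_derive_subf (is_derive_cstf z u) (is_derive_idf u).
    apply: is_derive_cont (is_derive_mulf (@is_derive_compf R (fun z => expR (- z) * F1 z)
      (fun y => z - y) u _ _ (is_derive_harmonic S1 zu) d1) (is_derive_expRNf u)).
  rewrite (_ : \int[mu]_(x in _) _ =
    \int[mu]_(y in `]0%R, z[) (K1 q n (z - y) * expR (- y))%:E)%E.
    by rewrite integral_K1// ltry.
  apply: eq_integral => y; rewrite inE/= in_itv/= => /andP[y0 yz].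
  by rewrite /= ger0_norm// convolution_integrand mulr_ge0 ?expR_ge0// ltW// kummerF_gt0 ?subr_gt0.
- rewrite /Rintegral integral_K1//= K1E (is_derive_derive1 dK).
  by field; rewrite !gt_eqF.
Qed.

(** Harmonicity of [h] is the Kummer system for F = e^z h and its primitive from 0, which tends to 0
    at 0+; [kummer_system_uniq] then applies. *)
Lemma q_harmonic_unique (h : R -> R) : q_harmonic lam q h ->
  exists c, forall z, 0 < z -> h z = c * K1 q n z.
Proof.
move=> harm; pose F z := expR z * h z.
pose G z := lam * \int[mu]_(y in `]0, z]) F y.
have dh (z : R) : 0 < z -> is_derive z 1 h (h^`()%classic z).
  by move=> z0; apply: DeriveDef; [case: (harm z z0)|rewrite derive1E].
have dF (z : R) (z0 : 0 < z) := is_derive_mulf (is_derive_expR z) (dh z z0).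
have contF (z : R) : 0 < z -> {for z, continuous F}.
  by move=> z0; exact: is_derive_cont (dF z z0).
have mF (z : R) : measurable_fun `]0, z[ F.
  apply: open_continuous_measurable_fun; first exact: interval_open.
  by move=> u; rewrite inE/= in_itv/= => /andP[u0 _]; exact: contF.
have integrandE z y : h (z - y) * expR (- y) = expR (- z) * F (z - y).
  have -> : expR (- y) = expR (- z) * expR (z - y) by rewrite -expRD; congr expR; ring.
  by rewrite /F; ring.
have mitv (z : R) : measurable (`]0, z[%classic : set (measurableTypeR R)).
  exact: measurable_itv.
(* Reflection carries the integrability required in [q_harmonic] over to [F]; this is what makes a
   primitive starting at 0 available. *)
have iF (z : R) : 0 < z -> mu.-integrable `]0, z[ (EFin \o F).
  move=> z0; have [_ /integrableP[_ fin] _] := harm z z0.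
  have ikF : mu.-integrable `]0, z[ (EFin \o (fun y => expR (- z) * F y)).
    apply/integrableP; split; first by apply/measurable_EFinP; apply: measurable_funM => //; exact: mF.
    have := @integral_reflect _ 0 z (fun u => `|expR (- z) * F u|).
    rewrite subr0 /= => <-; last by apply: measurableT_comp => //; apply: measurable_funM => //; exact: mF.
    by under eq_integral do rewrite -integrandE.
  have := integrableZl (mitv z) (expR z) ikF.
  congr (_.-integrable _ _); apply/funext => y /=.
  by rewrite -EFinM mulrA -expRD subrr expR0 mul1r.
have iFoc (z : R) : 0 < z -> mu.-integrable `]0, z] (EFin \o F).
  move=> z0; have /integrableP[/measurable_EFinP mFz fin] := iF z z0.
  have mF' : measurable_fun `]0, z] F by apply/measurable_fun_itv_bndo_bndcP.
  apply/integrableP; split; first exact/measurable_EFinP.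
  rewrite -integral_itv_bndo_bndc//.
  by apply: measurableT_comp => //; exact/measurable_EFinP.
have iFcc (z : R) : 0 < z -> mu.-integrable `[0, z] (EFin \o F).
  move=> z0; have /integrableP[/measurable_EFinP mFz fin] := iFoc z z0.
  have mF' : measurable_fun `[0, z] F by apply/measurable_fun_itv_obnd_cbndP.
  apply/integrableP; split; first exact/measurable_EFinP.
  rewrite -integral_itv_obnd_cbnd//.
  by apply: measurableT_comp => //; exact/measurable_EFinP.
have convE (z : R) : 0 < z ->
    \int[mu]_(y in `]0, z[) (h (z - y) * expR (- y)) = expR (- z) * \int[mu]_(y in `]0, z]) F y.
  move=> z0; rewrite -RintegralZl//; last exact: iFoc.
  rewrite -Rintegral_itv_bndo_bndc; last first.
    by apply: (integrableZl (mitv z) (expR (- z)) (iF z z0)).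
  rewrite /Rintegral; under eq_integral do rewrite integrandE.
  have := @integral_reflect _ 0 z (fun u => expR (- z) * F u).
  by rewrite subr0 => ->//; apply: measurable_funM => //; exact: mF.
have S : kummer_system lam q F G.
  move=> z z0; split.
    have zz : z < z + 1 by rewrite ltrDl.
    have z1 : 0 < z + 1 by rewrite addr_gt0.
    have lt0z : (BRight 0 < BRight z)%O by rewrite bnd_simp.
    have [dI dIE] := @continuous_FTC1 R F (BRight 0) z (z + 1) zz (iFoc _ z1) lt0z (contF z z0).
    apply: is_derive_mulcf; apply: DeriveDef; first exact: dI.
    by rewrite -derive1E; exact: dIE.
  apply: (is_derive_eqval (dF z z0)).
  have [_ _] := harm z z0; rewrite convE// => E.
  have -> : h^`()%classic z =
      ((lam + q) * h z - lam * (expR (- z) * \int[mu]_(y in `]0, z]) F y)) / z.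
    apply/(mulfI (lt0r_neq0 z0)); rewrite [RHS]mulrC divfK ?gt_eqF//.
    by apply/eqP; rewrite eq_sym subr_eq; move/eqP: E; rewrite subr_eq0 => /eqP ->.
  have eE : expR z * expR (- z) = 1 by rewrite -expRD subrr expR0.
  rewrite /G /F; field: eE; last by rewrite gt_eqF.
have G0 : G z @[z --> 0^'+] --> (0 : R).
  rewrite -[X in _ --> X](mulr0 lam); apply: cvgMl_tmp.
  have h0 := cvg_at_right_filter (parameterized_integral_cvg_left ltr01 (iFcc 1 ltr01)).
  apply: right_cvg_eq h0 => z z0; rewrite /parameterized_integral.
  by rewrite -Rintegral_itv_obnd_cbnd//; exact: iFoc.
have [c hc] := kummer_system_uniq lam_gt0 q_ge0 S G0.
exists c => z z0; have [Fz _] := hc z z0.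
have -> : h z = expR (- z) * F z by rewrite /F mulrA -expRD addNr expR0 mul1r.
by rewrite Fz K1_kummerF; ring.
Qed.

(** The constant in Liouville's formula is found by letting y tend to 0+: it is Gamma (n + 1) /
    Gamma (q + 1). *)
Lemma wronskian21_gt0 (x : R) : 0 < x -> 0 < G2 x * F1 x - F2 x * G1 x.
Proof.
move=> x0; set w := (X in 0 < X).
have p0 (y : R) : 0 < y -> 0 < y `^ n * expR y by move=> y0; rewrite mulr_gt0 ?powR_gt0 ?expR_gt0.
suff -> : w = Gamma (n + 1) / Gamma (q + 1) * (x `^ n * expR x).
  rewrite mulr_gt0 ?p0// divr_gt0 ?Gamma_gt0//; first by rewrite lerDr ltW.
  by rewrite lerDr.
rewrite -[LHS](divfK (lt0r_neq0 (p0 x x0))); congr (_ * _).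
have lim_w : w / (x `^ n * expR x) @[y --> (0 : R)^'+] --> w / (x `^ n * expR x) by exact: cvg_cst.
apply: right_lim_unique lim_w _.
have Mlim b : 0 < b -> kummerM (q + 1) b y @[y --> 0^'+] --> (1 : R).
  move=> b0; rewrite -[X in _ --> X](kummerM0 (q + 1) b); apply: cvg_at_right_filter.
  exact: continuous_kummerM.
have lim0 : (G2 y * kummerM (q + 1) (n + 1) y -
    y * F2 y * (lam / (n + 1) * kummerM (q + 1) (n + 1 + 1) y)) / expR y @[y --> 0^'+] -->
    (Gamma (n + 1) / Gamma (q + 1) * 1 - 0 * (lam / (n + 1) * 1)) / 1.
  apply: cvgM.
    apply: cvgB; apply: cvgM.
    - exact: tricomiG_cvg0.
    - exact: Mlim.
    - exact: mul_tricomiF_cvg0.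
    - by apply: cvgMl_tmp; apply: Mlim; rewrite addr_gt0.
  rewrite -expR0; apply: cvgV; first by rewrite expR0 oner_neq0.
  by apply: cvg_at_right_filter; exact: continuous_expR.
rewrite mulr1 mul0r subr0 divr1 in lim0.
apply: right_cvg_eq lim0 => y y0.
have S1 : kummer_system lam q F1 G1 by exact: kummer_system1.
have S2 : kummer_system lam q F2 G2 by exact: kummer_system2.
have := wronskian_proportional S2 S1 x0 y0; rewrite -/w => ->.
rewrite /kummerF /kummerG powRS//; field.
by rewrite !gt_eqF ?powR_gt0 ?expR_gt0.
Qed.

End Convolution.

(** * The scale function and its derivatives *)

Section ScaleFunction.
Context {R : realType}.
Local Notation mu := (@lebesgue_measure R).
Variables lam q : R.
Hypothesis lam_gt0 : 0 < lam.
Hypothesis q_ge0 : 0 <= q.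

Local Notation n := (q + lam).
Let n_gt0 : 0 < n. Proof. by rewrite ltr_wpDl. Qed.
Let n1_gt0 : 0 < n + 1. Proof. by rewrite addr_gt0. Qed.
Let n11_gt0 : 0 < n + 1 + 1. Proof. by rewrite addr_gt0. Qed.
Let q1_gt0 : 0 < q + 1. Proof. by rewrite ltr_wpDl. Qed.
Local Notation F1 := (kummerF lam q).
Local Notation G1 := (kummerG lam q).
Local Notation F2 := (tricomiF lam q).
Local Notation G2 := (tricomiG lam q).
Let S1 : kummer_system lam q F1 G1. Proof. exact: kummer_system1. Qed.
Let S2 : kummer_system lam q F2 G2. Proof. exact: kummer_system2. Qed.

(** [tricomiG] for lam is [tricomiF] for lam + 1, so the two systems give two expressions for its
    derivative; equating them and letting z tend to 0+ gives the identity. *)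
Lemma GammaS : Gamma (n + 1 + 1) = (n + 1) * Gamma (n + 1).
Proof.
have lam1 : 0 < lam + 1 by rewrite addr_gt0.
have S' : kummer_system (lam + 1) q (tricomiF (lam + 1) q) (tricomiG (lam + 1) q).
  exact: kummer_system2.
have F2S : tricomiF (lam + 1) q = G2 by apply/funext => z; rewrite /tricomiF /tricomiG addrK.
rewrite F2S in S'.
have E (z : R) : 0 < z -> lam * (z * F2 z) = (z + (n + 1)) * G2 z - tricomiG (lam + 1) q z.
  move=> z0; have [_ d'] := S' z z0; have [d _] := S2 z0.
  have := is_derive_derive1 d; rewrite (is_derive_derive1 d') => E.
  rewrite mulrCA -E; field; exact: lt0r_neq0.
have lim1 : lam * (z * F2 z) @[z --> (0 : R)^'+] --> lam * 0.
  by apply: cvgMl_tmp; exact: mul_tricomiF_cvg0.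
have lim2 : (z + (n + 1)) * G2 z - tricomiG (lam + 1) q z @[z --> (0 : R)^'+] -->
    (0 + (n + 1)) * (Gamma (n + 1) / Gamma (q + 1)) - Gamma (q + (lam + 1) + 1) / Gamma (q + 1).
  apply: cvgB; last exact: tricomiG_cvg0.
  apply: cvgM; last exact: tricomiG_cvg0.
  by apply: cvg_at_right_filter; apply: cvgD; [exact: cvg_id|exact: cvg_cst].
have := right_lim_unique (right_cvg_eq E lim1) lim2.
have Gq0 : Gamma (q + 1) != 0 by apply: lt0r_neq0; apply: Gamma_gt0; rewrite lerDr.
rewrite mulr0 add0r mulrA -mulrBl addrA => /esym/eqP.
by rewrite mulf_eq0 invr_eq0 (negbTE Gq0) orbF subr_eq0 => /eqP.
Qed.

Opaque kummerF kummerG tricomiF tricomiG.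

(** The combination whose [G] part vanishes at [a]: there kappa = 0, so the passage below [a] pays
    nothing. *)
Definition scaleF a z := F1 z - G1 a / G2 a * F2 z.
Definition scaleG a z := G1 z - G1 a / G2 a * G2 z.

Lemma scale_system a : kummer_system lam q (scaleF a) (scaleG a).
Proof. exact: kummer_systemB. Qed.

Lemma scaleG_cvg0 (a : R) : 0 < a -> scaleG a y @[y --> a^'+] --> (0 : R).
Proof.
move=> a0; have -> : 0 = scaleG a a.
  by rewrite /scaleG divfK ?subrr// gt_eqF// tricomiG_gt0.
apply: cvg_at_right_filter; have [dG _] := @scale_system a a a0.
exact: is_derive_cont dG.
Qed.

(** Positivity of the Wronskian is used twice: it makes [G1 / G2] nondecreasing and gives G1 z / G2
    z < F1 z / F2 z. *)
Lemma scaleF_gt0 a z : 0 < a -> a <= z -> 0 < scaleF a z.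
Proof.
move=> a0 az; have z0 := lt_le_trans a0 az.
have G2z := tricomiG_gt0 lam q_ge0 z0; have F2z := tricomiF_gt0 lam q_ge0 z0.
have mono : G1 a / G2 a <= G1 z / G2 z.
  have dr (y : R) : 0 < y -> is_derive y 1 (fun y => G1 y / G2 y)
      ((lam * F1 y * G2 y - G1 y * (lam * F2 y)) / G2 y ^+ 2).
    move=> y0; have [d1 _] := S1 y0; have [d2 _] := S2 y0.
    exact: (@is_derive_divf R G1 G2 y _ _ (lt0r_neq0 (tricomiG_gt0 lam q_ge0 y0)) d1 d2).
  apply: (@ger0_derive1_ndecr _ (fun y => G1 y / G2 y) a z) => //.
  - by move=> y; rewrite in_itv/= => /andP[ay _]; case: (dr y (lt_trans a0 ay)).
  - move=> y; rewrite in_itv/= => /andP[ay _]; have y0 := lt_trans a0 ay.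
    rewrite (is_derive_derive1 (dr y y0)) divr_ge0 ?sqr_ge0//.
    have -> : lam * F1 y * G2 y - G1 y * (lam * F2 y) =
      lam * (G2 y * F1 y - F2 y * G1 y) by ring.
    by rewrite mulr_ge0 ?(ltW lam_gt0)// ltW// wronskian21_gt0.
  - apply: continuous_in_subspaceT => y /set_mem/=; rewrite in_itv/= => /andP[ay _].
    exact: is_derive_cont (dr y (lt_le_trans a0 ay)).
have w0 := wronskian21_gt0 lam_gt0 q_ge0 z0.
have lt1 : G1 z / G2 z * F2 z < F1 z.
  rewrite mulrAC ltr_pdivrMr// -subr_gt0 [G1 z * _]mulrC [F1 z * _]mulrC.
  exact: w0.
by rewrite /scaleF subr_gt0; exact: le_lt_trans (ler_wpM2r (ltW F2z) mono) lt1.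
Qed.

Definition scaleW z a := K1 q n z -
  lam / (n + 1) * (K1 q (n + 1) a / K2 q (n + 1) a) * K2 q n z.

Lemma scaleWE z a : 0 < a -> 0 < z -> scaleW z a = expR (- z) * scaleF a z.
Proof.
move=> a0 z0; rewrite /scaleW K1_kummerF K1_kummerG// K2_tricomiF// K2_tricomiG// /scaleF.
by field; rewrite !gt_eqF ?expR_gt0 ?tricomiG_gt0.
Qed.

Lemma scaleW_gt0 z a : 0 < a -> a <= z -> 0 < scaleW z a.
Proof.
move=> a0 az; rewrite scaleWE//; last exact: lt_le_trans az.
by rewrite mulr_gt0 ?expR_gt0// scaleF_gt0.
Qed.

Section Derivatives.
Variables f F G : R -> R.
Hypothesis S : kummer_system lam q F G.
Hypothesis fE : forall z : R, 0 < z -> f z = expR (- z) * F z.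

Let df (z : R) : 0 < z -> is_derive z 1 f ((n * f z - expR (- z) * G z) / z).
Proof.
move=> z0; apply: (is_derive_eqval (is_derive_eqfun _ (is_derive_harmonic S z0))).
  by apply: filterS (near_pos z0) => y y0; rewrite fE.
by rewrite fE.
Qed.

(** [f] is given by the system only on the positive axis, so the derivatives are transferred on a
    neighbourhood of z. *)
Lemma harmonic_derivatives (z : R) : 0 < z ->
  [/\ derivable f z 1, derivable f^`()%classic z 1 &
      f^`(2)%classic z = (q * f z - (1 - n + z) * ((n * f z - expR (- z) * G z) / z)) / z].
Proof.
move=> z0; have d2 : is_derive z 1 f^`()%classic
    ((q * f z - (1 - n + z) * ((n * f z - expR (- z) * G z) / z)) / z).
  apply: (is_derive_eqval (is_derive_eqfun _ (is_derive2_harmonic S z0))).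
    apply: filterS (near_pos z0) => y y0.
    by rewrite (derive1_harmonic S y0) (is_derive_derive1 (df y0)) fE.
  by rewrite fE.
split; first by case: (df z0).
  by case: d2.
exact: is_derive_derive1 d2.
Qed.

End Derivatives.

Lemma scaleW_derivatives z a : 0 < a -> 0 < z ->
  [/\ derivable (scaleW ^~ a) z 1, derivable (scaleW ^~ a)^`()%classic z 1 &
      (scaleW ^~ a)^`(2)%classic z = (K1 q n)^`(2)%classic z -
        lam / (n + 1) * (K1 q (n + 1) a / K2 q (n + 1) a) * (K2 q n)^`(2)%classic z].
Proof.
move=> a0 z0.
have [d1 d2 ->] := harmonic_derivatives (@scale_system a) (fun z z0 => @scaleWE z a a0 z0) z0.
split; [exact: d1|exact: d2|].
have [_ _ ->] := harmonic_derivatives S1 (fun z _ => K1_kummerF lam q z) z0.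
have [_ _ ->] := harmonic_derivatives S2 (fun z z0 => K2_tricomiF lam q_ge0 z0) z0.
rewrite /scaleW !K1_kummerG// !K1_kummerF !K2_tricomiG// !K2_tricomiF// /scaleG.
have G2n0 := lt0r_neq0 (tricomiG_gt0 lam q_ge0 a0).
have en0 := lt0r_neq0 (expR_gt0 (- a)).
have lam0 := lt0r_neq0 lam_gt0; have n10 := lt0r_neq0 n1_gt0; have zn0 := lt0r_neq0 z0.
move: G2n0 en0; move: (F1 z) (F2 z) (G1 z) (G2 z) (G1 a) (G2 a) (expR (- z)) (expR (- a)).
move=> f1 f2 g1 g2 g1a g2a ez ea G2n0 en0; field.
by rewrite G2n0 en0 lam0 n10 zn0.
Qed.

Lemma scaleW_tricomi z a : 0 < a -> scaleW z a = z `^ n * expR (- z) *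
  (kummerM (q + 1) (n + 1) z - lam / (n + 1) * tricomiU (q + 1) (n + 1) z *
    (kummerM (q + 1) (n + 1 + 1) a / tricomiU (q + 1) (n + 1 + 1) a)).
Proof.
move=> a0; rewrite /scaleW /K1 /K2 -mulf_div divff ?mul1r; first by ring.
by rewrite gt_eqF// mulr_gt0 ?powR_gt0 ?expR_gt0.
Qed.

Lemma tricomi_gt0 a : 0 < a -> 0 < tricomiU (q + 1) (n + 1 + 1) a.
Proof.
move=> a0; have := tricomiG_gt0 lam q_ge0 a0; rewrite tricomiG_tricomi//.
by rewrite pmulr_rgt0// powR_gt0.
Qed.

(** At z = a the [G] part is 0, so a W' = n W there, and the second-order equation makes W'' an
    explicit multiple of W. *)
Lemma scaleW_derive2_diag a : 0 < a ->
  expR a * a `^ (- n + 2) / Gamma (n + 1) * (scaleW ^~ a)^`(2)%classic a =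
  (q * a - (1 - n + a) * n) / Gamma (n + 1) *
  (kummerM (q + 1) (n + 1) a - lam / (n + 1) * tricomiU (q + 1) (n + 1) a *
    (kummerM (q + 1) (n + 1 + 1) a / tricomiU (q + 1) (n + 1 + 1) a)).
Proof.
move=> a0.
have [_ _ ->] := harmonic_derivatives (@scale_system a) (fun z z0 => @scaleWE z a a0 z0) a0.
have -> : scaleG a a = 0 by rewrite /scaleG divfK ?subrr// gt_eqF// tricomiG_gt0.
rewrite scaleW_tricomi//; set B := (kummerM _ _ _ - _).
have an0 : a `^ n != 0 by rewrite gt_eqF// powR_gt0.
have -> : a `^ (- n + 2) = a ^+ 2 / a `^ n.
  by rewrite (@powRD _ a (- n) 2) ?(gt_eqF a0) ?implybT// powRN powR_mulrn ?(ltW a0)// mulrC.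
have eE : expR (- a) = (expR a)^-1 by rewrite expRN.
rewrite eE; field.
by rewrite an0 !gt_eqF ?expR_gt0// Gamma_gt0// lerDr ltW.
Qed.

Let tricomi_ratioE z : 0 < z ->
  z * F2 z / G2 z = tricomiU (q + 1) (n + 1) z / tricomiU (q + 1) (n + 1 + 1) z.
Proof.
move=> z0; rewrite tricomiF_tricomi// tricomiG_tricomi// powRS//.
move: (lt0r_neq0 (tricomi_gt0 z0)) (lt0r_neq0 (powR_gt0 n z0)).
move: (tricomiU _ _ _) (tricomiU _ _ _) (z `^ n) => u1 u2 p u20 p0; field.
by rewrite u20 p0 lt0r_neq0.
Qed.

(** The ratio is z F2 / G2, whose numerator tends to 0 and whose denominator to a positive limit. *)
Lemma tricomi_ratio_cvg0 :
  tricomiU (q + 1) (n + 1) z / tricomiU (q + 1) (n + 1 + 1) z @[z --> (0 : R)^'+] --> (0 : R).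
Proof.
have G0 : Gamma (n + 1) / Gamma (q + 1) != 0.
  by rewrite gt_eqF// divr_gt0 ?Gamma_gt0 ?lerDr// ltW.
have h : z * F2 z / G2 z @[z --> (0 : R)^'+] --> 0 / (Gamma (n + 1) / Gamma (q + 1)).
  apply: cvgM; first exact: mul_tricomiF_cvg0.
  by apply: cvgV => //; exact: tricomiG_cvg0.
by rewrite mul0r in h; exact: right_cvg_eq tricomi_ratioE h.
Qed.

Lemma scaleW_derive2_cvg :
  expR x * x `^ (- n + 2) / Gamma (n + 1) * (scaleW ^~ x)^`(2)%classic x
    @[x --> (0 : R)^'+] --> (n - 1) * n / Gamma (n + 1).
Proof.
have Mlim b : 0 < b -> kummerM (q + 1) b y @[y --> (0 : R)^'+] --> (1 : R).
  move=> b0; rewrite -[X in _ --> X](kummerM0 (q + 1) b); apply: cvg_at_right_filter.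
  exact: continuous_kummerM.
have h : (q * x - (1 - n + x) * n) / Gamma (n + 1) *
  (kummerM (q + 1) (n + 1) x - lam / (n + 1) * kummerM (q + 1) (n + 1 + 1) x *
   (tricomiU (q + 1) (n + 1) x / tricomiU (q + 1) (n + 1 + 1) x))
   @[x --> (0 : R)^'+] --> (q * 0 - (1 - n + 0) * n) / Gamma (n + 1) * (1 - lam / (n + 1) * 1 * 0).
  apply: cvgM.
    apply: cvgM; last exact: cvg_cst.
    apply: cvg_at_right_filter; apply: cvgB; first by apply: cvgMl_tmp; exact: cvg_id.
    by apply: cvgMr_tmp; apply: cvgD; [exact: cvg_cst|exact: cvg_id].
  apply: cvgB; first exact: Mlim.
  apply: cvgM; last exact: tricomi_ratio_cvg0.
  by apply: cvgMl_tmp; exact: Mlim.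
have E : (q * 0 - (1 - n + 0) * n) / Gamma (n + 1) * (1 - lam / (n + 1) * 1 * 0) =
  (n - 1) * n / Gamma (n + 1) by ring.
rewrite E in h; apply: right_cvg_eq h => x x0.
by rewrite scaleW_derive2_diag//; congr (_ * (_ - _)); ring.
Qed.

End ScaleFunction.

(** * The one-round equation *)

Section OneRound.
Context {R : realType}.
Local Notation mu := (@lebesgue_measure R).
Local Notation Rpos := (`]0%R, +oo[%classic : set R).
Variables lam q theta kappa a b : R.
Hypothesis lam_gt0 : 0 < lam.
Hypothesis q_ge0 : 0 <= q.
Hypothesis theta_gtN1 : -1 < theta.
Hypothesis kappa_ge0 : 0 <= kappa.
Hypothesis a_ge0 : 0 <= a.
Hypothesis b_gt0 : 0 < b.
Hypothesis ab : a <= b.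
Variables F G : R -> R.
Hypothesis S : kummer_system lam q F G.
Hypothesis F_ge0 : forall y, 0 < y -> a <= y <= b -> 0 <= F y.

Local Notation n := (q + lam).
(** The mean value after a claim at level x is e^(-x) times the integral of F over ]a, x], plus e^(a
    - x) kappa / (1 + theta) from claims overshooting [a]. For this to be e^(-x) G x / lam, G must
    start at [Ga]. *)
Let Ga := lam * kappa * expR a / (1 + theta).
Hypothesis G_lim : G y @[y --> a^'+] --> Ga.

Let n_gt0 : 0 < n. Proof. by rewrite ltr_wpDl. Qed.
Let th1 : 0 < 1 + theta. Proof. by rewrite -ltrBlDl sub0r. Qed.
Let Ga_ge0 : 0 <= Ga.
Proof. by rewrite divr_ge0 ?(ltW th1)// !mulr_ge0 ?expR_ge0// ltW. Qed.

(* At level 0, possible only when a = 0, the process waits for its first claim,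
   which ruins it. *)
Definition value u : R :=
  if a <= u <= b then
    if u == 0 then lam * kappa / (n * (1 + theta))
    else expR (- u) * (F \_ Rpos) u
  else 0.

Lemma valueE u : 0 < u -> a <= u <= b -> value u = expR (- u) * F u.
Proof.
by move=> u0 aub; rewrite /value aub gt_eqF// patchE mem_set//= in_itv/= u0.
Qed.

Lemma value_ge0 u : 0 <= value u.
Proof.
rewrite /value; case: ifP => // /andP[au ub].
case: eqP => [_|/eqP u0]; first by rewrite divr_ge0 ?mulr_ge0 ?(ltW lam_gt0) ?(ltW n_gt0) ?(ltW th1).
rewrite mulr_ge0 ?expR_ge0// patchE; case: ifP => // /set_mem/=; rewrite in_itv/= andbT => u1.
by apply: F_ge0 => //; rewrite au.
Qed.

Let contF u : 0 < u -> {for u, continuous F}.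
Proof. by move=> u0; have [_ /is_derive_cont] := S u0. Qed.

Let contG u : 0 < u -> {for u, continuous G}.
Proof. by move=> u0; have [/is_derive_cont] := S u0. Qed.

Lemma measurable_value : measurable_fun setT value.
Proof.
have mF : measurable_fun setT (F \_ Rpos).
  apply/(measurable_restrictT _ _).1; first exact: measurable_itv.
  apply: open_continuous_measurable_fun; first exact: interval_open.
  by move=> u; rewrite inE/= in_itv/= andbT; exact: contF.
apply: measurable_fun_ifT => //.
  by apply: measurable_and; exact: measurable_fun_ler.
apply: measurable_fun_ifT => //; first exact: measurable_fun_eqr.
apply: measurable_funM => //.
by apply: measurableT_comp.
Qed.

Lemma primitive_mono u v : 0 < u -> a < u -> u <= v -> v <= b -> G u <= G v.
Proof.
move=> u0 au uv vb.
apply: (@ger0_derive1_ndecr _ G u v) => //.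
- move=> x; rewrite in_itv/= => /andP[ux xv].
  by have [[]] := S (lt_trans u0 ux).
- move=> x; rewrite in_itv/= => /andP[ux xv].
  have [dG _] := S (lt_trans u0 ux).
  rewrite (is_derive_derive1 dG) mulr_ge0 ?(ltW lam_gt0)// F_ge0 ?(lt_trans u0)//.
  by rewrite (ltW (lt_trans au ux)) (le_trans (ltW xv)).
- apply: continuous_in_subspaceT => x /set_mem/=; rewrite in_itv/= => /andP[ux _].
  exact/contG/(lt_le_trans u0).
Qed.

Lemma primitive_ge0 u : a < u -> u <= b -> 0 <= G u.
Proof.
move=> au ub; apply: (le_trans Ga_ge0).
apply: (cvgr_to_le G_lim); near=> y.
have ay : a < y by near: y; exact: nbhs_right_gt.
have yu : y < u by near: y; exact: nbhs_right_lt.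
by apply: primitive_mono => //; [exact: le_lt_trans ay|exact: ltW].
Unshelve. all: by end_near. Qed.

(* By the system, (F u e^(- u) - G b / n) u^(- n) is nondecreasing. *)
Lemma value_bounded : exists B, forall u, value u <= B.
Proof.
pose M := G b / n.
pose D u := (F u * expR (- u) - M) / u `^ n.
have dD (u : R) : 0 < u -> is_derive u 1 D ((G b - G u * expR (- u)) / (u * u `^ n)).
  move=> u0; have [_ dF] := S u0.
  have un0 : u != 0 by rewrite gt_eqF.
  have p0 : u `^ n != 0 by rewrite gt_eqF// powR_gt0.
  have n0 : n != 0 by rewrite gt_eqF.
  apply: (is_derive_eqval (@is_derive_divf R (fun u => F u * expR (- u) - M)
    (fun u => u `^ n) u _ _ p0
    (is_derive_subf (is_derive_mulf dF (is_derive_expRNf u)) (is_derive_cstf M u))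
    (is_derive_powRf n u0))).
  by rewrite powR_pred// /M; field; rewrite un0 p0 n0.
have D_le u : 0 < u -> a < u -> u <= b -> D u <= D b.
  move=> u0 au ub; apply: (@ger0_derive1_ndecr _ D u b) => //.
  - move=> x; rewrite in_itv/= => /andP[ux xb].
    by case: (dD x (lt_trans u0 ux)).
  - move=> x; rewrite in_itv/= => /andP[ux xb].
    have x0 := lt_trans u0 ux.
    rewrite (is_derive_derive1 (dD x x0)) divr_ge0 ?mulr_ge0 ?powR_ge0 ?(ltW x0)//.
    have Gx0 : 0 <= G x by rewrite primitive_ge0 ?(ltW xb) ?(lt_trans au).
    rewrite subr_ge0 (le_trans (y := G x))//.
      by rewrite ler_piMr// -expR0 ler_expR oppr_le0 ltW.
    by apply: primitive_mono; rewrite ?(ltW xb) ?(lt_trans au).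
  - apply: continuous_in_subspaceT => x /set_mem/=; rewrite in_itv/= => /andP[ux _].
    by apply: is_derive_cont; apply: dD; exact: lt_le_trans ux.
exists (Num.max (value 0) (Num.max (value a) (M + `|D b| * b `^ n))) => u.
rewrite !le_max.
have [aub|aub] := boolP (a <= u <= b); last first.
  by rewrite [value u]/value (negbTE aub) value_ge0.
have [->|u0] := eqVneq u 0; first by rewrite lexx.
have [->|ua] := eqVneq u a; first by rewrite lexx orbT.
have /andP[au ub] := aub.
have {}au : a < u by rewrite lt_neqAle eq_sym ua.
have {}u0 : 0 < u by exact: le_lt_trans au.
apply/orP; right; apply/orP; right.
rewrite valueE// mulrC -[F u * _](subrK M) addrC lerD2l.
have p0 : 0 < u `^ n by rewrite powR_gt0.
rewrite -[leLHS](divfK (lt0r_neq0 p0)) -/(D u).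
apply: (@le_trans _ _ (`|D b| * u `^ n)).
  by rewrite ler_wpM2r ?(ltW p0)// (le_trans (D_le u u0 au ub))// ler_norm.
rewrite ler_wpM2l//; apply: ge0_ler_powR; rewrite ?nnegrE ?(ltW n_gt0) ?(ltW u0) ?(ltW b_gt0)//.
Qed.

Let mvalue := measurable_value.

Let hb := expR (- b) * F b.
Let hb_ge0 : 0 <= hb.
Proof. by rewrite mulr_ge0 ?expR_ge0// F_ge0 ?ab ?lexx. Qed.

Let g u := expR (theta * (u - a)).

Definition round_payoff y t c : \bar R :=
  ((hb * pay_up q b y t + kappa * pay_down q a b g y t c)%:E +
   (if stays a b y t c then expR (- (q * t)) * value (expR t * y - c) else 0)%:E)%E.

Lemma round_payoff_up y t : b < expR t * y ->
  (\int[mu]_(c in `]0%R, +oo[) (round_payoff y t c * (expR (- c))%:E) =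
   (hb * expR (- (q * (ln b - ln y))))%:E)%E.
Proof.
move=> bx; set k := hb * _.
transitivity (\int[mu]_(c in `]0%R, +oo[) (k%:E * (expR (- (1 * c)))%:E))%E.
  apply: eq_integral => c _.
  by rewrite /round_payoff /pay_up /pay_down /stays bx leNgt bx/= andbF mulr0 !addr0 mul1r.
rewrite ge0_integralZl_EFin//.
- by rewrite integral_exp_tail// mulr0 oppr0 expR0 divr1 mule1.
- apply/measurable_EFinP; apply: measurable_funTS; apply: measurableT_comp => //.
  by apply: measurableT_comp => //; exact: measurable_funM.
- by rewrite /k mulr_ge0 ?expR_ge0.
Qed.

Let measurable_round_payoff y t : measurable_fun setT (fun c => round_payoff y t c).
Proof.
have m1 : measurable_fun setT (fun c : R => expR t * y - c) by exact: measurable_funB.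
apply: emeasurable_funD; apply/measurable_EFinP.
  apply: measurable_funD => //; apply: measurable_funM => //.
  apply: measurable_fun_ifT => //; first by apply: measurable_and => //; exact: measurable_fun_ltr.
  apply: measurable_funM => //; apply: measurableT_comp => //.
  by apply: measurableT_comp => //; apply: measurable_funM => //; exact: measurable_funB.
apply: measurable_fun_ifT => //.
  apply: measurable_and => //; apply: measurable_and => //; apply: measurable_and => //.
    exact: measurable_fun_ler.
  exact: measurable_fun_ltr.
by apply: measurable_funM => //; exact: measurableT_comp.
Qed.

Let round_payoff_ge0 y t c : (0 <= round_payoff y t c)%E.
Proof.
rewrite adde_ge0// lee_fin.
  rewrite addr_ge0// mulr_ge0//; first exact: pay_up_ge0.
  by apply: pay_down_ge0 => u; exact: expR_ge0.
by case: ifP => // _; rewrite mulr_ge0 ?expR_ge0 ?value_ge0.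
Qed.

Lemma integral_system x : 0 < x -> a < x -> x <= b ->
  (\int[mu]_(y in `]a, x]) (F y)%:E = ((G x - Ga) / lam)%:E)%E.
Proof.
move=> x0 ax xb; rewrite mulrBl.
apply: (@ge0_open_FTC _ F (fun y => G y / lam)) => //.
- move=> y /andP[ay yx]; have y0 : 0 < y by exact: le_lt_trans ay.
  have [dG _] := S y0.
  apply: (is_derive_eqval (is_derive_mulf dG (is_derive_cstf lam^-1 y))).
  by field; rewrite gt_eqF.
- by move=> y /andP[ay yx]; apply: contF; exact: le_lt_trans ay.
- move=> y /andP[ay yx]; apply: F_ge0; first exact: le_lt_trans ay.
  by rewrite (ltW ay) (le_trans yx).
- by apply: cvgM => //; exact: cvg_cst.
Qed.

(** The claims are split at x - a. Larger ones ruin and pay kappa / (1 + theta) on average over the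
    overshoot; smaller ones, after reflection, give the integral of F over ]a, x]. The choice of
    [Ga] merges the two into G x. *)
Lemma round_payoff_stay y t : 0 < t -> a <= y -> expR t * y <= b ->
  (\int[mu]_(c in `]0%R, +oo[) (round_payoff y t c * (expR (- c))%:E) =
   (expR (- (q * t)) * (if y == 0 then kappa / (1 + theta)
      else expR (- (expR t * y)) * G (expR t * y) / lam))%:E)%E.
Proof.
move=> t0 ay xb; set x := expR t * y.
have y0 : 0 <= y by exact: le_trans ay.
have yx : y <= x by rewrite ler_peMl// -expR0 ler_expR ltW.
have ax : a <= x by exact: le_trans yx.
have d0 : 0 <= x - a by rewrite subr_ge0.
rewrite (@ge0_integral_itv_split R _ (x - a))//; last 2 first.
- apply: emeasurable_funM => //; apply/measurable_EFinP.
  by apply: measurableT_comp => //.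
- by move=> c _; rewrite mule_ge0// lee_fin expR_ge0.
have -> : (\int[mu]_(c in `](x - a)%R, +oo[) (round_payoff y t c * (expR (- c))%:E) =
   (kappa * expR (- (q * t)) * (expR (- (x - a)) / (1 + theta)))%:E)%E.
  set k := kappa * expR (- (q * t)) * expR (theta * (x - a)).
  transitivity (\int[mu]_(c in `](x - a)%R, +oo[) (k%:E * (expR (- ((1 + theta) * c)))%:E))%E.
    apply: eq_integral => c; rewrite inE/= in_itv/= andbT => dc.
    rewrite /round_payoff /pay_up /pay_down /stays -/x ltNge xb/=.
    have -> : x - c < a by rewrite ltrBlDr -ltrBlDl.
    have -> : a <= x - c = false by apply/negbTE; rewrite -ltNge ltrBlDr -ltrBlDl.
    rewrite andbF/= addr0 mulr0 add0r -!EFinM /k /g -!mulrA; congr (_ * (_ * _))%:E.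
    by rewrite -!expRD; congr expR; ring.
  rewrite ge0_integralZl_EFin//.
  - rewrite integral_exp_tail// -EFinM /k; congr _%:E.
    rewrite -!mulrA; congr (_ * (_ * _)); rewrite !mulrA -expRD; congr (expR _ / _); ring.
  - apply/measurable_EFinP; apply: measurable_funTS; apply: measurableT_comp => //.
    by apply: measurableT_comp => //; exact: measurable_funM.
  - by rewrite /k !mulr_ge0 ?expR_ge0.
(* From 0, which forces a = 0, the process does not move before the claim, and the range of
   survivable claims is empty. *)
have [yE|yn0] := eqVneq y 0.
  have a0 : a = 0 by apply/eqP; rewrite eq_le a_ge0 -yE ay.
  have -> : x = 0 by rewrite /x yE mulr0.
  rewrite a0 subrr set_itvoc0 integral_set0 add0e oppr0 expR0; congr _%:E.
  by field; rewrite gt_eqF.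
have {}y0 : 0 < y by rewrite lt_neqAle eq_sym yn0.
have {}yx : y < x by rewrite ltr_pMl// -expR0 ltr_expR.
have {}ax : a < x by exact: le_lt_trans yx.
have x0 : 0 < x by exact: lt_trans yx.
have dpos : 0 < x - a by rewrite subr_gt0.
have mF : measurable_fun `]a, x[ F.
  apply: open_continuous_measurable_fun; first exact: interval_open.
  by move=> u; rewrite inE/= in_itv/= => /andP[au _]; apply: contF; exact: le_lt_trans au.
rewrite -integral_itv_bndo_bndc; last first.
  by apply: measurable_funTS; apply: emeasurable_funM => //; apply/measurable_EFinP; exact: measurableT_comp.
set k := expR (- (q * t)) * expR (- x).
have k_ge0 : 0 <= k by rewrite mulr_ge0 ?expR_ge0.
have -> : (\int[mu]_(c in `]0%R, (x - a)%R[) (round_payoff y t c * (expR (- c))%:E) =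
    \int[mu]_(c in `]0%R, (x - a)%R[) (k * F (x - c)%R)%:E)%E.
  apply: eq_integral => c; rewrite inE/= in_itv/= => /andP[c0 cd].
  have axc : a < x - c by rewrite ltrBrDl -ltrBrDr.
  rewrite /round_payoff /pay_up /pay_down /stays -/x ltNge xb/= ltNge (ltW axc)/= t0 c0/=.
  rewrite !mulr0 addr0 add0r -EFinM valueE//; last 2 first.
  - exact: le_lt_trans axc.
  - by rewrite (ltW axc)/= (le_trans _ xb)// gerBl ltW.
  have eE : expR (- x) = expR (- (x - c)) * expR (- c).
    by rewrite -expRD; congr expR; ring.
  by congr _%:E; rewrite /k eE; ring.
rewrite (@integral_reflect _ a x (fun u => k * F u)); last exact: measurable_funM.
rewrite integral_itv_bndo_bndc; last by apply/measurable_EFinP; exact: measurable_funM.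
have -> : (\int[mu]_(u in `]a, x]) (k * F u)%:E = k%:E * \int[mu]_(u in `]a, x]) (F u)%:E)%E.
  under eq_integral do rewrite EFinM.
  rewrite ge0_integralZl_EFin//.
  - move=> u /=; rewrite in_itv/= => /andP[au ux]; rewrite lee_fin F_ge0//.
      exact: le_lt_trans au.
    by rewrite (ltW au) (le_trans ux).
  - by apply/measurable_EFinP/measurable_fun_itv_bndo_bndcP.
rewrite integral_system// -EFinM -EFinD; congr _%:E.
rewrite /k /Ga opprB expRD.
have eE : expR a * expR (- a) = 1 by rewrite -expRD subrr expR0.
by field; rewrite ?gt_eqF.
Qed.

(** Without a claim the path reaches [b] at time s = ln (b / y). Gaps longer than s contribute the
    up-passage term e^(-n s) [hb]; the shorter ones give an integral with an explicit primitive,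
    whose value at s cancels that term. *)
Lemma round_value y : a <= y <= b -> round_mean lam (round_payoff y) = (value y)%:E.
Proof.
move=> /andP[ay yb]; have y0 : 0 <= y by exact: le_trans ay.
have [yE|yn0] := eqVneq y 0.
  have a0 : a = 0 by apply/eqP; rewrite eq_le a_ge0 -yE ay.
  rewrite /round_mean.
  transitivity (\int[mu]_(t in `]0%R, +oo[) ((lam * kappa / (1 + theta))%:E * (expR (- (n * t)))%:E))%E.
    apply: eq_integral => t; rewrite inE/= in_itv/= andbT => t0.
    rewrite round_payoff_stay//; last by rewrite yE mulr0 ltW.
    rewrite yE eqxx -!EFinM; congr _%:E.
    have -> : - (n * t) = - (q * t) + - (lam * t) by ring.
    by rewrite expRD; ring.
  rewrite ge0_integralZl_EFin//.
  - rewrite integral_exp_tail// mulr0 oppr0 expR0 -EFinM /value yE eqxx a0 lexx (ltW b_gt0)/=.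
    by congr _%:E; field; rewrite !gt_eqF.
  - apply/measurable_EFinP; apply: measurable_funTS; apply: measurableT_comp => //.
    by apply: measurableT_comp => //; exact: measurable_funM.
  - by rewrite divr_ge0 ?(ltW th1)// mulr_ge0 ?(ltW lam_gt0).
have {}y0 : 0 < y by rewrite lt_neqAle eq_sym yn0.
pose s : R := ln b - ln y.
have expRs : expR s * y = b.
  by rewrite /s expRB !lnK ?posrE// divfK// gt_eqF.
have s0 : 0 <= s by rewrite subr_ge0 ler_ln ?posrE.
have btE t : (b < expR t * y) = (s < t).
  by rewrite -expRs ltr_pM2r// ltr_expR.
pose stay t := expR (- (n * t)) * (expR (- (expR t * y)) * G (expR t * y)).
pose up t := hb * expR (- (q * s)) * (lam * expR (- (lam * t))).
have dx (t : R) : is_derive t 1 (fun t => expR t * y) (expR t * y).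
  by apply: (is_derive_eqval (is_derive_mulf (is_derive_expR t) (is_derive_cstf y t))); ring.
have x_gt0 t : 0 < expR t * y by rewrite mulr_gt0 ?expR_gt0.
have dexp (t : R) : is_derive t 1 (fun t => expR (- (n * t))) (- n * expR (- (n * t))).
  have -> : (fun t : R => expR (- (n * t))) = fun t => expR (- n * t).
    by apply/funext => u; rewrite mulNr.
  by rewrite -[in X in is_derive _ _ _ X]mulNr; exact: is_derive_expRcf.
have dexpx (t : R) := @is_derive_compf R (fun x => expR (- x)) (fun t => expR t * y) t _ _
  (is_derive_expRNf _) (dx t).
have cstay t : {for t, continuous stay}.
  have [dG _] := S (x_gt0 t).
  exact: is_derive_cont (is_derive_mulf (dexp t) (is_derive_mulf (dexpx t)
    (@is_derive_compf R G (fun t => expR t * y) t _ _ dG (dx t)))).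
rewrite /round_mean.
transitivity (\int[mu]_(t in `]0%R, +oo[) (if s < t then up t else stay t)%:E)%E.
  apply: eq_integral => t; rewrite inE/= in_itv/= andbT => t0.
  have [st|ts] := ltP s t.
    by rewrite round_payoff_up ?btE// -EFinM.
  rewrite round_payoff_stay//; last by rewrite leNgt btE -leNgt.
  rewrite (negbTE yn0) -EFinM; congr _%:E; rewrite /stay.
  have -> : - (n * t) = - (q * t) + - (lam * t) by ring.
  by rewrite expRD; field; rewrite gt_eqF.
rewrite (@ge0_integral_itv_split R _ s)//; last 2 first.
- apply/measurable_EFinP; apply: measurable_fun_ifT => //; first exact: measurable_fun_ltr.
    apply: measurable_funM => //; apply: measurable_funM => //; apply: measurableT_comp => //.
    by apply: measurableT_comp => //; exact: measurable_funM.
  exact: continuous_measurable_fun.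
- move=> t t0; rewrite lee_fin; case: ltP => [st|ts].
    by rewrite /up !mulr_ge0 ?expR_ge0 ?(ltW lam_gt0)// F_ge0 ?ab ?lexx.
  rewrite /stay !mulr_ge0 ?expR_ge0//; apply: primitive_ge0; last by rewrite leNgt btE -leNgt.
  by rewrite (le_lt_trans ay)// ltr_pMl// -expR0 ltr_expR.
have -> : (\int[mu]_(t in `]s, +oo[) (if s < t then up t else stay t)%:E =
    (hb * expR (- (n * s)))%:E)%E.
  set k := hb * expR (- (q * s)) * lam.
  transitivity (\int[mu]_(t in `]s, +oo[) (k%:E * (expR (- (lam * t)))%:E))%E.
    apply: eq_integral => t; rewrite inE/= in_itv/= andbT => ->.
    by rewrite -EFinM /up /k mulrA.
  rewrite ge0_integralZl_EFin//.
  - rewrite integral_exp_tail// -EFinM; congr _%:E.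
    have -> : - (n * s) = - (q * s) + - (lam * s) by ring.
    by rewrite expRD /k; field; rewrite gt_eqF.
  - apply/measurable_EFinP; apply: measurable_funTS; apply: measurableT_comp => //.
    by apply: measurableT_comp => //; exact: measurable_funM.
  - by rewrite /k !mulr_ge0 ?expR_ge0 ?(ltW lam_gt0)// F_ge0 ?ab ?lexx.
have -> : (\int[mu]_(t in `]0%R, s]) (if s < t then up t else stay t)%:E =
    \int[mu]_(t in `]0%R, s]) (stay t)%:E)%E.
  by apply: eq_integral => t; rewrite inE/= in_itv/= => /andP[_]; rewrite leNgt => /negbTE ->.
rewrite valueE ?ay//.
move: s0; rewrite le_eqVlt => /predU1P[sE|s0].
  have yE : y = b by rewrite -expRs -sE expR0 mul1r.
  by rewrite -sE set_itvoc0 integral_set0 add0e mulr0 oppr0 expR0 mulr1 yE.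
rewrite integral_itv_obnd_cbnd; last first.
  apply/measurable_EFinP; apply: measurable_funTS; exact: continuous_measurable_fun.
(* Minus e^(-n t) e^(-x) F x along x = e^t y. Since dx/dt = x, the equation x F' = (x + n) F - G
   leaves only the [G] term in the derivative. *)
pose Phi t := - (expR (- (n * t)) * (expR (- (expR t * y)) * F (expR t * y))).
have dPhi (t : R) : is_derive t 1 Phi (stay t).
  have [_ dF] := S (x_gt0 t).
  have d := is_derive_oppf (is_derive_mulf (dexp t) (is_derive_mulf (dexpx t)
    (@is_derive_compf R F (fun t => expR t * y) t _ _ dF (dx t)))).
  apply: (is_derive_eqval d); rewrite /stay; field.
  by rewrite yn0 gt_eqF// expR_gt0.
rewrite (@closed_FTC R stay Phi 0 s s0 (fun t _ => dPhi t) (fun t _ => cstay t)).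
by rewrite -EFinD /Phi expRs mulr0 oppr0 !expR0 !mul1r /hb; congr _%:E; ring.
Qed.

End OneRound.

(** * Exit laws *)

Section ExitLaws.
Context {d : measure_display} {T : measurableType d} {R : realType}.
Variables (P : probability T R) (lam q : R) (tau C : nat -> {RV P >-> R}).
Variables (N : R -> T -> nat) (z : R) (X : R -> T -> R).
Hypothesis lam_gt0 : 0 < lam.
Hypothesis q_ge0 : 0 <= q.
Hypothesis N_poisson : poisson_process lam tau N.
Hypothesis C_iid : iid_exponential 1 C.
Hypothesis NC_indep : independent_sequences tau C.
Hypothesis X_segerdahl : segerdahl_process 1 0 z N C X.
Hypothesis z_gt0 : 0 < z.

Let measurable_deficit theta a : measurable_fun setT (fun u : R => expR (theta * (u - a))).
Proof.
by apply: measurableT_comp => //; apply: measurable_funM => //; exact: measurable_funB.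
Qed.

(** Joins the analytic side, the one-round equation for [value], to the probabilistic one, the
    iteration along the chain. *)
Lemma exit_identity theta kappa a b (F G : R -> R) :
  -1 < theta -> 0 <= kappa -> 0 <= a -> a <= z -> z <= b ->
  kummer_system lam q F G -> (forall y, 0 < y -> a <= y <= b -> 0 <= F y) ->
  G y @[y --> a^'+] --> lam * kappa * expR a / (1 + theta) ->
  ((expR (- z) * F z)%:E = (expR (- b) * F b)%:E * exit_above P q X a b +
   kappa%:E * exit_below_mean P q X a b (fun u => expR (theta * (u - a)))%R)%E.
Proof.
move=> th k0 a0 az zb S F0 Glim.
have ab := le_trans az zb; have b0 := lt_le_trans z_gt0 zb.
have azb : a <= z <= b by rewrite az.
have [B hB] := value_bounded lam_gt0 q_ge0 th k0 a0 b0 S F0 Glim.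
rewrite -(valueE lam q theta kappa F z_gt0 azb).
have g0 y : 0 <= expR (theta * (y - a)) by exact: expR_ge0.
apply: (two_sided_identity lam_gt0 q_ge0 N_poisson C_iid NC_indep X_segerdahl z_gt0
  a0 azb g0 _ _ hB) => //.
- by move=> y; exact: value_ge0.
- exact: measurable_value S.
- by rewrite mulr_ge0 ?expR_ge0// F0 ?ab ?lexx.
- by move=> y ayb; exact: (round_value lam_gt0 q_ge0 th k0 a0 b0 ab S F0 Glim ayb).
Qed.

(** The case kappa = 0; the finite left side also excludes an infinite expectation. *)
Lemma exit_above_ratio a b (F G : R -> R) :
  0 <= a -> a <= z -> z <= b -> kummer_system lam q F G ->
  (forall y, 0 < y -> a <= y -> 0 < F y) -> G y @[y --> a^'+] --> (0 : R) ->
  exit_above P q X a b = ((expR (- z) * F z) / (expR (- b) * F b))%:E.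
Proof.
move=> a0 az zb S F0 Glim.
have Fb : 0 < expR (- b) * F b.
  by rewrite mulr_gt0 ?expR_gt0// F0 ?(lt_le_trans z_gt0)// (le_trans az).
have := @exit_identity 0 0 a b F G.
rewrite mulr0 !mul0r mul0e adde0 => /(_ _ _ _ _ _ S) E.
have {E} : ((expR (- z) * F z)%:E = (expR (- b) * F b)%:E * exit_above P q X a b)%E.
  by apply: E => // y y0 /andP[ay _]; exact/ltW/F0.
case: exit_above => [e| |].
- by rewrite -EFinM => -[->]; rewrite mulrAC divff ?mul1r// gt_eqF.
- by rewrite gt0_muley.
- by rewrite gt0_muleNy.
Qed.

Lemma passage_above_ge0 b w : (0 <= passage_above X b w)%E.
Proof. by apply: le_ereal_inf_tmp => _ [t [t0 _] <-]; rewrite lee_fin. Qed.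

Lemma discount_le1 (t : \bar R) : (0 <= t)%E -> discount q t <= 1.
Proof.
case: t => [t||] //=; rewrite lee_fin => t0.
by rewrite -expR0 ler_expR oppr_le0 mulr_ge0.
Qed.

Lemma exit_above_le1 a b : (exit_above P q X a b <= 1)%E.
Proof.
rewrite /exit_above unlock.
rewrite -[leRHS](_ : \int[P]_w cst 1%E w = _)%E; last first.
  by rewrite integral_cst// mul1e; exact: probability_setT.
apply: ge0_le_integral_nonmeasurable => w.
  by rewrite lee_fin mulr_ge0 ?discount_ge0.
rewrite lee_fin; case: (_ < _)%E; rewrite ?mulr0 ?mulr1//.
by rewrite discount_le1// passage_above_ge0.
Qed.

Lemma exit_above_ge0 a b : (0 <= exit_above P q X a b)%E.
Proof.
by rewrite /exit_above unlock integral_ge0// => w _; rewrite lee_fin mulr_ge0 ?discount_ge0.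
Qed.

Section Ruin.
Variables (a L : R).
Hypothesis a_ge0 : 0 <= a.
Hypothesis az : a <= z.
Hypothesis L_gt0 : 0 < L.
Hypothesis G2_lim : tricomiG lam q y @[y --> a^'+] --> L.

(** The constant [c] scales the Tricomi solution so that kappa = 1. [L] is its limit at a+, which is
    [tricomiG] at a > 0 and a ratio of Gamma values at 0. *)
Let F2_identity theta b : -1 < theta -> z <= b ->
  ((lam * expR a / ((1 + theta) * L) * (expR (- z) * tricomiF lam q z))%:E =
   (lam * expR a / ((1 + theta) * L) * (expR (- b) * tricomiF lam q b))%:E * exit_above P q X a b +
   exit_below_mean P q X a b (fun u => expR (theta * (u - a)))%R)%E.
Proof.
move=> th zb.
have th1 : 0 < 1 + theta by rewrite -ltrBlDl sub0r.
set c := _ / _.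
have S : kummer_system lam q (fun y => c * tricomiF lam q y) (fun y => c * tricomiG lam q y).
  by apply: kummer_systemZ; exact: kummer_system2.
have := exit_identity th ler01 a_ge0 az zb S.
rewrite mul1e mulr1 [expR (- z) * _]mulrCA [expR (- b) * _]mulrCA; apply.
- move=> y y0 _; rewrite mulr_ge0//; last exact/ltW/tricomiF_gt0.
  by rewrite divr_ge0 ?mulr_ge0 ?expR_ge0 ?ltW.
- have -> : lam * expR a / (1 + theta) = c * L.
    by rewrite /c; field; rewrite !gt_eqF.
  exact: cvgMl_tmp.
Qed.

(** Let b = z + i tend to infinity in [F2_identity]: the left side is fixed, the up-passage term is
    at most [hb i], which tends to 0, and the ruin term converges monotonically. *)
Lemma ruin_deficitE theta : -1 < theta ->
  ruin_deficit P q theta X a =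
  (lam * expR a / ((1 + theta) * L) * (expR (- z) * tricomiF lam q z))%:E.
Proof.
move=> th; set K := _ * (expR (- z) * _).
have th1 : 0 < 1 + theta by rewrite -ltrBlDl sub0r.
set c := lam * expR a / ((1 + theta) * L).
have c0 : 0 < c by rewrite divr_gt0 ?mulr_gt0 ?expR_gt0.
pose g u := expR (theta * (u - a)).
pose hb i := c * (expR (- (z + i%:R)) * tricomiF lam q (z + i%:R)).
have zi i : z <= z + i%:R by rewrite lerDl ler0n.
have z_i i : 0 < z + i%:R by rewrite (lt_le_trans z_gt0).
have hb0 i : 0 <= hb i.
  by rewrite mulr_ge0 ?(ltW c0)// mulr_ge0 ?expR_ge0// ltW// tricomiF_gt0.
have below : exit_below_mean P q X a (z + i%:R) g @[i --> \oo] -->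
    ruin_deficit P q theta X a.
  rewrite /ruin_deficit unlock.
  apply: (exit_below_mean_cvg lam_gt0 N_poisson C_iid X_segerdahl z_gt0 a_ge0 az) => [y|].
    exact: expR_ge0.
  exact: measurable_deficit.
have [B hB] := shifted_gamma_decay q_ge0 lam_gt0.
have hb_cvg : hb i @[i --> \oo] --> (0 : R).
  pose ub i := c * (B * expR (- (2^-1 * (z + i%:R))) / Gamma (q + 1)).
  have ub_cvg : ub i @[i --> \oo] --> (0 : R).
    rewrite -[X in _ --> X](mulr0 c); apply: cvgMl_tmp.
    rewrite -[X in _ --> X](mul0r (Gamma (q + 1))^-1); apply: cvgMr_tmp.
    rewrite -[X in _ --> X](mulr0 B); apply: cvgMl_tmp.
    apply: (@cvg_comp _ _ _ (fun i : nat => i%:R) (fun r => expR (- (2^-1 * (z + r)))) _ +oo).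
      exact: cvgr_idn.
    apply: (@cvg_comp _ _ _ (fun r => 2^-1 * (z + r)) (fun x => expR (- x)) _ +oo);
      last exact: cvgr_expR.
    by apply: gt0_cvgMry; [rewrite invr_gt0|exact: cvg_addrl].
  apply: (squeeze_cvgr _ (cvg_cst 0) ub_cvg); near=> i.
  rewrite hb0/= ler_wpM2l ?(ltW c0)// /tricomiF mulrA ler_wpM2r//.
    by rewrite invr_ge0 ltW// Gamma_gt0 ?lerDr.
  apply: hB; rewrite (le_trans (y := i%:R))//; last by rewrite lerDr ltW.
  by rewrite ler1n; near: i; exists 1%N.
have above : ((hb i)%:E * exit_above P q X a (z + i%:R))%E @[i --> \oo] --> 0%E.
  apply: (@squeeze_cvge _ _ _ _ (cst 0%E) _ (fun i => (hb i)%:E)).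
  - near=> i; rewrite mule_ge0 ?lee_fin// ?exit_above_ge0//=.
    by rewrite -[leRHS]mule1 lee_wpmul2l ?lee_fin// exit_above_le1.
  - exact: cvg_cst.
  - by apply: cvg_EFin => //; exact: nearW.
have : (fun i => (hb i)%:E * exit_above P q X a (z + i%:R) +
    exit_below_mean P q X a (z + i%:R) g)%E = fun=> K%:E.
  by apply/funext => i; rewrite -F2_identity.
move=> E; have := cvgeD _ above below; rewrite E add0e => H.
have {}H : K%:E @[_ --> \oo] --> ruin_deficit P q theta X a.
  by apply: H; exact: fin_num_adde_defr.
by rewrite -(cvg_lim (@ereal_hausdorff R) H) lim_cst//; exact: ereal_hausdorff.
Unshelve. all: by end_near. Qed.

Lemma ruinE : ruin P q X a = (lam * expR a / L * (expR (- z) * tricomiF lam q z))%:E.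
Proof.
have := @ruin_deficitE 0; rewrite addr0 mul1r => <-; last by rewrite oppr_lt0.
by rewrite /ruin_deficit /ruin; congr ('E_P[_])%E; apply/funext => w; rewrite mul0r expR0 mulr1.
Qed.

Lemma ruin_beforeE b : z <= b ->
  ((lam * expR a / L * (expR (- z) * tricomiF lam q z))%:E =
   (lam * expR a / L * (expR (- b) * tricomiF lam q b))%:E * exit_above P q X a b +
   ruin_before P q X a b)%E.
Proof.
move=> zb; have th : -1 < 0 :> R by rewrite oppr_lt0.
have := F2_identity th zb.
rewrite (_ : (1 + 0) * L = L); last by ring.
move=> E; apply: (etrans E).
congr (_ + _)%E; rewrite /exit_below_mean /ruin_before unlock.
by apply: eq_integral => w _; rewrite mul0r expR0 mulr1.
Qed.

End Ruin.

End ExitLaws.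

Lemma det_mx22 (R : realType) (x11 x12 x21 x22 : R) :
  \det (mx22 x11 x12 x21 x22) = x11 * x22 - x12 * x21.
Proof.
rewrite (expand_det_row _ ord0) !big_ord_recl big_ord0 /cofactor !det_mx11 !mxE/=.
rewrite /= !addr0 expr0 expr1 !mul1r mulN1r; ring.
Qed.

(** Equal ratios on ordered pairs of D make f / g constant on D; the base point x0 is compared with
    points on either side. *)
Lemma ratio_unique (R : realType) (D : R -> Prop) (e : R -> R -> \bar R) (f g : R -> R) (x0 : R) :
  D x0 ->
  (forall x y, D x -> x <= y -> f y != 0 /\ e x y = (f x / f y)%:E) ->
  (forall x y, D x -> x <= y -> g y != 0 /\ e x y = (g x / g y)%:E) ->
  exists2 c, c != 0 & forall x, D x -> f x = c * g x.
Proof.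
move=> Dx0 hf hg.
have f0 x : D x -> f x != 0 by move=> /hf /(_ (lexx x)) [].
have g0 x : D x -> g x != 0 by move=> /hg /(_ (lexx x)) [].
exists (f x0 / g x0); first by rewrite mulf_neq0 ?invr_eq0 ?f0 ?g0.
have key x y : D x -> D y -> x <= y -> f x / g x = f y / g y.
  move=> Dx Dy xy; have [_ e1] := hf x y Dx xy; have [_] := hg x y Dx xy.
  rewrite e1 => -[] /eqP; rewrite eqr_div ?f0 ?g0// => /eqP E.
  by apply/eqP; rewrite eqr_div ?g0// E mulrC.
move=> x Dx; have [xx0|/ltW xx0] := leP x x0.
  by rewrite -(key x x0)// divfK// g0.
by rewrite (key x0 x)// divfK// g0.
Qed.

(** * Survival, ruin and scale functions of the process *)

Section Theorem2.
Context {d : measure_display} {T : measurableType d} {R : realType}.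
Variables (P : probability T R) (lam q : R) (tau C : nat -> {RV P >-> R}).
Variables (N : R -> T -> nat) (X : R -> R -> T -> R).
Hypothesis lam_gt0 : 0 < lam.
Hypothesis q_ge0 : 0 <= q.
Hypothesis N_poisson : poisson_process lam tau N.
Hypothesis C_iid : iid_exponential 1 C.
Hypothesis NC_indep : independent_sequences tau C.
Hypothesis X_segerdahl : forall z : R, segerdahl_process 1 0 z N C (X z).

Local Notation n := (q + lam).
Let n_gt0 : 0 < n. Proof. by rewrite ltr_wpDl. Qed.
Let n1_gt0 : 0 < n + 1. Proof. by rewrite addr_gt0. Qed.

Lemma survival_K1 : survival_function P q X (K1 q n).
Proof.
move=> z b z0 zb; have b0 := lt_le_trans z0 zb.
have F1p y : 0 < y -> 0 <= y -> 0 < kummerF lam q y by move=> y0 _; exact: kummerF_gt0.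
have G0 := kummerG_cvg0 lam_gt0 q_ge0.
rewrite (exit_above_ratio lam_gt0 q_ge0 N_poisson C_iid NC_indep (X_segerdahl z) z0
  (lexx 0) (ltW z0) zb (kummer_system1 lam_gt0 q_ge0) F1p G0) !K1_kummerF.
by split => //; rewrite gt_eqF// mulr_gt0 ?expR_gt0 ?F1p// ltW.
Qed.

Lemma scale_scaleW a : 0 < a -> scale_function P q X a (fun z => scaleW lam q z a).
Proof.
move=> a0 z b az zb; have z0 := lt_le_trans a0 az; have b0 := lt_le_trans z0 zb.
have Fp y : 0 < y -> a <= y -> 0 < scaleF lam q a y by move=> _; exact: scaleF_gt0.
rewrite (exit_above_ratio lam_gt0 q_ge0 N_poisson C_iid NC_indep (X_segerdahl z) z0
  (ltW a0) az zb (scale_system lam_gt0 q_ge0 a) Fp (scaleG_cvg0 lam_gt0 q_ge0 a0)).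
rewrite -!scaleWE//; split => //.
by rewrite gt_eqF// scaleW_gt0// (le_trans az).
Qed.

Lemma survival_unique (H : R -> R) : survival_function P q X H ->
  exists2 c : R, c != 0 & forall z, 0 < z -> H z = c * K1 q n z.
Proof.
move=> hH; have K := survival_K1.
exact: (@ratio_unique R (fun z => 0 < z) (fun z b => exit_above P q (X z) 0 b) H (K1 q n) 1 ltr01).
Qed.

Lemma scale_unique a (W : R -> R) : 0 < a -> scale_function P q X a W ->
  exists2 c : R, c != 0 & forall z, a <= z -> W z = c * scaleW lam q z a.
Proof.
move=> a0 hW; have S := scale_scaleW a0.
exact: (@ratio_unique R (fun z => a <= z) (fun z b => exit_above P q (X z) a b) W
  (fun z => scaleW lam q z a) a (lexx a)).
Qed.

Lemma scale_proportional a c (W : R -> R) : 0 < a -> c != 0 ->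
  (forall z, a <= z -> W z = c * scaleW lam q z a) -> scale_function P q X a W.
Proof.
move=> a0 c0 WE z b az zb; have [Wb0 ->] := scale_scaleW a0 az zb.
have ab := le_trans az zb.
rewrite (WE z az) (WE b ab); split; first exact: mulf_neq0.
by rewrite -mulf_div (divff c0) mul1r.
Qed.

Lemma ruin_deficit_level_pos a z theta : 0 < a -> a <= z -> - 1 < theta ->
  ruin_deficit P q theta (X z) a =
  (lam * (K2 q n z / K2 q (n + 1) a) / (1 + theta))%:E.
Proof.
move=> a0 az th; have z0 := lt_le_trans a0 az.
have th1 : 0 < 1 + theta by rewrite -ltrBlDl sub0r.
have G2a := tricomiG_gt0 lam q_ge0 a0.
have G2lim : tricomiG lam q y @[y --> a^'+] --> tricomiG lam q a.
  apply: cvg_at_right_filter; have [dG _] := kummer_system2 lam q_ge0 a0.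
  exact: is_derive_cont dG.
rewrite (ruin_deficitE lam_gt0 q_ge0 N_poisson C_iid NC_indep (X_segerdahl z) z0
  (ltW a0) az G2a G2lim th) K2_tricomiF// K2_tricomiG// [expR (- a)]expRN; congr _%:E; field.
by rewrite !gt_eqF ?expR_gt0.
Qed.

Lemma ruin_deficit_level0 z theta : 0 < z -> - 1 < theta ->
  ruin_deficit P q theta (X z) 0 =
  (lam * Gamma (1 + q) / Gamma (1 + q + lam) *
           (expR (- z) * z `^ n * tricomiU (q + 1) (n + 1) z) / (1 + theta))%:E.
Proof.
move=> z0 th.
have th1 : 0 < 1 + theta by rewrite -ltrBlDl sub0r.
have Gq : 0 < Gamma (q + 1) by rewrite Gamma_gt0 ?lerDr.
have Gn : 0 < Gamma (n + 1) by rewrite Gamma_gt0 ?lerDr// ltW.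
have L0 := divr_gt0 Gn Gq.
rewrite (ruin_deficitE lam_gt0 q_ge0 N_poisson C_iid NC_indep (X_segerdahl z) z0
  (lexx 0) (ltW z0) L0 (tricomiG_cvg0 lam_gt0 q_ge0) th) tricomiF_tricomi// expR0.
have -> : 1 + q + lam = n + 1 by ring.
rewrite [1 + q]addrC; congr _%:E.
move: (lt0r_neq0 Gq) (lt0r_neq0 Gn) (lt0r_neq0 th1).
move: (Gamma _) (Gamma _) (z `^ n) (tricomiU _ _ _) (expR _) => g1 g2 p u e g10 g20 th0.
by field; rewrite g10 g20 th0.
Qed.

Lemma ruin_as_deficit z a : ruin P q (X z) a = ruin_deficit P q 0 (X z) a.
Proof.
by rewrite /ruin_deficit /ruin; congr ('E_P[_])%E; apply/funext => w; rewrite mul0r expR0 mulr1.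
Qed.

Lemma ruin_level_pos a z : 0 < a -> a <= z ->
  ruin P q (X z) a = (lam * (K2 q n z / K2 q (n + 1) a))%:E.
Proof. by move=> a0 az; rewrite ruin_as_deficit ruin_deficit_level_pos// addr0 divr1. Qed.

Lemma ruin_before_level_pos a z b : 0 < a -> a <= z -> z <= b ->
  ruin_before P q (X z) a b =
  (lam * (K2 q n z / K2 q (n + 1) a) -
   scaleW lam q z a / scaleW lam q b a * (lam * (K2 q n b / K2 q (n + 1) a)))%:E.
Proof.
move=> a0 az zb; have z0 := lt_le_trans a0 az; have b0 := lt_le_trans z0 zb.
have G2a := tricomiG_gt0 lam q_ge0 a0.
have G2lim : tricomiG lam q y @[y --> a^'+] --> tricomiG lam q a.
  apply: cvg_at_right_filter; have [dG _] := kummer_system2 lam q_ge0 a0.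
  exact: is_derive_cont dG.
have := ruin_beforeE lam_gt0 q_ge0 N_poisson C_iid NC_indep (X_segerdahl z) z0
  (ltW a0) az G2a G2lim zb.
have [Wb ->] := scale_scaleW a0 az zb.
rewrite !K2_tricomiF// K2_tricomiG// -EFinM [expR (- a)]expRN.
move: (lt0r_neq0 G2a) (lt0r_neq0 (expR_gt0 a)) Wb.
move: (scaleW _ _ _ _) (scaleW _ _ _ _) (tricomiF _ _ z) (tricomiF _ _ b) (tricomiG _ _ a) (expR (- z)) (expR (- b)) (expR a).
move=> wz wb f2z f2b g2a ez eb ea g2a0 ea0 wb0.
case: ruin_before => [e|//|//]; rewrite -EFinD => -[E]; congr _%:E.
apply: (@addrI _ (lam * ea / g2a * (eb * f2b) * (wz / wb))); rewrite -E.
by field; rewrite wb0 g2a0 ea0.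
Qed.

Lemma Rintegral_survival (H : R -> R) c a : 0 < a ->
  (forall z, 0 < z -> H z = c * K1 q n z) ->
  \int[lebesgue_measure]_(y in `]0, a[) (expR (- y) * H (a - y)) =
  c * (K1 q (n + 1) a / (n + 1)).
Proof.
move=> a0 HE; rewrite -(Rintegral_K1 lam_gt0 q_ge0 a0) -RintegralZl//; last first.
  by have [_ + _] := q_harmonic_K1 lam_gt0 q_ge0 a0.
apply: eq_Rintegral => y; rewrite inE/= in_itv/= => /andP[y0 ya].
by rewrite HE ?subr_gt0//; ring.
Qed.

End Theorem2.

Theorem theorem2 (R : realType) (d : measure_display) (T : measurableType d)
    (P : probability T R) (lam q : R) (tau C : nat -> {RV P >-> R})
    (N : R -> T -> nat) (X : R -> R -> T -> R)
    (lam_gt0 : 0 < lam) (q_ge0 : 0 <= q)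
    (N_poisson : poisson_process lam tau N)
    (C_iid : iid_exponential 1 C)
    (NC_indep : independent_sequences tau C)
    (X_segerdahl : forall z : R, segerdahl_process 1 0 z N C (X z)) :
  let n := q + lam in
  let M := @kummerM R in
  let U := @tricomiU R in
  let Psi z a := ruin P q (X z) a in
  let W z a := K1 q n z -
    lam / (n + 1) * (K1 q (n + 1) a / K2 q (n + 1) a) * K2 q n z in
  let W2 z a := z `^ n * expR (- z) *
    \det (mx22 (M (1 + q) (lam + 1 + q) z) (M (1 + q) (lam + 2 + q) a)
               (lam * U (1 + q) (lam + 1 + q) z)
               ((lam + 1 + q) * U (1 + q) (lam + 2 + q) a)) in
  let D a u := (lam + q + 1) * M (q + 1) (n + 1) u * U (q + 1) (n + 2) a -
    lam * U (q + 1) (n + 1) u * M (q + 1) (n + 2) a in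
  let U_ratio (z : R) := U (q + 1) (n + 1) z / U (q + 1) (n + 2) z in
  let U_ratio0 := lim (U_ratio z @[z --> (0 : R)^'+]) in
  let ddW00 := (n - 1) * n * (1 - lam * n * U_ratio0 / (n + 1) ^+ 2)
               / Gamma (n + 1) in
  [/\
   (* 1 *)
   [/\ survival_function P q X (K1 q n),
       forall H : R -> R, survival_function P q X H ->
         exists2 c : R, c != 0 & forall z, 0 < z -> H z = c * K1 q n z,
       forall z, 0 < z ->
         K1 q n z = z `^ n * expR (- z) * M (q + 1) (n + 1) z /\
         K1 q n z = z `^ n * M lam (n + 1) (- z),
       q_harmonic lam q (K1 q n) /\
         (forall x y, 0 < x -> x < y -> K1 q n x < K1 q n y) &
       forall h : R -> R, q_harmonic lam q h ->
         (forall x y, 0 < x -> x < y -> h x <= h y) ->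
         exists c : R, forall z, 0 < z -> h z = c * K1 q n z],
   (* 2 *)
   [/\ forall z a, 0 < a -> a <= z ->
         Psi z a = (lam * (K2 q n z / K2 q (n + 1) a))%:E /\
         Psi z a = (lam * ((expR (- z) * z `^ n * U (q + 1) (n + 1) z) /
           (expR (- a) * a `^ (n + 1) * U (q + 1) (n + 2) a)))%:E,
       (z `^ (q + 1 + lam) * U (1 + q) (q + 2 + lam) z) @[z --> (0 : R)^'+]
         --> Gamma (1 + q + lam) / Gamma (1 + q) &
       forall z, 0 < z ->
         Psi z 0 = (lam * Gamma (1 + q) / Gamma (1 + q + lam) *
           (expR (- z) * z `^ n * U (q + 1) (n + 1) z))%:E],
   (* 3 *)
   forall z a theta, 0 <= a -> a <= z -> 0 < z -> - 1 < theta ->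
     ruin_deficit P q theta (X z) a = (Psi z a * (1 / (1 + theta))%:E)%E,
   (* 4 *)
   forall a, 0 < a ->
   [/\ [/\ scale_function P q X a (fun z => W z a),
           forall H : R -> R, survival_function P q X H ->
             scale_function P q X a (fun z => H z - fine (Psi z a) *
               \int[lebesgue_measure]_(y in `]0, a[)
                 (expR (- y) * H (a - y))) &
           forall z, a <= z ->
           [/\ W z a = K1 q n z - fine (Psi z a) *
                 \int[lebesgue_measure]_(y in `]0, a[)
                   (expR (- y) * K1 q n (a - y)),
               W z a = K1 q n z - fine (Psi z a) * (K1 q (n + 1) a / (n + 1)) &
               W z a = z `^ n * expR (- z) * (M (q + 1) (n + 1) z -
                 lam / (n + 1) * U (q + 1) (n + 1) z *
                 (M (q + 1) (n + 2) a / U (q + 1) (n + 2) a))]],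
       [/\ forall W' : R -> R, scale_function P q X a W' ->
             exists2 c : R, c != 0 & forall z, a <= z -> W' z = c * W z a,
           scale_function P q X a (fun z => W2 z a) &
           forall z, a <= z -> W2 z a = z `^ n * expR (- z) * D a z],
       forall z, a <= z ->
       [/\ derivable (fun x => W x a) z 1,
           derivable (fun x => W x a)^`()%classic z 1 &
           (fun x => W x a)^`(2)%classic z = (K1 q n)^`(2)%classic z -
             lam / (n + 1) * (K1 q (n + 1) a / K2 q (n + 1) a) *
             (K2 q n)^`(2)%classic z],
       (* with the coefficients corrected: Gamma (n + 1) on the left; in the
          first summand 1 / n and n * (n - q) - lam * n *)
       expR a * a `^ (- n + 2) / Gamma (n + 1) *
         (fun x => W x a)^`(2)%classic a =
         kummerM_reg (q + 1) (n + 2) a / n *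
           (lam * n * (a * n - a * q - n ^+ 2 + n) * U (q + 1) (n + 1) a /
              U (q + 1) (n + 2) a +
            a * (a - n + 1) * (n * (n - q) - lam * n)) +
         (- (a + 1) * n + a * q + n ^+ 2) * kummerM_reg (q + 1) (n + 1) a &
       (* the value at a = 0 of the normalized second derivative *)
       [/\ cvg (U_ratio z @[z --> (0 : R)^'+]),
           (expR x * x `^ (- n + 2) / Gamma (n + 1) *
             (fun z => W z x)^`(2)%classic x) @[x --> (0 : R)^'+] --> ddW00 &
           ddW00 < 0 <-> q + lam < 1]] &
   (* 5 *)
   forall a z b, 0 < a -> a <= z -> z <= b -> a < b ->
     ruin_before P q (X z) a b =
       (Psi z a - (W z a / W b a)%:E * Psi b a)%E /\
     ruin_before P q (X z) a b =
       (lam / a * ((expR (- z) * z `^ n * U (q + 1) (n + 1) z) /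
                   (expR (- a) * a `^ n * U (q + 1) (n + 2) a)) -
        lam / a * ((expR (- b) * b `^ n * U (q + 1) (n + 1) b) /
                   (expR (- a) * a `^ n * U (q + 1) (n + 2) a)) *
        (z / b) `^ n * expR (b - z) * (D a z / D a b))%:E].

Proof.
move=> n M U Psi W W2 D U_ratio U_ratio0 ddW00.
have n_gt0 : 0 < n by rewrite /n ltr_wpDl.
have n1_gt0 : 0 < n + 1 by rewrite addr_gt0.
have e2 : n + 2 = n + 1 + 1 by ring.
have e1q : 1 + q = q + 1 by rewrite addrC.
have el1 : lam + 1 + q = n + 1 by rewrite /n; ring.
have el2 : lam + 2 + q = n + 1 + 1 by rewrite /n; ring.
have elq : lam + q + 1 = n + 1 by rewrite /n; ring.
have U2_gt0 a : 0 < a -> 0 < U (q + 1) (n + 1 + 1) a by exact: tricomi_gt0.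
have Gn_gt0 : 0 < Gamma (n + 1) by rewrite Gamma_gt0// lerDr ltW.
have ruinE z a : 0 < a -> a <= z -> Psi z a = (lam * (K2 q n z / K2 q (n + 1) a))%:E.
  exact: ruin_level_pos lam_gt0 q_ge0 N_poisson C_iid NC_indep X_segerdahl a z.
(* [D] is the first normalization cleared of the denominator (n + 1) U(q + 1, n + 2, a), a positive
   factor free of z. *)
have WD z a : 0 < a -> W z a = z `^ n * expR (- z) * D a z / ((n + 1) * U (q + 1) (n + 1 + 1) a).
  move=> a0; have := U2_gt0 a a0; rewrite [W z a]scaleW_tricomi// /D /U /M e2 elq => U0.
  rewrite -/n; move: (lt0r_neq0 n1_gt0) (lt0r_neq0 U0).
  move: (n + 1) (z `^ n) (expR _) (kummerM _ _ z) (kummerM _ _ a) (tricomiU _ _ z) (tricomiU _ _ a).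
  by move=> p pz e m1 m2 u1 u2 p0 u20; field; rewrite p0 u20.
have W2E z a : W2 z a = z `^ n * expR (- z) * D a z.
  by rewrite /W2 /D det_mx22 e1q el1 el2 elq e2; ring.
have survK1 := survival_K1 lam_gt0 q_ge0 N_poisson C_iid NC_indep X_segerdahl.
have WE z a : scaleW lam q z a = W z a by [].
have scaleWP := scale_scaleW lam_gt0 q_ge0 N_poisson C_iid NC_indep X_segerdahl.
have W_gt0 z a : 0 < a -> a <= z -> 0 < W z a by exact: scaleW_gt0.
split.
- split.
  + exact: survK1.
  + exact: survival_unique lam_gt0 q_ge0 N_poisson C_iid NC_indep X_segerdahl.
  + by move=> z z0; split; [|exact: kummer_transformation].
  + by split; [exact: q_harmonic_K1|exact: K1_increasing].
  + by move=> h /(q_harmonic_unique lam_gt0 q_ge0) hK _.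
- split.
  + move=> z a a0 az; split; first exact: ruinE.
    rewrite (ruinE z a a0 az) /K2 /U e2.
    congr (lam * (_ * _ / (_ * _)))%:E; exact: mulrC.
  + have -> : 1 + q + lam = n + 1 by rewrite /n; ring.
    have -> : q + 1 + lam = n + 1 by rewrite /n; ring.
    have -> : q + 2 + lam = n + 1 + 1 by rewrite /n; ring.
    (* The function is [tricomiG] written with [tricomiU], so its limit is already known. *)
    rewrite e1q; apply: right_cvg_eq (tricomiG_cvg0 lam_gt0 q_ge0) => z z0.
    exact: tricomiG_tricomi.
  + move=> z z0; rewrite /Psi ruin_as_deficit.
    rewrite (ruin_deficit_level0 lam_gt0 q_ge0 N_poisson C_iid NC_indep X_segerdahl z0)//.
    by rewrite addr0 divr1.
- move=> z a theta a0 az z0 th; rewrite /Psi ruin_as_deficit.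
  (* The levels 0 and a > 0 are normalized differently, but in both theta enters only through 1 / (1
     + theta). *)
  move: a0; rewrite le_eqVlt => /predU1P[<-|a0].
    rewrite !(ruin_deficit_level0 lam_gt0 q_ge0 N_poisson C_iid NC_indep X_segerdahl z0)//.
    by rewrite -EFinM addr0 divr1 mul1r.
  rewrite !(ruin_deficit_level_pos lam_gt0 q_ge0 N_poisson C_iid NC_indep X_segerdahl a0 az)//.
  by rewrite -EFinM addr0 divr1 mul1r.
- move=> a a0; have U0 := U2_gt0 a a0.
  have WK z : a <= z -> W z a = K1 q n z - fine (Psi z a) * (K1 q (n + 1) a / (n + 1)).
    by move=> az; rewrite ruinE//= /W; ring.
  split.
  + split.
    * exact: scaleWP.
    * move=> H hH.
      have [c c0 HE] := survival_unique lam_gt0 q_ge0 N_poisson C_iid NC_indep X_segerdahl hH.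
      apply: (scale_proportional lam_gt0 q_ge0 N_poisson C_iid NC_indep X_segerdahl a0 c0).
      move=> z az; rewrite (Rintegral_survival lam_gt0 q_ge0 a0 HE).
      rewrite HE ?(lt_le_trans a0)// WE WK//; ring.
    * move=> z az; split; last 2 first.
      - exact: WK.
      - rewrite /M /U e2; exact: scaleW_tricomi.
      rewrite WK// (@Rintegral_survival _ _ _ lam_gt0 q_ge0 (K1 q n) 1 a a0) ?mul1r//.
      by move=> y _; rewrite mul1r.
  + split.
    * move=> W' hW'.
      exact: (scale_unique lam_gt0 q_ge0 N_poisson C_iid NC_indep X_segerdahl a0 hW').
    * apply: (scale_proportional lam_gt0 q_ge0 N_poisson C_iid NC_indep X_segerdahl a0
        (c := (n + 1) * U (q + 1) (n + 1 + 1) a)).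
        by rewrite gt_eqF// mulr_gt0.
      move=> z az; rewrite W2E WE WD//; field.
      by rewrite !gt_eqF.
    * by move=> z _; exact: W2E.
  + move=> z az; by apply: scaleW_derivatives => //; exact: lt_le_trans az.
  + have -> := scaleW_derive2_diag lam_gt0 q_ge0 a0.
    rewrite /kummerM_reg e2 GammaS// -/n /U.
    (* By [GammaS] both regularized functions are now over Gamma (n + 1); with n - q = lam the
       difference n (n - q) - lam n cancels and a rational identity remains. *)
    have -> : n - q = lam by rewrite /n; ring.
    move: (lt0r_neq0 n_gt0) (lt0r_neq0 n1_gt0) (lt0r_neq0 Gn_gt0) (lt0r_neq0 U0); rewrite /U.
    move: (n + 1) (Gamma _) (kummerM _ _ _) (kummerM _ _ _) (tricomiU _ _ _) (tricomiU _ _ _).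
    move=> p g m2 m1 u2 u1 n0 p0 g0 u20.
    field.
    by rewrite n0 p0 g0 u20.
  (* As the ratio of [U] functions tends to 0, [ddW00] is (n - 1) n / Gamma (n + 1), which has the
     sign of n - 1. *)
  + have lim0 : U_ratio z @[z --> (0 : R)^'+] --> (0 : R).
      by rewrite /U_ratio /U e2; exact: tricomi_ratio_cvg0.
    have dE : ddW00 = (n - 1) * n / Gamma (n + 1).
      rewrite /ddW00 /U_ratio0 (cvg_lim (@norm_hausdorff _ R) lim0).
      by rewrite mulr0 mul0r subr0 mulr1.
    split.
    * by apply/cvg_ex; exists 0.
    * rewrite dE; exact: scaleW_derive2_cvg.
    * by rewrite dE pmulr_llt0 ?invr_gt0// pmulr_llt0// subr_lt0.
- move=> a z b a0 az zb ab; have z0 := lt_le_trans a0 az; have b0 := lt_le_trans z0 zb.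
  have az' := ltW ab; have U0 := U2_gt0 a a0; have Wb := W_gt0 b a a0 az'.
  (* [W b a] is positive and is [D a b] times a factor, so the quotient D(z) / D(b) is
     legitimate. *)
  have Db : D a b != 0.
    by apply/eqP => Db; move: Wb; rewrite WD// Db mulr0 mul0r ltxx.
  rewrite (ruin_before_level_pos lam_gt0 q_ge0 N_poisson C_iid NC_indep X_segerdahl a0 az zb).
  rewrite !ruinE//; split => //; congr _%:E.
  rewrite !WE !WD// /K2 -/U e2 powRS//.
  have -> : z `^ n = (z / b) `^ n * b `^ n.
    have zb0 : 0 <= z / b by rewrite divr_ge0 ?ltW.
    by rewrite -powRM// ?divfK ?gt_eqF// ltW.
  have -> : expR (b - z) = expR (- z) / expR (- b) by rewrite -expRB; congr expR; ring.
  move: (lt0r_neq0 U0) (lt0r_neq0 n1_gt0) (lt0r_neq0 (powR_gt0 n a0)) (lt0r_neq0 (powR_gt0 n b0)).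
  move: (lt0r_neq0 (expR_gt0 (- a))) (lt0r_neq0 (expR_gt0 (- b))) (lt0r_neq0 a0) Db.
  move: (D a b) (D a z) (U _ _ a) (U _ _ z) (U _ _ b) (expR (- a)) (expR (- b)) (expR (- z)).
  move: (a `^ n) (b `^ n) ((z / b) `^ n) (n + 1) => an bn zn m Db Dz ua uz ub ea eb ez.
  move=> ea0 eb0 a_0 Db0 ua0 m0 an0 bn0; field.
  by rewrite ea0 eb0 a_0 Db0 ua0 m0 an0 bn0.
Qed.
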